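(* Let $\Lambda$ be a primitive $k$-graph such that for each $p\in\mathbb N^k$ the restrictions of $r$ and $s$ to $\Lambda^p$ are surjective (onto $\Lambda^0$) and finite-to-one. Then the fixed point algebra $C^*(\Lambda)^\alpha$ of the gauge action is a simple AF algebra, and hence so is the stable algebra $S=C^*(G_s(\Lambda))$.
   Context: **$k$-graphs.** Let $k\ge 1$; $\mathbb N=\{0,1,2,\dots\}$; $\mathbb N^k,\mathbb Z^k$ carry the coordinatewise order. A $k$-graph $(\Lambda,d)$ is a countable small category $\Lambda$ with a functor $d:\Lambda\to\mathbb N^k$ (degree) such that whenever $d(\lambda)=n_1+n_2$ there are unique $\nu_1,\nu_2\in\Lambda$ with $\lambda=\nu_1\nu_2$, $d(\nu_i)=n_i$. Put $\Lambda^n=d^{-1}(n)$; objects are identified with $\Lambda^0$; $r,s:\Lambda\to\Lambda^0$ are range and source; $\lambda\mu$ is defined when $s(\lambda)=r(\mu)$. $\Lambda$ is primitive if there is a nonzero $p\in\mathbb N^k$ such that for all $u,v\in\Lambda^0$ there is $\lambda\in\Lambda^p$ with $r(\lambda)=u$, $s(\lambda)=v$. (Under the hypothesis on $r,s$, a primitive $\Lambda$ has $\Lambda^0$ finite and is irreducible, meaning that any $u,v\in\Lambda^0$ are the range and source of some $\lambda$ with $d(\lambda)\ne0$; so $S$ below is defined.) **$C^*(\Lambda)$.** The universal $C^*$-algebra generated by partial isometries $\{s_\lambda:\lambda\in\Lambda\}$ such that $\{s_v:v\in\Lambda^0\}$ are mutually orthogonal projections; $s_{\lambda\mu}=s_\lambda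 s_\mu$ if $s(\lambda)=r(\mu)$; $s_\lambda^*s_\lambda=s_{s(\lambda)}$; and $s_v=\sum_{\lambda\in\Lambda^n,r(\lambda)=v}s_\lambda s_\lambda^*$ for $v\in\Lambda^0,n\in\mathbb N^k$. The gauge action $\alpha$ of $\mathbb T^k$ is $\alpha_z(s_\lambda)=z^{d(\lambda)}s_\lambda$. **Stable groupoid.** $\Delta=\{(m,n)\in\mathbb Z^k\times\mathbb Z^k:m\le n\}$ is a $k$-graph with $r(m,n)=m$, $s(m,n)=n$, $(\ell,m)(m,n)=(\ell,n)$, $d(m,n)=n-m$. $\Lambda^\Delta$ is the set of degree-preserving functors $x:\Delta\to\Lambda$, with the topology having basis $Z(\lambda,n)=\{x:x(n,n+d(\lambda))=\lambda\}$; $x(n)=x(n,n)$; the shift is $(\sigma^nx)(\ell,m)=x(\ell+n,m+n)$, $n\in\mathbb Z^k$. $x\sim_sy$ iff there is $m\in\mathbb Z^k$ with $x(m,n)=y(m,n)$ for all $n\ge m$. $G_s=\{(x,y):x\sim_sy\}$ is the groupoid of this equivalence relation ($r(x,y)=x$, $s(x,y)=y$), with the inductive limit topology from the subgroupoids $G_{s,m}=\{(x,y):x(m,n)=y(m,n)\ \forall n\ge m\}$ ($m\in\mathbb Z^k$), each with the relative topology from $\Lambda^\Delta\times\Lambda^\Delta$. **Haar system on $G_s$** ($\Lambda$ irreducible, $\Lambda^0$ finite). Let $|\Lambda^p|(u,v)$ be the number of $\lambda\in\Lambda^p$ with $r(\lambda)=u,s(\lambda)=v$. Fix (by Perron–Frobenius)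 $t\in(0,\infty)^k$ and $a,b:\Lambda^0\to(0,\infty)$ with $\sum_v a(v)b(v)=1$, $\sum_u a(u)|\Lambda^p|(u,v)=t^pa(v)$, $\sum_v|\Lambda^p|(u,v)b(v)=t^pb(u)$ for all $p\in\mathbb N^k$, where $t^p=\prod_i t_i^{p_i}$. For $x\in\Lambda^\Delta$ let $E_x=\{y:y(m,n)=x(m,n)\ \forall\,0\le m\le n\}$ and let $\mu_s^x$ be the measure on $E_x$ with $\mu_s^x(E_x\cap Z(\lambda,-d(\lambda)))=t^{-d(\lambda)}a(r(\lambda))$ for all $\lambda$ with $s(\lambda)=x(0)$. The stable class of $x$ is the increasing union over $p\in\mathbb N^k$ of the sets $\sigma^{-p}E_{\sigma^px}$; the measure on it whose restriction to $\sigma^{-p}E_{\sigma^px}$ is $B\mapsto t^p\mu_s^{\sigma^px}(\sigma^pB)$, multiplied by $\delta_x$, is $\tilde\mu_s^x$, and $\{\tilde\mu_s^x\}$ is the Haar system used to form $S=C^*(G_s)$. *)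

(* Defs.v *)
From HB Require Import structures.
From mathcomp Require Import all_boot all_order all_algebra.
From mathcomp Require Import all_classical all_reals all_analysis.
From mathcomp Require Import finmap complex.

Set Implicit Arguments.
Unset Strict Implicit.
Unset Printing Implicit Defensive.

Import Order.TTheory GRing.Theory Num.Theory.
Import numFieldNormedType.Exports.

Local Open Scope classical_set_scope.
Local Open Scope ring_scope.

(** * Multi-indices *)

Notation Nk k := {ffun 'I_k -> nat}.
Notation Zk k := {ffun 'I_k -> int}.

Definition toZ k (p : Nk k) : Zk k := [ffun i => (p i)%:Z].

Definition lez k (m n : Zk k) : bool := [forall i, m i <= n i].

Lemma lezz k (n : Zk k) : lez n n.
Proof. exact/forallP. Qed.

Lemma lez_trans k (l m n : Zk k) : lez l m -> lez m n -> lez l n.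
Proof.
move=> /forallP lm /forallP mn; apply/forallP => i.
exact: le_trans (lm i) (mn i).
Qed.

Lemma lez_add k (p m n : Zk k) : lez m n -> lez (m + p) (n + p).
Proof. by move=> /forallP mn; apply/forallP => i; rewrite !ffunE lerD2r. Qed.

Lemma lez_addN k (n : Zk k) (p : Nk k) : lez n (n + toZ p).
Proof. by apply/forallP => i; rewrite !ffunE lerDl. Qed.

Definition mpow (F : fieldType) k (t : 'I_k -> F) (p : Nk k) : F :=
  \prod_(i < k) t i ^+ p i.

(** * k-graphs *)

(* [kg_comp] is total, but it only means something on composable pairs.
   An object [v] corresponds to the degree-0 morphism [kg_id v]. *)
Record kgraph (k : nat) := KGraph {
  kg_obj : countType;
  kg_mor :> countType;
  kg_r : kg_mor -> kg_obj;
  kg_s : kg_mor -> kg_obj;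
  kg_id : kg_obj -> kg_mor;
  kg_comp : kg_mor -> kg_mor -> kg_mor;
  kg_d : kg_mor -> Nk k;
  kg_r_id : forall v, kg_r (kg_id v) = v;
  kg_s_id : forall v, kg_s (kg_id v) = v;
  kg_r_comp : forall x y, kg_s x = kg_r y -> kg_r (kg_comp x y) = kg_r x;
  kg_s_comp : forall x y, kg_s x = kg_r y -> kg_s (kg_comp x y) = kg_s y;
  kg_compA : forall x y z, kg_s x = kg_r y -> kg_s y = kg_r z ->
    kg_comp x (kg_comp y z) = kg_comp (kg_comp x y) z;
  kg_id_comp : forall x, kg_comp (kg_id (kg_r x)) x = x;
  kg_comp_id : forall x, kg_comp x (kg_id (kg_s x)) = x;
  kg_d_id : forall v, kg_d (kg_id v) = 0;
  kg_d_comp : forall x y, kg_s x = kg_r y ->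
    kg_d (kg_comp x y) = kg_d x + kg_d y;
  kg_factor : forall x n1 n2, kg_d x = n1 + n2 ->
    exists! y : kg_mor * kg_mor,
      [/\ kg_s y.1 = kg_r y.2, x = kg_comp y.1 y.2,
          kg_d y.1 = n1 & kg_d y.2 = n2]
}.

Section KGraphs.
Variables (k : nat) (L : kgraph k).

Definition primitive : Prop :=
  exists2 p : Nk k, p <> 0 &
    forall u v : kg_obj L, exists x : L, [/\ kg_d x = p, kg_r x = u & kg_s x = v].

(* For each p, the map f : Lambda^p -> Lambda^0 is onto and finite-to-one. *)
Definition surjective_finite_to_one (f : L -> kg_obj L) : Prop :=
  forall (p : Nk k) (v : kg_obj L),
    [set x : L | kg_d x = p /\ f x = v] !=set0 /\
    finite_set [set x : L | kg_d x = p /\ f x = v].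

Definition count_mor (p : Nk k) (u v : kg_obj L) : nat :=
  #|` fset_set [set x : L | [/\ kg_d x = p, kg_r x = u & kg_s x = v]] |.

(** ** The two-sided path space and the stable equivalence relation *)

(* A degree-preserving functor from Delta to Lambda: [bp_obj n] is x(n) and
   [bp h] is x(m,n), for h : m <= n. *)
Record bipath := Bipath {
  bp_obj : Zk k -> kg_obj L;
  bp : forall m n : Zk k, lez m n -> L;
  bp_r : forall m n (h : lez m n), kg_r (bp h) = bp_obj m;
  bp_s : forall m n (h : lez m n), kg_s (bp h) = bp_obj n;
  bp_id : forall n, bp (lezz n) = kg_id (bp_obj n);
  bp_comp : forall l m n (h : lez l m) (h' : lez m n),
    bp (lez_trans h h') = kg_comp (bp h) (bp h');
  bp_d : forall m n (h : lez m n), toZ (kg_d (bp h)) = n - m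
}.

HB.instance Definition _ := gen_eqMixin bipath.
HB.instance Definition _ := gen_choiceMixin bipath.

Definition cylinder (x : L) (n : Zk k) : set bipath :=
  [set y | bp y (lez_addN n (kg_d x)) = x].

(* The topology generated by the cylinders (they in fact form a basis). *)
HB.instance Definition _ := @isSubBaseTopological.Build bipath
  (set bipath) [set U | exists x n, U = cylinder x n] id.

Section Shift.
Variables (p : Zk k) (x : bipath).

Definition shift_bp m n (h : lez m n) : L := bp x (lez_add p h).

Fact shift_r m n (h : lez m n) : kg_r (shift_bp h) = bp_obj x (m + p).
Proof. exact: bp_r. Qed.

Fact shift_s m n (h : lez m n) : kg_s (shift_bp h) = bp_obj x (n + p).
Proof. exact: bp_s. Qed.

Fact shift_id n : shift_bp (lezz n) = kg_id (bp_obj x (n + p)).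
Proof. by rewrite /shift_bp (bool_irrelevance (lez_add _ _) (lezz _)) bp_id. Qed.

Fact shift_comp l m n (h : lez l m) (h' : lez m n) :
  shift_bp (lez_trans h h') = kg_comp (shift_bp h) (shift_bp h').
Proof.
by rewrite /shift_bp -bp_comp; congr (bp x _); exact: bool_irrelevance.
Qed.

Fact shift_d m n (h : lez m n) : toZ (kg_d (shift_bp h)) = n - m.
Proof. by rewrite bp_d opprD addrACA subrr addr0. Qed.

Definition path_shift : bipath :=
  Bipath shift_r shift_s shift_id shift_comp shift_d.

End Shift.

Definition agree_from (m : Zk k) (x y : bipath) : Prop :=
  forall n (h : lez m n), bp x h = bp y h.

Definition stable (x y : bipath) : Prop := exists m, agree_from m x y.

Definition Gs : Type := {xy : bipath * bipath | stable xy.1 xy.2}.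

HB.instance Definition _ := gen_eqMixin Gs.
HB.instance Definition _ := gen_choiceMixin Gs.

(* The inductive limit topology: U is open iff its trace on each subgroupoid
   G_{s,m} is open for the topology induced by the product topology. *)
Definition Gs_open (U : set Gs) : Prop :=
  forall m, exists2 V : set (bipath * bipath), open V &
    forall g : Gs, agree_from m (sval g).1 (sval g).2 -> U g <-> V (sval g).

Fact Gs_openT : Gs_open setT.
Proof. by move=> m; exists setT => //; exact: openT. Qed.

Fact Gs_openI : setI_closed Gs_open.
Proof.
move=> A B oA oB m; have [V oV AV] := oA m; have [W oW BW] := oB m.
exists (V `&` W); first exact: openI.
by move=> g gm; split=> -[/(AV g gm) ? /(BW g gm) ?]; split.
Qed.

Fact Gs_open_bigU (I : Type) (f : I -> set Gs) :
  (forall i, Gs_open (f i)) -> Gs_open (\bigcup_i f i).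
Proof.
move=> of_ m; have /choice[V VP] : forall i, exists V : set (bipath * bipath),
    open V /\ forall g : Gs, agree_from m (sval g).1 (sval g).2 ->
      f i g <-> V (sval g).
  by move=> i; have [V oV fV] := of_ i m; exists V.
exists (\bigcup_i V i); first by apply: bigcup_open => i _; have [] := VP i.
move=> g gm; split=> -[i _ ig]; exists i => //; exact/(VP i).2.
Qed.

HB.instance Definition _ :=
  isOpenTopological.Build Gs Gs_openT Gs_openI Gs_open_bigU.

(* MathComp-Analysis requires measurable types to be pointed; the path space
   has no canonical point, so we point it at a chosen path [x]. The point plays
   no role: the Borel sets do not depend on it. *)
Definition bipath_at (x : bipath) : Type := bipath.
HB.instance Definition _ x := Choice.on (bipath_at x).
HB.instance Definition _ x := isPointed.Build (bipath_at x) x.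

Definition borel_at (x : bipath) :=
  g_sigma_algebraType (@open bipath : set (set (bipath_at x))).

End KGraphs.

(** * C*-algebras *)

Section Cstar.
Variable R : realType.
Local Notation C := (complex R).

(* Complex C*-algebras, not necessarily unital *)
Record cstar := Cstar {
  cs_car :> completeNormedModType C;
  cs_mul : cs_car -> cs_car -> cs_car;
  cs_adj : cs_car -> cs_car;
  cs_mulA : forall x y z, cs_mul x (cs_mul y z) = cs_mul (cs_mul x y) z;
  cs_mulDl : forall x y z, cs_mul (x + y) z = cs_mul x z + cs_mul y z;
  cs_mulDr : forall x y z, cs_mul x (y + z) = cs_mul x y + cs_mul x z;
  cs_mulZl : forall (c : C) x y, cs_mul (c *: x) y = c *: cs_mul x y;
  cs_mulZr : forall (c : C) x y, cs_mul x (c *: y) = c *: cs_mul x y;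
  cs_adjK : forall x, cs_adj (cs_adj x) = x;
  cs_adjD : forall x y, cs_adj (x + y) = cs_adj x + cs_adj y;
  cs_adjZ : forall (c : C) x, cs_adj (c *: x) = c^* *: cs_adj x;
  cs_adjM : forall x y, cs_adj (cs_mul x y) = cs_mul (cs_adj y) (cs_adj x);
  cs_normM : forall x y, `|cs_mul x y| <= `|x| * `|y|;
  cs_norm_adj : forall x, `|cs_mul (cs_adj x) x| = `|x| ^+ 2
}.

Local Notation "x ** y" := (cs_mul x y) (at level 40, left associativity).
Local Notation "x ^#" := (cs_adj x) (at level 2, format "x ^#").

Definition star_hom (A B : cstar) (f : A -> B) : Prop :=
  [/\ forall x y, f (x + y) = f x + f y,
      forall (c : C) x, f (c *: x) = c *: f x,
      forall x y, f (x ** y) = f x ** f y &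
      forall x, f x^# = (f x)^#].

Definition subspace (A : cstar) (B : set A) : Prop :=
  [/\ B 0, forall x y, B x -> B y -> B (x + y) &
      forall (c : C) x, B x -> B (c *: x)].

Definition star_subalgebra (A : cstar) (B : set A) : Prop :=
  [/\ subspace B, forall x y, B x -> B y -> B (x ** y) &
      forall x, B x -> B x^#].

Definition cstar_subalgebra (A : cstar) (B : set A) : Prop :=
  star_subalgebra B /\ closed B.

Definition finite_dim (A : cstar) (B : set A) : Prop :=
  exists n (e : 'I_n -> A),
    forall x, B x -> exists c : 'I_n -> C, x = \sum_(i < n) c i *: e i.

(* In the next two definitions B is a C*-subalgebra of A, regarded as a
   C*-algebra in its own right (take B = setT for A itself). *)

Definition simple_algebra (A : cstar) (B : set A) : Prop :=
  (exists2 x, B x & x <> 0) /\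
  forall I : set A, I `<=` B -> subspace I -> closed I ->
    (forall x y, B x -> I y -> I (x ** y) /\ I (y ** x)) ->
    I = [set 0] \/ I = B.

(* B is the closure of the union of an increasing sequence of
   finite-dimensional C*-subalgebras. *)
Definition AF_algebra (A : cstar) (B : set A) : Prop :=
  exists F : nat -> set A,
    [/\ forall n, star_subalgebra (F n) /\ finite_dim (F n),
        forall n, F n `<=` F n.+1 &
        closure (\bigcup_n F n) = B].

Definition simple_AF_algebra (A : cstar) (B : set A) : Prop :=
  [/\ cstar_subalgebra B, simple_algebra B & AF_algebra B].

(** ** The C*-algebra of a k-graph *)

Section KGraphAlgebra.
Variables (k : nat) (L : kgraph k).

(* The fsbig sum in the last relation is the genuine sum as soon as each set
   v Lambda^n is finite (MathComp-Analysis sets it to 0 otherwise). *)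
Definition ck_family (A : cstar) (S : L -> A) : Prop :=
  [/\ forall x, S x ** (S x)^# ** S x = S x,
      (forall v, S (kg_id v) ** S (kg_id v) = S (kg_id v) /\
         (S (kg_id v))^# = S (kg_id v)) /\
      (forall u v, u <> v -> S (kg_id u) ** S (kg_id v) = 0),
      forall x y, kg_s x = kg_r y -> S (kg_comp x y) = S x ** S y,
      forall x, (S x)^# ** S x = S (kg_id (kg_s x)) &
      forall v (n : Nk k), S (kg_id v) =
        \sum_(x \in [set x : L | kg_d x = n /\ kg_r x = v]) S x ** (S x)^#].

(* (A, S) is C*(Lambda) with its generating family *)
Definition is_kgraph_algebra (A : cstar) (S : L -> A) : Prop :=
  [/\ ck_family S,
      forall B : set A, cstar_subalgebra B -> (forall x, B (S x)) -> B = setT &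
      forall (B : cstar) (T : L -> B), ck_family T ->
        exists2 f : A -> B, star_hom f & forall x, f (S x) = T x].

Definition torus : set ('I_k -> C) := [set z | forall i, `|z i| = 1].

(* On T^k these conditions determine [al] (as S generates A), and they force it
   to be a group action by automorphisms; outside T^k its values are unused. *)
Definition is_gauge_action (A : cstar) (S : L -> A)
    (al : ('I_k -> C) -> A -> A) : Prop :=
  forall z, torus z ->
    star_hom (al z) /\ forall x : L, al z (S x) = mpow z (kg_d x) *: S x.

Definition fixed_points (A : cstar) (al : ('I_k -> C) -> A -> A) : set A :=
  [set a | forall z, torus z -> al z a = a].

End KGraphAlgebra.

(** * The Haar system on the stable groupoid *)

Section Haar.
Variables (k : nat) (L : kgraph k).

Definition perron_frobenius (t : 'I_k -> R) (a b : kg_obj L -> R) : Prop :=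
  [/\ forall i, 0 < t i,
      forall v, 0 < a v /\ 0 < b v,
      \sum_(v \in [set: kg_obj L]) a v * b v = 1,
      forall p v, \sum_(u \in [set: kg_obj L]) a u * (count_mor p u v)%:R =
        mpow t p * a v &
      forall p u, \sum_(v \in [set: kg_obj L]) (count_mor p u v)%:R * b v =
        mpow t p * b u].

Definition local_stable_set (x : bipath L) : set (bipath L) :=
  [set y | forall m n (h : lez m n), lez 0 m -> bp y h = bp x h].

(* The family mu_s^x, each extended by 0 from E_x to the whole path space *)
Definition local_measures (t : 'I_k -> R) (a : kg_obj L -> R)
    (mu : forall x : bipath L, {measure set (borel_at x) -> \bar R}) : Prop :=
  forall x, mu x (~` local_stable_set x) = 0%E /\
    forall l : L, kg_s l = bp_obj x 0 ->
      mu x (local_stable_set x `&` cylinder l (- toZ (kg_d l))) =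
        ((mpow t (kg_d l))^-1 * a (kg_r l))%:E.

(* [mut x] is the second factor of delta_x x mu, i.e. the measure on the stable
   class of x, extended by 0 to the whole path space. *)
Definition stable_haar_system (t : 'I_k -> R) (a : kg_obj L -> R)
    (mut : forall x : bipath L, {measure set (borel_at x) -> \bar R}) : Prop :=
  exists2 mu : forall x : bipath L, {measure set (borel_at x) -> \bar R},
    local_measures t a mu &
    forall x, mut x (~` stable x) = 0%E /\
      forall (p : Nk k) (B : set (borel_at x)), measurable B ->
        B `<=` path_shift (toZ p) @^-1` local_stable_set (path_shift (toZ p) x) ->
        mut x B = ((mpow t p)%:E * mu (path_shift (toZ p) x) (path_shift (toZ p) @` B))%E.

(** ** The groupoid C*-algebra *)

Variable mut : forall x : bipath L, {measure set (borel_at x) -> \bar R}.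

Definition Cc : set (Gs L -> C) :=
  [set f | continuous (f : Gs L -> C^o) /\ compact (closure [set g | f g != 0])].

(* f(x,y), extended by 0 off the groupoid *)
Definition ev (f : Gs L -> C) (x y : bipath L) : C :=
  if pselect (stable x y) is left h
  then f (exist (fun xy => stable xy.1 xy.2) (x, y) h) else 0.

Definition Cintegral (x : bipath L) (f : bipath L -> C) : C :=
  Complex (\int[mut x]_(y in setT) complex.Re (f y))
          (\int[mut x]_(y in setT) complex.Im (f y)).

(* (f * g)(x,y) = \int f(x,z) g(z,y) d mut^x(z) *)
Definition convol (f g : Gs L -> C) : Gs L -> C := fun xy =>
  Cintegral (sval xy).1
    (fun z => ev f (sval xy).1 z * ev g z (sval xy).2).

Definition invol (f : Gs L -> C) : Gs L -> C := fun xy =>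
  (ev f (sval xy).2 (sval xy).1)^*.

Definition I_norm (f : Gs L -> C) : \bar R :=
  maxe
    (ereal_sup [set (\int[mut x]_(y in setT) (complex.Re `|ev f x y|)%:E)%E
               | x in [set: bipath L]])
    (ereal_sup [set (\int[mut x]_(y in setT) (complex.Re `|ev f y x|)%:E)%E
               | x in [set: bipath L]]).

Record hilbert := Hilbert {
  hs_car :> completeNormedModType C;
  hs_ip : hs_car -> hs_car -> C;
  hs_ipDl : forall x y z, hs_ip (x + y) z = hs_ip x z + hs_ip y z;
  hs_ipZl : forall (c : C) x y, hs_ip (c *: x) y = c * hs_ip x y;
  hs_ipC : forall x y, hs_ip x y = (hs_ip y x)^*;
  hs_ip_norm : forall x, hs_ip x x = `|x| ^+ 2
}.

(* I-norm bounded *-representations of C_c(G_s) on H (only the values of [pi]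
   on C_c(G_s) matter; [pi f] is a bounded operator by the last clause) *)
Definition representation (H : hilbert) (pi : (Gs L -> C) -> H -> H) : Prop :=
  [/\ forall f, Cc f -> forall (c : C) v w, pi f (c *: v + w) = c *: pi f v + pi f w,
      forall f g, Cc f -> Cc g -> forall (c : C) v,
        pi (fun x => c * f x + g x) v = c *: pi f v + pi g v,
      forall f g, Cc f -> Cc g -> forall v, pi (convol f g) v = pi f (pi g v),
      forall f, Cc f -> forall v w, hs_ip (pi f v) w = hs_ip v (pi (invol f) w) &
      forall f, Cc f -> forall v, `|pi f v| <= (fine (I_norm f))%:C%C * `|v|].

(* (S, iota) is the completion of C_c(G_s) in the norm
   ||f|| = sup { ||pi(f)|| : pi an I-norm bounded *-representation }. *)
Definition is_stable_algebra (S : cstar) (iota : (Gs L -> C) -> S) : Prop :=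
  [/\ forall f g, Cc f -> Cc g -> forall c : C,
        iota (fun x => c * f x + g x) = c *: iota f + iota g,
      forall f g, Cc f -> Cc g -> iota (convol f g) = iota f ** iota g,
      forall f, Cc f -> iota (invol f) = (iota f)^#,
      closure (iota @` Cc) = setT &
      forall f, Cc f ->
        (forall (H : hilbert) (pi : (Gs L -> C) -> H -> H), representation pi ->
           forall v, `|pi f v| <= `|iota f| * `|v|) /\
        (forall M : C, 0 <= M ->
           (forall (H : hilbert) (pi : (Gs L -> C) -> H -> H),
              representation pi -> forall v, `|pi f v| <= M * `|v|) ->
           `|iota f| <= M)].

End Haar.
End Cstar.

(* Main.v *)
(* Both algebras are closures of the span of a nested sequence of systems of matrix units, indexed at
   level N by the paths of degree (N, ..., N) for the fixed point algebra, and by the windows x(-N, N)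
   for S. Primitivity shows that, for M large, every diagonal unit of level M is of the form x e y for
   any given diagonal unit e of level N, so an ideal that contains one diagonal unit is everything.
   A nonzero closed ideal does contain one: matrix algebras map contractively, so an element of the
   ideal close to a level-N matrix of larger norm can be compressed to an element at distance < 1 from
   a diagonal unit.

   A fixed point of the gauge action is a limit of combinations of s_x s_y^*, and averaging over
   suitable elements of the torus removes the terms with d(x) <> d(y). For S, the functions that are
   constant on cells of windows are uniformly dense in C_c(G_s) with control of supports, hence dense
   for the I-norm. Nonvanishing comes from concrete representations: on l^2 of the one-sided paths for
   C*(Lambda), and on L^2 of one stable class for S. *)

From HB Require Import structures.
From mathcomp Require Import all_boot all_order all_algebra.
From mathcomp Require Import all_classical all_reals all_analysis.
From mathcomp Require Import measurable_realfun finmap complex lra ring zify.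

Require Import Defs.

Set Implicit Arguments.
Unset Strict Implicit.
Unset Printing Implicit Defensive.

Import Order.TTheory GRing.Theory Num.Theory.
Import numFieldNormedType.Exports.

Local Open Scope classical_set_scope.
Local Open Scope ring_scope.

(** * C*-algebra preliminaries *)

(** All estimates in C*-algebras rest on the C*-identity and on a convergent iteration for the
    square root of 1 - a; neither spectra nor positive elements occur. The algebras need not have a
    unit, so unitaries are formal: they are replaced by norm-preserving maps x |-> a x + i (x - c
    x). Two facts require this. The gauge automorphisms are given only as star homomorphisms, so
    they must be shown contractive before approximants can be averaged. And the relations do not say
    that the projections S_x S_x^# of one degree and range are orthogonal, only that they add up to
    a projection. For S the matrix units are indicators of cells of pairs divided by sqrt(w_i w_j),
    where w_i = t^(-N) a(r(i)) is the Haar measure attached to the window i. The norm of S is at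
    most the I-norm, which gives density, but a lower bound needs a representation of all of C_c.
    The kernel operators on L^2 are built on functions constant on cells, where everything is a
    finite matrix, and extended along uniform limits with support in one fixed G_{s,m}; those are
    limits in the I-norm too. *)

Section NormedC.
Variable R : realType.
Local Notation C := (complex R).

(** The norm of a complex normed space takes its values in C; its real part carries the same
    information and makes real arithmetic applicable. *)
Definition nm (V : normedZmodType C) (x : V) : R := complex.Re `|x|.

Lemma nmE (V : normedZmodType C) (x : V) : `|x| = (nm x)%:C%C.
Proof. by rewrite /nm RRe_real ?ger0_real. Qed.

Lemma nm_ge0 (V : normedZmodType C) (x : V) : 0 <= nm x.
Proof. by rewrite -lecR -nmE; exact: normr_ge0. Qed.

Lemma nm0 (V : normedZmodType C) : nm (0 : V) = 0.
Proof. by rewrite /nm normr0. Qed.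

Lemma nm_eq0 (V : normedZmodType C) (x : V) : nm x <= 0 -> x = 0.
Proof.
move=> x0; apply: normr0_eq0; apply/eqP; rewrite nmE.
by have /eqP -> : nm x == 0 by rewrite eq_le x0 nm_ge0.
Qed.

Lemma nmN (V : normedZmodType C) (x : V) : nm (- x) = nm x.
Proof. by rewrite /nm normrN. Qed.

Lemma nmD (V : normedZmodType C) (x y : V) : nm (x + y) <= nm x + nm y.
Proof. by rewrite -lecR rmorphD /= -!nmE ler_normD. Qed.

Lemma nmB (V : normedZmodType C) (x y : V) : nm (x - y) = nm (y - x).
Proof. by rewrite /nm distrC. Qed.

Lemma nm_tri (V : normedZmodType C) (x y z : V) : nm (x - z) <= nm (x - y) + nm (y - z).
Proof. by rewrite -(subrKA y) nmD. Qed.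

Lemma nmZ (V : normedModType C) (c : C) (x : V) : nm (c *: x) = nm c * nm x.
Proof.
by apply: (@complexI R); rewrite rmorphM /= -!nmE normrZ.
Qed.

Lemma nmM (c d : C) : nm (c * d) = nm c * nm d.
Proof. by apply: (@complexI R); rewrite rmorphM /= -!nmE normrM. Qed.

Lemma nmR (r : R) : nm (r%:C%C : C) = `|r|.
Proof. by rewrite /nm normc_def /= expr0n addr0 sqrtr_sqr. Qed.

Lemma nm_i : nm ('i%C : C) = 1.
Proof. by rewrite /nm normc_def /= expr0n add0r expr1n sqrtr1. Qed.

Lemma nm_conj (c : C) : nm (c^*) = nm c.
Proof. by rewrite /nm norm_conjC. Qed.

Lemma nm1 : nm (1 : C) = 1.
Proof. by rewrite /nm normr1. Qed.

Lemma nm_sum (V : normedZmodType C) (I : Type) (r : seq I) (P : pred I) (F : I -> V) :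
  nm (\sum_(i <- r | P i) F i) <= \sum_(i <- r | P i) nm (F i).
Proof.
elim/big_rec2: _ => [|i y x _ le]; first by rewrite nm0.
by apply: le_trans (nmD _ _) _; rewrite lerD2l.
Qed.

Lemma ballC (V : normedModType C) (x y : V) (e : R) : ball x e%:C%C y <-> nm (x - y) < e.
Proof. by rewrite -ball_normE /ball_ /= nmE ltcR. Qed.

Lemma nbhsC (V : normedModType C) (x : V) (S : set V) :
  nbhs x S <-> exists2 e : R, 0 < e & forall y, nm (x - y) < e -> S y.
Proof.
split=> [/nbhs_ballP[e /= e0 eS]|[e e0 eS]].
  exists (complex.Re e); first by move: e0; rewrite ltcE /= => /andP[].
  move=> y xy; apply: eS; rewrite -(RRe_real (gtr0_real e0)).
  exact/ballC.
apply/nbhs_ballP; exists e%:C%C; first by rewrite /= ltcR.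
by move=> y /ballC /eS.
Qed.

Lemma closureC (V : normedModType C) (S : set V) x :
  closure S x <-> forall e : R, 0 < e -> exists2 y, S y & nm (x - y) < e.
Proof.
split=> [cx e e0|h B /nbhsC[e e0 eB]].
  have /cx[y [Sy xy]] : nbhs x [set y | nm (x - y) < e] by apply/nbhsC; exists e.
  by exists y.
by have [y Sy /eB By] := h e e0; exists y.
Qed.

Lemma closedC (V : normedModType C) (S : set V) :
  closed S <-> forall x, (forall e : R, 0 < e -> exists2 y, S y & nm (x - y) < e) -> S x.
Proof.
rewrite closure_id; split=> [E x h|h].
  by rewrite E; apply/closureC.
apply/seteqP; split; first exact: subset_closure.
by move=> x /closureC; exact: h.
Qed.

Lemma complete_seq (V : completeNormedModType C) (u : nat -> V) :
  (forall e : R, 0 < e -> exists N : nat, forall m n, (N <= m)%N -> (N <= n)%N -> nm (u m - u n) < e) ->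
  exists l, forall e : R, 0 < e -> exists N : nat, forall n, (N <= n)%N -> nm (u n - l) < e.
Proof.
move=> cu; have /cauchy_cvgP/cvg_ex[l ul] : cauchy (u @ \oo).
  apply: cauchy_exP => e e0.
  have [|N NP] := cu (complex.Re e); first by move: e0; rewrite ltcE /= => /andP[].
  exists (u N); exists N => // n /= Nn; rewrite -(RRe_real (gtr0_real e0)).
  exact/ballC/NP.
exists l => e e0.
have /ul[N _ NP] : nbhs l [set y | nm (l - y) < e] by apply/nbhsC; exists e.
by exists N => n Nn; rewrite nmB; exact: NP.
Qed.

Lemma expr_small (q e : R) : 0 <= q -> q < 1 -> 0 < e -> exists N : nat, forall n, (N <= n)%N -> q ^+ n < e.
Proof.
move=> q0 q1 e0.
have : (fun n => q ^+ n) @ \oo --> (0 : R) by apply: cvg_expr; rewrite ger0_norm.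
move=> /cvgrPdist_lt/(_ e e0)[N _ NP]; exists N => n /NP /=.
by rewrite sub0r normrN ger0_norm // exprn_ge0.
Qed.

Lemma geometric_limit (V : completeNormedModType C) (u : nat -> V) (q K : R) :
  0 <= q -> q < 1 -> (forall n, nm (u n.+1 - u n) <= K * q ^+ n) ->
  exists l, forall e : R, 0 < e -> exists N : nat, forall n, (N <= n)%N -> nm (u n - l) < e.
Proof.
move=> q0 q1 uq; apply: complete_seq => e e0.
have K0 : 0 <= K by have := uq 0%N; rewrite expr0 mulr1; apply: le_trans; exact: nm_ge0.
have d0 : 0 < 1 - q by rewrite subr_gt0.
have tail n k : nm (u (n + k)%N - u n) <= K * q ^+ n / (1 - q) * (1 - q ^+ k).
  elim: k => [|k IH]; first by rewrite addn0 subrr nm0 expr0 subrr mulr0.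
  rewrite addnS; apply: le_trans (nm_tri _ (u (n + k)%N) _) _.
  apply: le_trans (lerD (uq _) IH) _.
  by rewrite le_eqVlt; apply/orP; left; apply/eqP; rewrite exprD exprS; field; rewrite gt_eqF.
have K1 : 0 < 2 * (K + 1) by lra.
have [N NP] := expr_small q0 q1 (divr_gt0 (mulr_gt0 e0 d0) K1).
exists N => m n Nm Nn.
have near p : (N <= p)%N -> nm (u p - u N) < e / 2.
  move=> /subnKC <-; apply: le_lt_trans (tail _ _) _.
  have qN : q ^+ N * (2 * (K + 1)) < e * (1 - q).
    by rewrite -ltr_pdivlMr; [apply: NP | lra].
  have qN0 : 0 <= q ^+ N by rewrite exprn_ge0.
  have qp0 : 0 <= q ^+ (p - N) by rewrite exprn_ge0.
  have : K * q ^+ N / (1 - q) <= e / 2 - q ^+ N / (1 - q).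
    rewrite lerBrDr -mulrDl ler_pdivrMr //; lra.
  have : 0 <= K * q ^+ N / (1 - q) by rewrite divr_ge0 ?mulr_ge0 // ltW.
  have : 0 <= q ^+ N / (1 - q) by rewrite divr_ge0 // ltW.
  have [->|/eqP qN1] := eqVneq (q ^+ N) 0; first by rewrite !mulr0 mul0r; lra.
  have : 0 < q ^+ N / (1 - q) by rewrite divr_gt0 // lt_neqAle qN0 andbT eq_sym; apply/eqP.
  nra.
apply: le_lt_trans (nm_tri _ (u N) _) _.
by have := near m Nm; have := near n Nn; rewrite (nmB (u N)); lra.
Qed.

End NormedC.

Notation "x ** y" := (cs_mul x y) (at level 40, left associativity).
Notation "x ^#" := (cs_adj x) (at level 2, format "x ^#").

(** * Elementary C*-algebra and the square root of 1 - a *)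

Section CstarBasics.
Variable R : realType.
Local Notation C := (complex R).
Implicit Types A B : cstar R.

Lemma cs_mul0 A (x : A) : x ** 0 = 0.
Proof. by have := cs_mulZr 0 x 0; rewrite !scale0r. Qed.

Lemma cs_0mul A (x : A) : 0 ** x = 0.
Proof. by have := cs_mulZl 0 0 x; rewrite !scale0r. Qed.

Lemma cs_mulNr A (x y : A) : x ** (- y) = - (x ** y).
Proof. by rewrite -scaleN1r cs_mulZr scaleN1r. Qed.

Lemma cs_mulNl A (x y : A) : (- x) ** y = - (x ** y).
Proof. by rewrite -scaleN1r cs_mulZl scaleN1r. Qed.

Lemma cs_mulBr A (x y z : A) : x ** (y - z) = x ** y - x ** z.
Proof. by rewrite cs_mulDr cs_mulNr. Qed.

Lemma cs_mulBl A (x y z : A) : (x - y) ** z = x ** z - y ** z.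
Proof. by rewrite cs_mulDl cs_mulNl. Qed.

Lemma cs_adj0 A : (0 : A)^# = 0.
Proof. by have := cs_adjZ 0 (0 : A); rewrite conjC0 !scale0r. Qed.

Lemma cs_adjN A (x : A) : (- x)^# = - x^#.
Proof. by rewrite -scaleN1r cs_adjZ conjCN1 scaleN1r. Qed.

Lemma cs_adjB A (x y : A) : (x - y)^# = x^# - y^#.
Proof. by rewrite cs_adjD cs_adjN. Qed.

Lemma cs_suml A (I : Type) (r : seq I) (P : pred I) (F : I -> A) x :
  (\sum_(i <- r | P i) F i) ** x = \sum_(i <- r | P i) F i ** x.
Proof.
by apply: (big_morph (fun y => y ** x)) => [y z|]; rewrite ?cs_mulDl ?cs_0mul.
Qed.

Lemma cs_sumr A (I : Type) (r : seq I) (P : pred I) (F : I -> A) x :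
  x ** (\sum_(i <- r | P i) F i) = \sum_(i <- r | P i) x ** F i.
Proof.
by apply: (big_morph (fun y => x ** y)) => [y z|]; rewrite ?cs_mulDr ?cs_mul0.
Qed.

Lemma cs_adj_sum A (I : Type) (r : seq I) (P : pred I) (F : I -> A) :
  (\sum_(i <- r | P i) F i)^# = \sum_(i <- r | P i) (F i)^#.
Proof.
by apply: (big_morph (fun y : A => y^#)) => [y z|]; rewrite ?cs_adjD ?cs_adj0.
Qed.

Lemma nm_cs_mul A (x y : A) : nm (x ** y) <= nm x * nm y.
Proof. by rewrite -lecR rmorphM /= -!nmE; exact: cs_normM. Qed.

Lemma nm_cstar A (x : A) : nm (x^# ** x) = nm x ^+ 2.
Proof. by apply: (@complexI R); rewrite rmorphXn /= -!nmE; exact: cs_norm_adj. Qed.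

(** Cancel ||y|| in ||y||^2 = ||y^# y|| <= ||y^#|| ||y||. *)
Lemma nm_adj A (x : A) : nm x^# = nm x.
Proof.
suff le y : nm y <= nm (y^# : A).
  by apply/eqP; rewrite eq_le le -{2}(cs_adjK x) le.
have [->|y0] := eqVneq (nm y) 0; first exact: nm_ge0.
have yp : 0 < nm y by rewrite lt_neqAle eq_sym y0 nm_ge0.
by rewrite -(ler_pM2r yp) -expr2 -nm_cstar nm_cs_mul.
Qed.

Lemma cs_adj_mul_eq0 A (x : A) : x^# ** x = 0 -> x = 0.
Proof.
move=> xx; apply: nm_eq0; have := nm_cstar x; rewrite xx nm0 => /esym/eqP.
by rewrite sqrf_eq0 => /eqP ->.
Qed.

Lemma nm_proj A (p : A) : p^# = p -> p ** p = p -> nm p <= 1.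
Proof.
move=> ps pp; have := nm_cstar p; rewrite ps pp => E.
have := nm_ge0 p; nra.
Qed.

(** Yields closedness of commutants, of the self-adjoint part and of the elements fixed by a left
    multiplication. The sign of K is free, hence the denominator |K| + 1. *)
Lemma closed_ker A (f : A -> A) (K : R) :
  (forall x y, f (x - y) = f x - f y) -> (forall x, nm (f x) <= K * nm x) ->
  closed [set x | f x = 0].
Proof.
move=> fB fK; apply/closedC => x hx; apply: nm_eq0.
rewrite leNgt; apply/negP => fx0.
have [y /= fy0 xy] := hx (nm (f x) / (`|K| + 1)) ltac:(by rewrite divr_gt0 // ltr_wpDl).
move: xy; rewrite ltr_pdivlMr ?ltr_wpDl // => xy.
have := fK (x - y); rewrite fB fy0 subr0.
have := ler_norm K; have := nm_ge0 (x - y); have := normr_ge0 K; nra.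
Qed.

Definition half (V : normedModType C) (x : V) : V := (2^-1 : R)%:C%C *: x.

Lemma nm_half (V : normedModType C) (x : V) : nm (half x) = nm x / 2.
Proof. by rewrite /half nmZ nmR normfV normr_nat mulrC. Qed.

Lemma halfB (V : normedModType C) (x y : V) : half (x - y) = half x - half y.
Proof. exact: scalerBr. Qed.

Lemma half_add (V : normedModType C) (x : V) : half x + half x = x.
Proof.
rewrite /half -scalerDl -[RHS]scale1r; congr (_ *: _).
by apply/eqP; rewrite eq_complex /= addr0 eqxx andbT; apply/eqP; lra.
Qed.

(* b is the limit of the iteration b <- (a + b^2) / 2, so that (1 - b)^2 = 1 - a. *)
Lemma cstar_sqrt A (a : A) : nm a < 1 -> exists b : A,
  b + b = a + b ** b /\
  forall P : set A, closed P -> P 0 -> P a ->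
    (forall x y, P x -> P y -> P (x + y)) -> (forall x y, P x -> P y -> P (x ** y)) ->
    (forall x, P x -> P (half x)) -> P b.
Proof.
pose r := nm a; rewrite -/r => r1.
have r0 : 0 <= r := nm_ge0 a.
pose f x := half (a + x ** x); pose b n := iter n f 0.
have bn n : nm (b n) <= r.
  elim: n => [|n IH]; first by rewrite nm0.
  rewrite /= nm_half; have := nmD a (b n ** b n); have := nm_cs_mul (b n) (b n).
  by have := nm_ge0 (b n); rewrite -/r; nra.
(* f contracts the ball of radius r by the factor r, since x^2 - y^2 = x (x - y) + (x - y) y. *)
have fB x y : nm x <= r -> nm y <= r -> nm (f x - f y) <= r * nm (x - y).
  move=> xr yr; rewrite /f -halfB nm_half opprD addrACA subrr add0r.
  have -> : x ** x - y ** y = x ** (x - y) + (x - y) ** y by rewrite cs_mulBr cs_mulBl subrKA.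
  have := nmD (x ** (x - y)) ((x - y) ** y).
  have := nm_cs_mul x (x - y); have := nm_cs_mul (x - y) y; have := nm_ge0 (x - y); nra.
have bS n : nm (b n.+1 - b n) <= r * r ^+ n.
  elim: n => [|n IH]; first by rewrite expr0 mulr1 subr0; exact: bn 1%N.
  by have := fB (b n.+1) (b n) (bn _) (bn _); rewrite exprS /=; nra.
have [l bl] := geometric_limit r0 r1 bS.
have lr : nm l <= r.
  rewrite leNgt; apply/negP => lr; have [|N NP] := bl (nm l - r); first lra.
  have := NP N (leqnn N); have := nm_tri l (b N) 0; rewrite !subr0 (nmB l); have := bn N; lra.
exists l; split.
  suff E : l = f l by rewrite {1 2}E /f half_add.
  apply/eqP; rewrite -subr_eq0; apply/eqP/nm_eq0; rewrite leNgt; apply/negP => d0.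
  have [|N NP] := bl (nm (l - f l) / 2); first lra.
  have := NP N (leqnn N); have := NP N.+1 (leqnSn N) => /=.
  have := fB (b N) l (bn _) lr; have := nm_tri l (f (b N)) (f l).
  by rewrite (nmB l (f (b N))) /=; have := nm_ge0 (b N - l); nra.
(* The iterates are built from 0 and a by the operations that P allows, so such closed conditions
   pass to b. *)
move=> P cP P0 Pa PD PM Ph; move/closedC: cP; apply => e /bl[N NP].
exists (b N); last by rewrite nmB; exact: NP.
by elim: (N) => //= n IH; apply/Ph/PD/PM.
Qed.

(* For a = a^# the square root c of the previous lemma gives the formal unitary a + i (1 - c). *)
Lemma cstar_sqrt_sa A (a : A) : a^# = a -> nm a < 1 -> exists b : A,
  [/\ b + b = a + b ** b, b^# = b, forall d, a ** d = d ** a -> b ** d = d ** b &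
      forall q, q ** a = a -> q ** b = b].
Proof.
move=> sa a1; have [b [bb Pb]] := cstar_sqrt a1; exists b.
have comm (d : A) : closed [set x : A | x ** d = d ** x].
  have := @closed_ker A (fun x => x ** d - d ** x) (nm d + nm d).
  rewrite (_ : [set x | _ = 0] = [set x | x ** d = d ** x]); last first.
    by apply/seteqP; split=> x /=; [move/subr0_eq|move=> ->; rewrite subrr].
  apply=> [x y|x]; first by rewrite cs_mulBl cs_mulBr !opprD !opprK addrACA.
  have := nmD (x ** d) (- (d ** x)); rewrite nmN.
  have := nm_cs_mul x d; have := nm_cs_mul d x; lra.
have Pd d : a ** d = d ** a -> b ** d = d ** b.
  move=> ad; apply: (Pb [set x | x ** d = d ** x]) => //=.
  - by rewrite cs_0mul cs_mul0.
  - by move=> x y xd yd; rewrite cs_mulDl xd yd cs_mulDr.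
  - by move=> x y xd yd; rewrite -cs_mulA yd cs_mulA xd cs_mulA.
  - by move=> x xd; rewrite cs_mulZl xd cs_mulZr.
have Pq q : q ** a = a -> q ** b = b.
  move=> qa; apply: (Pb [set x | q ** x = x]) => //=.
  - have := @closed_ker A (fun x => q ** x - x) (nm q + 1).
    rewrite (_ : [set x | _ = 0] = [set x | q ** x = x]); last first.
      by apply/seteqP; split=> x /=; [move/subr0_eq|move=> ->; rewrite subrr].
    apply=> [x y|x]; first by rewrite cs_mulBr !opprD !opprK addrACA.
    by have := nmD (q ** x) (- x); have := nm_cs_mul q x; rewrite nmN; lra.
  - by rewrite cs_mul0.
  - by move=> x y xq yq; rewrite cs_mulDr xq yq.
  - by move=> x y xq yq; rewrite cs_mulA xq.
  - by move=> x xq; rewrite cs_mulZr xq.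
split=> //.
(* A product of self-adjoint elements is self-adjoint only if they commute; the invariant therefore
   also makes x commute with all that commutes with a. *)
suff [] : [set x : A | x^# = x /\ forall d, a ** d = d ** a -> x ** d = d ** x] b by [].
have csa : closed [set x : A | x^# = x].
  have := @closed_ker A (fun x => x^# - x) 2.
  rewrite (_ : [set x | _ = 0] = [set x | x^# = x]); last first.
    by apply/seteqP; split=> x /=; [move/subr0_eq|move=> ->; rewrite subrr].
  apply=> [x y|x]; first by rewrite cs_adjB !opprD !opprK addrACA.
  by have := nmD x^# (- x); rewrite nmN nm_adj; lra.
apply: Pb => /=.
- have -> : [set x : A | x^# = x /\ forall d, a ** d = d ** a -> x ** d = d ** x] =
      [set x : A | x^# = x] `&` \bigcap_(d in [set d | a ** d = d ** a]) [set x | x ** d = d ** x].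
    by apply/seteqP; split=> x [].
  by apply: closedI => //; apply: closed_bigI => d _.
- by split=> [|d _]; rewrite ?cs_adj0 // cs_0mul cs_mul0.
- by [].
- move=> x y [xs xd] [ys yd]; split=> [|d ad]; first by rewrite cs_adjD xs ys.
  by rewrite cs_mulDl xd // yd // cs_mulDr.
- move=> x y [xs xd] [ys yd]; split=> [|d ad].
    by rewrite cs_adjM xs ys; apply/yd/esym/xd.
  by rewrite -cs_mulA yd // cs_mulA xd // cs_mulA.
- move=> x [xs xd]; split=> [|d ad].
    by rewrite /half cs_adjZ xs; by rewrite conj_Creal ?ger0_real ?ler0c ?invr_ge0.
  by rewrite /half cs_mulZl xd // cs_mulZr.
Qed.

End CstarBasics.

Section Contractive.
Variable R : realType.
Local Notation C := (complex R).
Implicit Types A B : cstar R.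

Lemma conj_i : ('i%C : C)^* = - 'i%C.
Proof. by apply/eqP; rewrite eq_complex /= oppr0 !eqxx. Qed.

Lemma mulii : ('i%C : C) * 'i%C = -1.
Proof. by rewrite -expr2 sqr_i. Qed.

(** The cross terms of the C*-identity for p + iq are i (p^# q - q^# p). *)
Lemma nm_add_i A (p q : A) : p^# ** q = q^# ** p ->
  nm (p + 'i%C *: q) ^+ 2 = nm (p^# ** p + q^# ** q).
Proof.
move=> pq; rewrite -nm_cstar cs_adjD cs_adjZ conj_i; congr (nm _).
rewrite cs_mulDl !cs_mulDr !cs_mulZl !cs_mulZr pq scalerA mulNr mulii opprK scale1r.
by rewrite addrA -(addrA (p^# ** p)) -scalerDl subrr scale0r addr0.
Qed.

(* If a^2 + (1 - c)^2 = 1 then f a + i (1 - f c) is formally unitary, and f a is its real part. *)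
Lemma star_hom_le1 A B (f : A -> B) (a : A) :
  star_hom f -> a^# = a -> nm a < 1 -> nm (f a) <= 1.
Proof.
move=> [fD fZ fM fs] sa a1.
have [||c [cc sc comm _]] := @cstar_sqrt_sa R A (a ** a).
- by rewrite cs_adjM sa.
- by apply: le_lt_trans (nm_cs_mul _ _) _; have := nm_ge0 a; nra.
have ca : c ** a = a ** c by apply: comm; rewrite cs_mulA.
set al := f a; set ga := f c.
have als : al^# = al by rewrite -fs sa.
have gas : ga^# = ga by rewrite -fs sc.
have ag : al ** ga = ga ** al by rewrite -!fM ca.
have gg : ga + ga = al ** al + ga ** ga by rewrite -!fM -!fD cc.
clearbody al ga; clear -als gas ag gg.
(* q x is (1 - f c) x written without a unit, and x |-> al x + i q x, x |-> al x - i q x play the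
   unitary and its adjoint. *)
pose q x := x - ga ** x.
have pq x : (al ** x)^# ** q x = (q x)^# ** (al ** x).
  rewrite cs_adjM als cs_mulBr cs_adjB cs_adjM gas cs_mulBl; congr (_ - _).
    by rewrite cs_mulA.
  by rewrite !cs_mulA -(cs_mulA x^#) ag !cs_mulA.
have norm x : (al ** x)^# ** (al ** x) + (q x)^# ** q x = x^# ** x.
  have -> : (q x)^# ** q x = x^# ** (q x - ga ** q x).
    by rewrite {1}/q cs_adjB cs_adjM gas cs_mulBl -cs_mulA -cs_mulBr.
  have -> : (al ** x)^# ** (al ** x) = x^# ** (al ** al ** x).
    by rewrite cs_adjM als !cs_mulA.
  have al2 : al ** al = ga + ga - ga ** ga by rewrite gg addrK.
  rewrite -cs_mulDr al2; congr (_ ** _).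
  rewrite /q cs_mulBr cs_mulBl cs_mulDl cs_mulA.
  by rewrite opprB [x - _ + _]addrACA -opprD [LHS]addrC addrA subrK addrK.
have up x : nm (al ** x + 'i%C *: q x) = nm x.
  by apply/eqP; rewrite -(eqrXn2 (n := 2)) ?nm_ge0 // nm_add_i // norm nm_cstar.
have dn x : nm (al ** x + 'i%C *: (- q x)) = nm x.
  apply/eqP; rewrite -(eqrXn2 (n := 2)) ?nm_ge0 // nm_add_i.
    by rewrite cs_adjN cs_mulNl cs_mulNr opprK norm nm_cstar.
  by rewrite cs_adjN cs_mulNl cs_mulNr pq.
(* al x is half the sum of the two norm-preserving images of x. At x = al this gives ||al||^2 <=
   ||al||. *)
have le x : nm (al ** x) <= nm x.
  have := nmD (al ** x + 'i%C *: q x) (al ** x + 'i%C *: (- q x)).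
  rewrite up dn scalerN addrACA subrr addr0 => h.
  have -> : al ** x = half (al ** x + al ** x).
    by rewrite -[in LHS](half_add (al ** x)) /half scalerDr.
  by rewrite nm_half; lra.
have := le al; rewrite -{1}als nm_cstar; have := nm_ge0 al; nra.
Qed.

(** The C*-identity reduces the claim to x^# x, and scaling reduces self-adjoint elements to the
    open unit ball. *)
Lemma star_hom_contractive A B (f : A -> B) (x : A) : star_hom f -> nm (f x) <= nm x.
Proof.
move=> hf; have [fD fZ fM fs] := hf.
have f0 : f 0 = 0 by have := fZ 0 0; rewrite !scale0r.
suff sa (a : A) : a^# = a -> nm (f a) <= nm a.
  have := sa (x^# ** x); rewrite cs_adjM cs_adjK => /(_ erefl).
  rewrite fM fs !nm_cstar; have := nm_ge0 x; have := nm_ge0 (f x); nra.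
move=> sa; apply/ler_addgt0Pr => e e0.
have d0 : 0 < nm a + e by rewrite ltr_wpDl ?nm_ge0.
have := @star_hom_le1 A B f (((nm a + e)^-1)%:C%C *: a) hf.
rewrite cs_adjZ sa conj_Creal; last by apply/ger0_real; rewrite ler0c ltW // invr_gt0.
have E (V : normedModType C) (y : V) : nm ((nm a + e)^-1%:C%C *: y) = nm y / (nm a + e).
  by rewrite nmZ nmR ger0_norm ?invr_ge0 ?ltW // mulrC.
by rewrite fZ !E => /(_ erefl); rewrite ltr_pdivrMr // mul1r ltrDl ler_pdivrMr // mul1r; apply.
Qed.

(** In the corner q A q the projection q is the unit, so q - b is the square root of 1 - a there. *)
Lemma corner_sqrt A (q a : A) : q^# = q -> q ** q = q -> a^# = a -> q ** a = a -> nm a < 1 ->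
  exists y : A, [/\ y ** y = q - a, y^# = y &
    forall e, q ** e = e ** q -> a ** e = e ** a -> y ** e = e ** y].
Proof.
move=> sq qq sa qa a1; have [b [bb bs bc bq]] := cstar_sqrt_sa sa a1.
have qb := bq q qa; have bq' : b ** q = b by rewrite -[RHS]bs -{2}qb cs_adjM bs sq.
exists (q - b); split; first last.
- by move=> e qe ae; rewrite cs_mulBl cs_mulBr qe bc.
- by rewrite cs_adjB sq bs.
by rewrite cs_mulBl !cs_mulBr qq qb bq' -addrA -opprD addrA bb addrK.
Qed.

(* Both 1 + g and 1 - g are squares up to a factor, so their square roots y and z (after shrinking
   g by d < 1) satisfy y^2 + z^2 = 2 (1 - d), and y + i z is small. *)
Lemma corner_unit_extreme A (q g : A) : q^# = q -> q ** q = q -> g^# = g ->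
  q ** g = g -> nm (q + g) <= 1 -> nm (q - g) <= 1 -> g = 0.
Proof.
move=> sq qq sg qg n1 n2; apply: nm_eq0; rewrite leNgt; apply/negP => g0.
have gq : g ** q = g by rewrite -[RHS]sg -{2}qg cs_adjM sg sq.
(* The estimates below end in d ||g|| <= 3 (1 - d), that is d (3 + ||g||) <= 3; this d makes the
   left side 3 + ||g||/2. *)
pose d := (3 + nm g / 2) / (3 + nm g).
have d1 : d < 1 by rewrite ltr_pdivrMr ?mul1r; lra.
have d0 : 0 < d by apply: divr_gt0; lra.
have nmd (V : normedModType C) (x : V) : nm (d%:C%C *: x) = d * nm x by rewrite nmZ nmR gtr0_norm.
have sgm (h : A) : h^# = h -> (d%:C%C *: h)^# = d%:C%C *: h.
  by move=> sh; rewrite cs_adjZ sh conj_Creal // ger0_real // ler0c ltW.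
have sqr h : h^# = h -> q ** h = h -> nm (q - h) <= 1 -> exists y : A,
    [/\ y ** y = q - d%:C%C *: (q - h), y^# = y &
    forall e, q ** e = e ** q -> h ** e = e ** h -> y ** e = e ** y].
  move=> sh qh nh; have [|||y [yy ys yc]] := @corner_sqrt A q (d%:C%C *: (q - h)) sq qq.
  - by apply: sgm; rewrite cs_adjB sq sh.
  - by rewrite cs_mulZr cs_mulBr qq qh.
  - by rewrite nmd; have := nm_ge0 (q - h); nra.
  exists y; split=> // e qe he; apply: yc => //.
  by rewrite cs_mulZl cs_mulZr cs_mulBl cs_mulBr qe he.
have [y [yy ys yc]] := sqr g sg qg n2.
have [|||z [zz zs zc]] := sqr (- g).
- by rewrite cs_adjN sg.
- by rewrite cs_mulNr qg.
- by rewrite opprK.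
have yz : y ** z = z ** y.
  by apply: yc; [apply/esym/zc|apply/esym/zc]; rewrite ?cs_mulNl ?cs_mulNr ?qg ?gq.
have yyE : y ** y = (1 - d)%:C%C *: q + d%:C%C *: g.
  by rewrite yy scalerBr opprB addrA addrAC rmorphB rmorph1 scalerBl scale1r addrAC.
have zzE : z ** z = (1 - d)%:C%C *: q - d%:C%C *: g.
  by rewrite zz opprK scalerDr opprD addrA rmorphB rmorph1 scalerBl scale1r.
have nq := nm_proj sq qq.
have nw : nm (y + 'i%C *: z) ^+ 2 <= 2 * (1 - d).
  rewrite nm_add_i ?ys ?zs // yyE zzE addrACA subrr addr0.
  have := nmD ((1 - d)%:C%C *: q) ((1 - d)%:C%C *: q).
  by rewrite nmZ nmR ger0_norm; [have := nm_ge0 q; nra|lra].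
have ny : nm y <= nm (y + 'i%C *: z).
  have -> : nm y = nm (y + y) / 2 by rewrite -nm_half /half scalerDr half_add.
  have := nmD (y + 'i%C *: z) (y + 'i%C *: z)^#.
  rewrite nm_adj cs_adjD cs_adjZ conj_i ys zs scaleNr addrACA subrr addr0; lra.
have : nm (d%:C%C *: g) <= nm (y ** y) + (1 - d) * nm q.
  have -> : d%:C%C *: g = y ** y - (1 - d)%:C%C *: q by rewrite yyE addrC addKr.
  have d1' : 0 <= 1 - d by lra.
  apply: le_trans (nmD _ _) _.
  by rewrite nmN nmZ nmR ger0_norm.
rewrite nmd; have := nm_cs_mul y y; have := nm_ge0 y.
have E : d * (3 + nm g) = 3 + nm g / 2 by rewrite /d divfK // gt_eqF //; lra.
nra.
Qed.

(** The compressions h_l = q p_l q by q = p_i add up to 0 over l != i, and being positive they all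
    vanish. Positivity is expressed by ||q - 2 h_l|| <= 1, and the extremality of q in the unit ball
    of its corner takes over the rest. *)
Lemma proj_sum_orthogonal A (I : finType) (p : I -> A) (i j : I) :
  (forall i, (p i)^# = p i) -> (forall i, p i ** p i = p i) ->
  (forall i, (\sum_j p j) ** p i = p i) -> i != j -> p j ** p i = 0.
Proof.
move=> ps pp sump ij; set q := p i.
pose h l := q ** p l ** q.
have sq : q^# = q := ps i. have qq : q ** q = q := pp i.
have sh l : (h l)^# = h l by rewrite /h !cs_adjM sq ps cs_mulA.
have nh l : nm (q - (h l + h l)) <= 1.
  (* y is (1 - 2 p_l) q, and 1 - 2 p_l is a formal unitary. *)
  pose y := q - (p l ** q + p l ** q).
  have ny : nm y <= 1.
    have : nm y ^+ 2 = nm q ^+ 2.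
      rewrite -!nm_cstar /y; congr (nm _).
      rewrite cs_adjB cs_adjD cs_adjM sq ps cs_mulBl !cs_mulBr !cs_mulDl !cs_mulDr.
      have -> : q ** p l ** (p l ** q) = q ** p l ** q by rewrite cs_mulA -(cs_mulA q) pp.
      by rewrite cs_mulA opprB addrK subrK.
    by move=> /eqP; rewrite eqrXn2 ?nm_ge0 // => /eqP ->; exact: nm_proj.
  have -> : q - (h l + h l) = q ** y by rewrite /y cs_mulBr qq cs_mulDr cs_mulA.
  have := nm_cs_mul q y; have := nm_proj sq qq; have := nm_ge0 y; have := nm_ge0 q; nra.
have sum0 : \sum_(l | l != i) h l = 0.
  have : q ** (\sum_l p l) ** q = q by rewrite -cs_mulA sump.
  rewrite cs_sumr cs_suml (bigD1 i) //= -/q !qq => E.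
  by apply: (addrI q); rewrite addr0.
have hj0 : h j = 0.
  (* Both q + 2 h_j/(m + 1) and q - 2 h_j/(m + 1) have norm at most 1: the first because m q + 2 h_j
     is the sum of the m elements q - 2 h_l with l different from i and j. *)
  pose m := #|[pred l | (l != i) && (l != j)]|.
  have rest : \sum_(l | (l != i) && (l != j)) h l = - h j.
    by move: sum0; rewrite (bigD1 j) 1?eq_sym //= => /eqP; rewrite addrC addr_eq0 => /eqP.
  have nrest : nm (m%:R *: q + (h j + h j)) <= m%:R.
    have -> : (m%:R : C) *: q + (h j + h j) = \sum_(l | (l != i) && (l != j)) (q - (h l + h l)).
      by rewrite sumrB big_split /= rest sumr_const scaler_nat opprD !opprK.
    apply: le_trans (nm_sum _ _ _) _; by rewrite /m -sum1_card natr_sum; apply: ler_sum => l _; exact: nh.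
  set c : R := m%:R + 1; have c0 : 0 < c by rewrite ltr_wpDl.
  have cC : (m%:R : C) = (m%:R : R)%:C%C by rewrite rmorph_nat.
  have nmc (x : A) : nm (c^-1%:C%C *: x) = nm x / c by rewrite nmZ nmR ger0_norm ?invr_ge0 ?ltW // mulrC.
  have nq := nm_proj sq qq.
  have cq : q = c^-1%:C%C *: (c%:C%C *: q) by rewrite scalerA -rmorphM mulVf ?gt_eqF // scale1r.
  have cqE : c%:C%C *: q = m%:R *: q + q by rewrite rmorphD rmorph1 scalerDl scale1r cC.
  have m0 : 0 <= (m%:R : R) by [].
  have : c^-1%:C%C *: (h j + h j) = 0.
    apply: (@corner_unit_extreme _ q) => //.
    - rewrite cs_adjZ cs_adjD sh conj_Creal // ger0_real // ler0c invr_ge0 ltW //.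
    - by rewrite cs_mulZr cs_mulDr /h !cs_mulA qq.
    - rewrite {1}cq -scalerDr nmc ler_pdivrMr // mul1r cqE addrAC.
      by apply: le_trans (nmD _ _) _; rewrite lerD.
    - rewrite {1}cq -scalerBr nmc ler_pdivrMr // mul1r cqE -addrA.
      apply: le_trans (nmD _ _) _; rewrite lerD ?nh // nmZ cC nmR ger0_norm //; nra.
  move/eqP; rewrite scaler_eq0 => /orP[/eqP/complexI/eqP|/eqP h2].
    by rewrite invr_eq0 gt_eqF.
  by rewrite -(half_add (h j)) /half -scalerDr h2 scaler0.
(* h_j is the product of p_j q with its adjoint on the left. *)
by apply: cs_adj_mul_eq0; rewrite cs_adjM sq ps cs_mulA -(cs_mulA q) pp.
Qed.

End Contractive.

(** * Simple AF algebras from matrix units *)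

Section ClosureAlgebra.
Variables (R : realType) (A : cstar R).
Local Notation C := (complex R).

Lemma closure_star_subalgebra (S : set A) :
  star_subalgebra S -> cstar_subalgebra (closure S).
Proof.
move=> [[S0 SD SZ] SM SJ]; split; last exact: closed_closure.
split; first split.
- exact: subset_closure.
- move=> x y /closureC cx /closureC cy; apply/closureC => e e0.
  have e2 : 0 < e / 2 by lra.
  have [x' Sx xx] := cx _ e2; have [y' Sy yy] := cy _ e2.
  exists (x' + y'); first exact: SD.
  have := nmD (x - x') (y - y'); rewrite addrACA -opprD; lra.
- move=> c x /closureC cx; apply/closureC => e e0.
  have c0 : 0 < nm c + 1 by rewrite ltr_wpDl ?nm_ge0.
  have [x' Sx xx] := cx _ (divr_gt0 e0 c0).
  exists (c *: x'); first exact: SZ.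
  rewrite -scalerBr nmZ; move: xx; rewrite ltr_pdivlMr //.
  have := nm_ge0 c; have := nm_ge0 (x - x'); nra.
- move=> x y /closureC cx /closureC cy; apply/closureC => e e0.
  have e2 : 0 < e / 2 by lra.
  have c0 : 0 < nm x + 1 by rewrite ltr_wpDl ?nm_ge0.
  have [y' Sy yy] := cy _ (divr_gt0 e2 c0).
  have c1 : 0 < nm y' + 1 by rewrite ltr_wpDl ?nm_ge0.
  have [x' Sx xx] := cx _ (divr_gt0 e2 c1).
  exists (x' ** y'); first exact: SM.
  apply: le_lt_trans (nm_tri _ (x ** y') _) _; rewrite -cs_mulBr -cs_mulBl.
  move: xx yy; rewrite !ltr_pdivlMr //.
  have := nm_cs_mul x (y - y'); have := nm_cs_mul (x - x') y'.
  have := nm_ge0 x; have := nm_ge0 y'; have := nm_ge0 (x - x'); have := nm_ge0 (y - y'); nra.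
- move=> x /closureC cx; apply/closureC => e /cx[x' Sx xx].
  by exists x'^#; [exact: SJ | rewrite -cs_adjB nm_adj].
Qed.

Lemma bigcup_star_subalgebra (F : nat -> set A) :
  (forall n, star_subalgebra (F n)) -> (forall n, F n `<=` F n.+1) ->
  star_subalgebra (\bigcup_n F n).
Proof.
move=> Fs Fi; have mono m n : (m <= n)%N -> F m `<=` F n.
  by move=> /subnKC <-; elim: (n - m)%N => [|k IH]; rewrite ?addn0 ?addnS //; apply: subset_trans (Fi _).
have common x y : (\bigcup_n F n) x -> (\bigcup_n F n) y -> exists n, F n x /\ F n y.
  move=> [m _ mx] [n _ ny]; exists (maxn m n).
  by split; [apply: mono mx; exact: leq_maxl | apply: mono ny; exact: leq_maxr].
split; first split.
- by exists 0%N => //; have [[]] := Fs 0%N.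
- by move=> x y /common h /h[n [nx ny]]; exists n => //; have [[_ D _] _ _] := Fs n; exact: D.
- by move=> c x [n _ nx]; exists n => //; have [[_ _ Z] _ _] := Fs n; exact: Z.
- by move=> x y /common h /h[n [nx ny]]; exists n => //; have [_ M _] := Fs n; exact: M.
- by move=> x [n _ nx]; exists n => //; have [_ _ J] := Fs n; exact: J.
Qed.

End ClosureAlgebra.

(** * Matrix units of a direct sum of matrix algebras, and the norm of their combinations *)

Section MatrixUnits.
Variables (R : realType) (A : cstar R) (V : eqType) (T : finType) (b : T -> V) (e : T -> T -> A).
Local Notation C := (complex R).
(** b names the summand of an index. Setting the units to 0 across summands allows sums over all
    pairs; [eM] stays true when l lies in another block, both sides being 0. *)
Hypothesis e_block : forall i j, b i != b j -> e i j = 0.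
Hypothesis eM : forall i j l, b i = b j -> e i j ** e j l = e i l.
Hypothesis eM0 : forall i j k l, j != k -> e i j ** e k l = 0.
Hypothesis eJ : forall i j, (e i j)^# = e j i.

Definition mx_sum (c : T -> T -> C) : A := \sum_i \sum_j c i j *: e i j.

Definition mx_span : set A := [set x | exists c, x = mx_sum c].

Lemma mx_span_e i j : mx_span (e i j).
Proof.
exists (fun k l => ((k == i) && (l == j))%:R).
rewrite /mx_sum (bigD1 i) //= (bigD1 j) //= !eqxx scale1r !big1 ?addr0 //.
  by move=> k /negPf ki; rewrite big1 // => l _; rewrite ki scale0r.
by move=> l /negPf ->; rewrite andbF scale0r.
Qed.

Lemma mx_span_subspace : subspace mx_span.
Proof.
split.
- by exists (fun _ _ => 0); rewrite /mx_sum big1 // => i _; rewrite big1 // => j _; rewrite scale0r.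
- move=> _ _ [c ->] [d ->]; exists (fun i j => c i j + d i j).
  rewrite /mx_sum -big_split; apply: eq_bigr => i _.
  by rewrite -big_split; apply: eq_bigr => j _; rewrite scalerDl.
- move=> a _ [c ->]; exists (fun i j => a * c i j).
  rewrite /mx_sum scaler_sumr; apply: eq_bigr => i _.
  by rewrite scaler_sumr; apply: eq_bigr => j _; rewrite scalerA.
Qed.

Lemma subspace_sum (B : set A) (I : Type) (r : seq I) (P : pred I) (F : I -> A) :
  subspace B -> (forall i, P i -> B (F i)) -> B (\sum_(i <- r | P i) F i).
Proof. by move=> [B0 BD _] BF; elim/big_ind: _ => //. Qed.

Lemma mx_span_sub (B : set A) : subspace B -> (forall i j, B (e i j)) -> mx_span `<=` B.
Proof.
move=> sB Be _ [c ->]; apply: subspace_sum => // i _; apply: subspace_sum => // j _.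
by have [_ _ BZ] := sB; exact: BZ.
Qed.

(** Coefficients across blocks are arbitrary, as they multiply 0, so the product has to skip
    them. *)
Definition mx_prod (c d : T -> T -> C) i l : C := \sum_(j | b i == b j) c i j * d j l.

Definition mx_adj (c : T -> T -> C) i j : C := (c j i)^*.

Lemma e_mx_sum i j c : b i = b j -> e i j ** mx_sum c = \sum_l c j l *: e i l.
Proof.
move=> ij; rewrite /mx_sum cs_sumr (bigD1 j) //= [X in _ + X]big1 ?addr0.
  by rewrite cs_sumr; apply: eq_bigr => l _; rewrite cs_mulZr eM.
move=> k kj; rewrite cs_sumr big1 // => l _.
by rewrite cs_mulZr eM0 ?scaler0 // eq_sym.
Qed.

Lemma mx_sumM c d : mx_sum c ** mx_sum d = mx_sum (mx_prod c d).
Proof.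
rewrite {1}/mx_sum cs_suml; apply: eq_bigr => i _; rewrite cs_suml.
under [RHS]eq_bigr do rewrite /mx_prod scaler_suml.
rewrite exchange_big /= [RHS]big_mkcond /=; apply: eq_bigr => j _.
case: ifPn => [/eqP ij|ij]; last by rewrite e_block // scaler0 cs_0mul.
by rewrite cs_mulZl e_mx_sum // scaler_sumr; apply: eq_bigr => l _; rewrite scalerA.
Qed.

Lemma mx_sumJ c : (mx_sum c)^# = mx_sum (mx_adj c).
Proof.
rewrite /mx_sum cs_adj_sum; under eq_bigr do rewrite cs_adj_sum.
by rewrite exchange_big; apply: eq_bigr => i _; apply: eq_bigr => j _; rewrite cs_adjZ eJ.
Qed.

Lemma mx_span_star : star_subalgebra mx_span.
Proof.
split; first exact: mx_span_subspace.
- by move=> _ _ [c ->] [d ->]; exists (mx_prod c d); exact: mx_sumM.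
- by move=> _ [c ->]; exists (mx_adj c); exact: mx_sumJ.
Qed.

Lemma mx_span_fin : finite_dim mx_span.
Proof.
exists #|{: T * T}|, (fun k => e (enum_val k).1 (enum_val k).2) => _ [c ->].
exists (fun k => c (enum_val k).1 (enum_val k).2).
rewrite /mx_sum pair_bigA /= (reindex (@enum_val _ {: T * T})) //=.
by exists enum_rank => x _; rewrite ?enum_valK ?enum_rankK.
Qed.

Definition sqn (x : T -> C) : R := \sum_i nm (x i) ^+ 2.

Definition mx_form (x : T -> C) c (y : T -> C) : C := \sum_i \sum_j (x i)^* * c i j * y j.

Definition in_block v (x : T -> C) := forall i, b i != v -> x i = 0.

(* K bounds the operator norm of every diagonal block of c. *)
Definition mx_bound (K : R) c := forall v x y, in_block v x -> in_block v y ->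
  nm (mx_form x c y) ^+ 2 <= K ^+ 2 * (sqn x * sqn y).

Lemma sqn_ge0 x : 0 <= sqn x.
Proof. by apply: sumr_ge0 => i _; rewrite sqr_ge0. Qed.

Lemma mx_bound_adj K c : mx_bound K c -> mx_bound K (mx_adj c).
Proof.
move=> cK v x y xv yv; rewrite (mulrC (sqn x)); apply: le_trans (cK v y x yv xv).
rewrite le_eqVlt; apply/orP; left; apply/eqP; congr (_ ^+ 2); rewrite -nm_conj; congr (nm _).
rewrite /mx_form rmorph_sum exchange_big; apply: eq_bigr => i _.
rewrite rmorph_sum; apply: eq_bigr => j _.
by rewrite /mx_adj !rmorphM /= !conjCK mulrC mulrA mulrAC -mulrA mulrC -mulrA.
Qed.

Lemma mx_bound_prod K K' c d :
  mx_bound K c -> mx_bound K' d -> mx_bound (K * K') (mx_prod c d).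
Proof.
move=> cK dK v x y xv yv.
(* z is the part of d y in the block v. Testing d on the pair (z, y) gives |z|^2, whence |z| <= K'
   |y|. *)
pose z j := if b j == v then \sum_l d j l * y l else 0.
have zv : in_block v z by move=> j /negPf; rewrite /z => ->.
have -> : mx_form x (mx_prod c d) y = mx_form x c z.
  apply: eq_bigr => i _; have [iv|iv] := eqVneq (b i) v; last first.
    by rewrite !big1 // => j _; rewrite xv // conjC0 !mul0r.
  rewrite /mx_prod /z; under eq_bigr do rewrite mulr_sumr mulr_suml.
  rewrite exchange_big /= big_mkcond; apply: eq_bigr => j _; rewrite iv eq_sym.
  by case: eqP => _; rewrite ?mulr0 // mulr_sumr; apply: eq_bigr => l _; rewrite !mulrA.
have zz : sqn z <= K' ^+ 2 * sqn y.
  have : nm (mx_form z d y) = sqn z.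
    rewrite -[RHS]ger0_norm ?sqn_ge0 // -nmR /sqn rmorph_sum; congr (nm _).
    apply: eq_bigr => i _; rewrite rmorphXn /= -nmE normCK mulrC /z.
    have [iv|iv] := eqVneq (b i) v; last by rewrite conjC0 mul0r big1 // => j _; rewrite !mul0r.
    by rewrite mulr_sumr; apply: eq_bigr => l _; rewrite mulrA.
  have := dK v z y zv yv => + E; rewrite E.
  have := sqn_ge0 z; have := sqn_ge0 y; have [->|z0] := eqVneq (sqn z) 0.
    by move=> y0 _ _; rewrite mulr_ge0 ?sqr_ge0.
  move=> y0 z0'; have zp : 0 < sqn z by rewrite lt_neqAle eq_sym z0.
  by move=> h; rewrite -(ler_pM2l zp) -expr2 mulrCA.
apply: le_trans (cK v x z xv zv) _.
have := ler_wpM2l (sqr_ge0 K) (ler_wpM2l (sqn_ge0 x) zz).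
by rewrite (_ : (K * K') ^+ 2 * (sqn x * sqn y) = K ^+ 2 * (sqn x * (K' ^+ 2 * sqn y))) //; ring.
Qed.

Lemma mx_bound_coef K c i j : 0 <= K -> mx_bound K c -> b i = b j -> nm (c i j) <= K.
Proof.
move=> K0 cK ij; pose d (k l : T) : C := (k == l)%:R.
have dv k : in_block (b k) (d k).
  by move=> l lk; rewrite /d; case: eqP => // E; rewrite E eqxx in lk.
have d1 k : sqn (d k) = 1.
  rewrite /sqn (bigD1 k) //= big1 => [|l /negPf lk]; rewrite /d ?eqxx ?nm1 ?expr1n ?addr0 //.
  by rewrite eq_sym lk nm0 expr0n.
have := cK (b i) (d i) (d j) (dv i); rewrite {1}ij => /(_ (dv j)); rewrite !d1 !mulr1.
have -> : mx_form (d i) c (d j) = c i j.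
  rewrite /mx_form (bigD1 i) //= (bigD1 j) //= /d !eqxx conjC1 mul1r mulr1 !big1 ?addr0 //.
    by move=> k /negPf ki; rewrite big1 // => l _; rewrite eq_sym ki conjC0 !mul0r.
  by move=> l /negPf lj; rewrite eq_sym lj mulr0.
by rewrite ler_sqr ?nnegrE ?nm_ge0.
Qed.

Lemma nm_e i j : nm (e i j) <= 1.
Proof.
have [ij|/e_block ->] := eqVneq (b i) (b j); last by rewrite nm0.
have : nm (e i j) ^+ 2 = nm (e j j) by rewrite -nm_cstar eJ eM.
have := nm_proj (eJ j j) (eM j (erefl (b j))); have := nm_ge0 (e i j); nra.
Qed.

(** The C*-identity trades c for c^# c and K for K^2, while the factor counting the entries stays
    the same. *)
Lemma mx_sum_iter m K c : 0 <= K -> mx_bound K c ->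
  nm (mx_sum c) ^+ (2 ^ m) <= (#|T| * #|T|)%:R * K ^+ (2 ^ m).
Proof.
elim: m K c => [|m IH] K c K0 cK.
  rewrite !expr1; apply: le_trans (nm_sum _ _ _) _.
  have -> : (#|T| * #|T|)%:R * K = \sum_(i : T) \sum_(j : T) K.
    by rewrite !sumr_const -mulrnA mulr_natl.
  apply: ler_sum => i _; apply: le_trans (nm_sum _ _ _) _; apply: ler_sum => j _.
  rewrite nmZ; have [ij|/e_block ->] := eqVneq (b i) (b j); last by rewrite nm0 mulr0.
  have := mx_bound_coef K0 cK ij; have := nm_e i j; have := nm_ge0 (e i j); have := nm_ge0 (c i j); nra.
have := IH (K * K) _ (mulr_ge0 K0 K0) (mx_bound_prod (mx_bound_adj cK) cK).
by rewrite -mx_sumM -mx_sumJ nm_cstar -expr2 -!exprM -expnS.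
Qed.

(* The inclusion of the matrix algebra is contractive: apply the trivial bound by the number of
   entries to (y^* y)^(2^m) and let m grow. *)
Lemma nm_mx_sum K c : 0 <= K -> mx_bound K c -> nm (mx_sum c) <= K.
Proof.
move=> K0 cK; rewrite leNgt; apply/negP => Kc.
set a := nm _ in Kc; have a0 : 0 < a by apply: le_lt_trans Kc.
set n : R := (#|T| * #|T|)%:R.
have n0 : 0 < n + 1 by rewrite ltr_wpDl.
have q0 : 0 <= K / a by rewrite divr_ge0 // ltW.
have q1 : K / a < 1 by rewrite ltr_pdivrMr // mul1r.
have ni : 0 < (n + 1)^-1 by rewrite invr_gt0.
have [N NP] := expr_small q0 q1 ni.
have := mx_sum_iter N K0 cK; rewrite -/a -/n.
have := NP (2 ^ N)%N (ltnW (ltn_expl N (ltnSn 1))); rewrite expr_div_n.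
have aN : 0 < a ^+ (2 ^ N) by rewrite exprn_gt0.
rewrite ltr_pdivrMr // mulrC ltr_pdivlMr //.
have : 0 <= K ^+ (2 ^ N) by rewrite exprn_ge0.
have : 0 <= n by [].
by nra.
Qed.

End MatrixUnits.

(** * Ideals of the closure of a nested sequence of matrix unit systems *)

Section AFSimple.
Variables (R : realType) (A : cstar R) (V : eqType) (T : nat -> finType).
Variables (b : forall N, T N -> V) (e : forall N, T N -> T N -> A).
Local Notation C := (complex R).
Hypothesis e_block : forall N i j, b i != b j -> @e N i j = 0.
Hypothesis eM : forall N (i j l : T N), b i = b j -> e i j ** e j l = e i l.
Hypothesis eM0 : forall N (i j k l : T N), j != k -> e i j ** e k l = 0.
Hypothesis eJ : forall N (i j : T N), (e i j)^# = e j i.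
Hypothesis e_mono : forall N (i j : T N), mx_span (@e N.+1) (e i j).
(** The form in which primitivity enters. M0 may depend on i: an ideal needs to absorb only the
    levels beyond some M0, as the levels increase. *)
Hypothesis e_conn : forall N (i : T N), exists M0, forall M, (M0 <= M)%N -> forall j : T M,
  exists x y, [/\ mx_span (@e M) x, mx_span (@e M) y & e j j = x ** e i i ** y].
Hypothesis e_neq0 : exists N (i : T N), e i i <> 0.

Definition af_core : set A := \bigcup_N mx_span (@e N).
Let B := closure af_core.

Lemma mx_span_mono N : mx_span (@e N) `<=` mx_span (@e N.+1).
Proof. by apply: mx_span_sub => //; exact: mx_span_subspace. Qed.

Lemma af_core_sub N : mx_span (@e N) `<=` B.
Proof. by move=> x xN; apply: subset_closure; exists N. Qed.

(** For w and z in I the element p z + w p - w z lies in I and differs from p by (p - w)(p - z), so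
    the distance from p to I can be halved forever. *)
Lemma idempotent_near_ideal (I : set A) (p z : A) : subspace I -> closed I ->
  (forall x, I x -> I (p ** x) /\ I (x ** p)) -> (forall x y, I x -> I y -> I (x ** y)) ->
  p ** p = p -> I z -> nm (p - z) <= 2^-1 -> I p.
Proof.
move=> [I0 ID IZ] cI Ip II pp Iz pz.
have IN x : I x -> I (- x) by rewrite -scaleN1r; exact: IZ.
have pow n : exists2 w, I w & nm (p - w) <= 2^-1 ^+ n.+1.
  elim: n => [|n [w Iw pw]]; first by exists z; rewrite ?expr1.
  exists (p ** z + w ** p - w ** z).
    by apply/ID/IN/II => //; apply: ID; [have [] := Ip _ Iz|have [] := Ip _ Iw].
  have -> : p - (p ** z + w ** p - w ** z) = (p - w) ** (p - z).
    by rewrite cs_mulBl !cs_mulBr pp -addrA opprD addrA.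
  rewrite exprSr; apply: le_trans (nm_cs_mul _ _) _.
  by apply: ler_pM => //; exact: nm_ge0.
move/closedC: cI; apply => d d0.
have [N NP] := @expr_small R 2^-1 d ltac:(by rewrite invr_ge0) ltac:(lra) d0.
by have [w Iw pw] := pow N; exists w => //; apply: le_lt_trans pw _; apply: NP.
Qed.

(* For a unit vector x in the row block of o, this is the partial isometry sum_i conj(x_i) e_oi. *)
Lemma row_mul N (o : T N) (x : T N -> C) c (y : T N -> C) :
  in_block (@b N) (b o) x -> in_block (@b N) (b o) y ->
  (\sum_i (x i)^* *: e o i) ** mx_sum (@e N) c ** (\sum_j y j *: e j o) = mx_form x c y *: e o o.
Proof.
move=> xo yo; rewrite cs_suml.
under eq_bigr => i _.
  rewrite cs_mulZl; have -> : (x i)^* *: (e o i ** mx_sum (@e N) c) = (x i)^* *: \sum_l c i l *: e o l.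
    have [io|io] := eqVneq (b i) (b o); last by rewrite xo // conjC0 !scale0r.
    by rewrite (e_mx_sum (@eM N) (@eM0 N)).
  over.
rewrite cs_suml /mx_form scaler_suml; apply: eq_bigr => i _.
rewrite cs_mulZl cs_suml scaler_suml scaler_sumr; apply: eq_bigr => j _.
rewrite cs_mulZl cs_sumr (bigD1 j) //= [X in _ + X]big1 ?addr0; last first.
  by move=> k kj; rewrite cs_mulZr eM0 ?scaler0 // eq_sym.
rewrite cs_mulZr; have [jo|jo] := eqVneq (b j) (b o); first by rewrite eM // !scalerA ?mulrA.
by rewrite (yo _ jo) mulr0 !scale0r !scaler0.
Qed.

Lemma nm_col N (o : T N) (y : T N -> C) : in_block (@b N) (b o) y ->
  nm (\sum_j y j *: e j o) ^+ 2 <= sqn y.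
Proof.
move=> yo; rewrite -nm_cstar cs_adj_sum cs_suml.
have -> : \sum_i (y i *: e i o)^# ** (\sum_j y j *: e j o) = (sqn y)%:C%C *: e o o.
  rewrite /sqn rmorph_sum scaler_suml; apply: eq_bigr => i _.
  rewrite cs_adjZ eJ cs_mulZl cs_sumr (bigD1 i) //= [X in _ + X]big1 ?addr0; last first.
    by move=> k kj; rewrite cs_mulZr eM0 ?scaler0 // eq_sym.
  rewrite cs_mulZr rmorphXn /= -nmE normCK.
  have [jo|jo] := eqVneq (b i) (b o); first by rewrite eM // scalerA mulrC.
  by rewrite (yo _ jo) conjC0 mul0r !scale0r.
rewrite nmZ nmR ger0_norm ?sqn_ge0 //.
have := nm_e (@e_block N) (@eM N) (@eJ N) o o; have := sqn_ge0 y; nra.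
Qed.

Lemma nm_row N (o : T N) (x : T N -> C) : in_block (@b N) (b o) x ->
  nm (\sum_j (x j)^* *: e o j) ^+ 2 <= sqn x.
Proof.
move=> xo; rewrite -nm_adj cs_adj_sum.
under eq_bigr do rewrite cs_adjZ conjCK eJ.
exact: nm_col.
Qed.

Lemma ideal_contains_unit (I : set A) : I `<=` B -> subspace I -> closed I ->
  (forall x y, B x -> I y -> I (x ** y) /\ I (y ** x)) ->
  forall x, I x -> x <> 0 -> exists N (o : T N), I (e o o).
Proof.
move=> IB sI cI BI x Ix x0.
have t0 : 0 < nm x by rewrite lt_neqAle eq_sym nm_ge0 andbT; apply/eqP => E; apply/x0/nm_eq0; rewrite E.
(* With error ||x||/4 the matrix has norm above ||x||/2. Compression divides an error at most
   ||x||/4 by a form value above ||x||/2 (for unit vectors), which leaves the 1/2 of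
   [idempotent_near_ideal]. *)
have t4 : 0 < nm x / 4 by lra.
have [_ [N _ [c ->]] xy] := (closureC _ _).1 (IB x Ix) _ t4.
have yb : nm x / 2 < nm (mx_sum (@e N) c).
  have := nm_tri x (mx_sum (@e N) c) 0; rewrite !subr0; lra.
have t2 : 0 <= nm x / 2 by lra.
(* Contraposition of [nm_mx_sum]: a large norm is witnessed by vectors p and q in a single block. *)
have /existsNP[v /existsNP[p /existsNP[q /not_implyP[pv /not_implyP[qv]]]]] :
    ~ mx_bound (@b N) (nm x / 2) c.
  by move=> /(nm_mx_sum (@e_block N) (@eM N) (@eM0 N) (@eJ N) t2); lra.
move=> /negP; rewrite -ltNge => big.
(* Over an empty block p would be 0, and the form could not be large. *)
have [ o ov] : exists o : T N, b o = v.
  apply: contrapT => no; move: big; rewrite /mx_form.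
  have sp : sqn p = 0 by rewrite /sqn big1 // => i _; rewrite pv ?nm0 ?expr0n //; apply/eqP => E; apply: no; exists i.
  rewrite big1 ?nm0 ?sp ?mul0r ?mulr0 ?expr0n ?ltxx // => i _; rewrite big1 // => j _.
  by rewrite pv ?conjC0 ?mul0r //; apply/eqP => E; apply: no; exists i.
exists N, o; rewrite -ov in pv qv.
set kap := mx_form p c q in big; set P := \sum_i (p i)^* *: e o i; set Q := \sum_j q j *: e j o.
have PQ : P ** mx_sum (@e N) c ** Q = kap *: e o o by exact: row_mul.
have nP : nm P ^+ 2 <= sqn p by exact: nm_row.
have nQ : nm Q ^+ 2 <= sqn q by exact: nm_col.
have k0 : 0 < nm kap.
  rewrite lt_neqAle eq_sym nm_ge0 andbT; apply/eqP => k0; move: big; rewrite k0 expr0n /= ltNge.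
  by move/negP; apply; rewrite mulr_ge0 ?sqr_ge0 // mulr_ge0 ?sqn_ge0.
have kap0 : kap != 0 by apply/eqP => E; move: k0; rewrite E nm0 ltxx.
have BL (f : T N -> C) (g : T N -> A) : (forall j, mx_span (@e N) (g j)) -> B (\sum_j f j *: g j).
  move=> gN; apply: (@af_core_sub N); have sN := mx_span_subspace (@e N).
  by apply: subspace_sum => // j _; have [_ _ sZ] := sN; exact: sZ.
have BP : B P by apply: BL => j; exact: mx_span_e.
have BQ : B Q by apply: BL => j; exact: mx_span_e.
have Be : B (e o o) by apply: (@af_core_sub N); exact: mx_span_e.
have [_ _ IZ] := sI.
apply: (@idempotent_near_ideal I _ (kap^-1 *: (P ** x ** Q))) => //.
- by move=> y Iy; exact: BI.
- by move=> y z Iy Iz; have [] := BI y z (IB _ Iy) Iz.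
- exact: eM.
- by apply: IZ; have [_] := BI Q (P ** x) BQ (BI P x BP Ix).1.
have -> : e o o - kap^-1 *: (P ** x ** Q) = kap^-1 *: (P ** (mx_sum (@e N) c - x) ** Q).
  by rewrite cs_mulBr cs_mulBl PQ scalerBr scalerA mulVf // scale1r.
rewrite nmZ (_ : nm kap^-1 = (nm kap)^-1); last first.
  apply: (mulfI (lt0r_neq0 k0)); rewrite -nmM divff // nm1 divff //; exact: lt0r_neq0.
rewrite mulrC ler_pdivrMr //.
apply: le_trans (nm_cs_mul _ _) _; rewrite mulrC.
have E1 := nm_cs_mul P (mx_sum (@e N) c - x); rewrite nmB in E1.
apply: le_trans (ler_wpM2l (nm_ge0 _) E1) _.
rewrite -(@ler_pXn2r _ 2) ?nnegrE ?mulr_ge0 ?nm_ge0 ?invr_ge0 //.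
have nk : (nm x) ^+ 2 / 4 * (sqn p * sqn q) <= nm kap ^+ 2.
  by apply: ltW; rewrite (_ : nm x ^+ 2 / 4 = (nm x / 2) ^+ 2) //; field.
apply: (@le_trans _ _ ((nm x / 4) ^+ 2 * (sqn p * sqn q))); last first.
  rewrite exprMn; set X := _ * sqn q in nk *; move: nk; nra.
rewrite [X in X <= _](_ : _ = nm (x - mx_sum (@e N) c) ^+ 2 * (nm P ^+ 2 * nm Q ^+ 2)); last by ring.
apply: ler_pM; [exact: sqr_ge0 | by rewrite mulr_ge0 ?sqr_ge0 | |].
  by rewrite ler_pXn2r ?nnegrE ?nm_ge0 ?ltW.
by apply: ler_pM; rewrite ?sqr_ge0.
Qed.

Theorem matrix_units_simple_AF : simple_AF_algebra B.
Proof.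
have Fs N := mx_span_star (@e_block N) (@eM N) (@eM0 N) (@eJ N).
have mono m n : (m <= n)%N -> mx_span (@e m) `<=` mx_span (@e n).
  move=> /subnKC <-; elim: (n - m)%N => [|k IH]; rewrite ?addn0 ?addnS //.
  by apply: subset_trans IH _; exact: mx_span_mono.
split.
- exact/closure_star_subalgebra/bigcup_star_subalgebra/mx_span_mono.
- split.
    have [N [i ei]] := e_neq0; exists (e i i) => //.
    by apply: (@af_core_sub N); exact: mx_span_e.
  move=> I IB sI cI BI; have [I0 _ _] := sI.
  have [[x Ix x0]|no] := pselect (exists2 x, I x & x <> 0); last first.
    left; apply/seteqP; split=> [x Ix|x ->] //=; apply: contrapT => x0.
    by apply: no; exists x.
  right; apply/seteqP; split=> //.
  have [N [ o Io]] := ideal_contains_unit IB sI cI BI Ix x0.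
  have [M0 conn] := e_conn o.
  have sub M : (M0 <= M)%N -> mx_span (@e M) `<=` I.
    move=> MM; apply: mx_span_sub => // i j.
    have [ij|ij] := eqVneq (b i) (b j); last by rewrite e_block //; have [] := sI.
    (* e_ij = e_ii e_ij, and only diagonal units are covered by the connection hypothesis. *)
    rewrite -(eM _ (erefl (b i))); have [p [q [pM qM ->]]] := conn M MM i.
    have [Ip _] := BI p (e o o) (af_core_sub pM) Io.
    have [_ Iq] := BI q (p ** e o o) (af_core_sub qM) Ip.
    by have [_] := BI (e i j) (p ** e o o ** q) (af_core_sub (mx_span_e _ _ _)) Iq.
  move/closure_id: (cI) => ->; apply: closure_subset => y [M _ yM].
  by apply: (sub (maxn M0 M) (leq_maxl _ _)); apply: mono yM; exact: leq_maxr.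
- exists (fun N => mx_span (@e N)); split=> //; last exact: mx_span_mono.
  by move=> N; split=> //; exact: mx_span_fin.
Qed.

End AFSimple.

(** * Bounded operators on a completion *)

Section SeqComplete.
Variable R : realType.
Local Notation C := (complex R).

Definition seq_complete (V : normedModType C) := forall u : nat -> V,
  (forall e : R, 0 < e -> exists N : nat, forall m n, (N <= m)%N -> (N <= n)%N -> nm (u m - u n) < e) ->
  exists l, forall e : R, 0 < e -> exists N : nat, forall n, (N <= n)%N -> nm (u n - l) < e.

Lemma real_seq_complete (u : nat -> R) :
  (forall e : R, 0 < e -> exists N : nat, forall m n, (N <= m)%N -> (N <= n)%N -> `|u m - u n| < e) ->
  exists l, forall e : R, 0 < e -> exists N : nat, forall n, (N <= n)%N -> `|u n - l| < e.
Proof.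
move=> cu; have /cauchy_cvgP/cvg_ex[l ul] : cauchy (u @ \oo).
  apply: cauchy_exP => e e0; have [N NP] := cu e e0.
  by exists (u N); exists N => // n /= Nn; rewrite -ball_normE; exact: NP.
exists l => e e0; move/cvgrPdist_lt: ul => /(_ e e0)[N _ NP].
by exists N => n /NP; rewrite distrC.
Qed.

Lemma nm_le_ReIm (z : C) : nm z <= `|complex.Re z| + `|complex.Im z|.
Proof.
have -> : z = (complex.Re z)%:C%C + 'i%C * (complex.Im z)%:C%C by rewrite -complexE.
by apply: le_trans (nmD _ _) _; rewrite nmM nm_i mul1r !nmR -complexE.
Qed.

Lemma Re_le_nm (z : C) : `|complex.Re z| <= nm z.
Proof. by rewrite -lecR -nmE normc_ge_Re. Qed.

Lemma Im_le_nm (z : C) : `|complex.Im z| <= nm z.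
Proof.
have := Re_le_nm ('i%C * z); rewrite nmM nm_i mul1r.
by rewrite mulrC ReiNIm normrN.
Qed.

Lemma complex_seq_complete : seq_complete C^o.
Proof.
move=> u cu.
have [|a ua] := @real_seq_complete (fun n => complex.Re (u n)).
  move=> e /cu[N NP]; exists N => m n Nm Nn; apply: le_lt_trans (NP m n Nm Nn).
  by apply: le_trans (Re_le_nm _); rewrite raddfB.
have [|b ub] := @real_seq_complete (fun n => complex.Im (u n)).
  move=> e /cu[N NP]; exists N => m n Nm Nn; apply: le_lt_trans (NP m n Nm Nn).
  by apply: le_trans (Im_le_nm _); rewrite raddfB.
exists (Complex a b) => e e0; have e2 : 0 < e / 2 by lra.
have [N NP] := ua _ e2; have [M MP] := ub _ e2; exists (maxn N M) => n.
rewrite geq_max => /andP[/NP h1 /MP h2]; apply: le_lt_trans (nm_le_ReIm _) _.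
by rewrite !raddfB /=; lra.
Qed.

(** A Cauchy filter contains balls of radius 2^-n; their centres form a Cauchy sequence whose limit
    is the limit of the filter. *)
Lemma seq_complete_filter (V : normedModType C) : seq_complete V ->
  forall F : set_system V, ProperFilter F -> cauchy F -> cvg F.
Proof.
move=> cV F PF cF.
have near n : exists x : V, F [set y | nm (x - y) < (2^-1 : R) ^+ n].
  have e0 : 0 < ((2^-1 : R) ^+ n)%:C%C by rewrite ltcR exprn_gt0 // invr_gt0.
  have [x xF] := (cauchyP _).1 cF _ e0; exists x; apply: filterS xF => y.
  by move/ballC.
have [u uF] := choice near.
have u_near m n : nm (u m - u n) < (2^-1 : R) ^+ m + 2^-1 ^+ n.
  have [y [my ny]] := filter_ex (filterI (uF m) (uF n)).
  apply: le_lt_trans (nm_tri _ y _) _; rewrite (nmB y); exact: ltrD.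
have small (e : R) : 0 < e -> exists N : nat, forall n, (N <= n)%N -> (2^-1 : R) ^+ n < e / 2.
  by move=> e0; apply: expr_small; lra.
have [|l ul] := cV u.
  move=> e /small[N NP]; exists N => m n /NP hm /NP hn.
  by apply: lt_trans (u_near m n) _; lra.
apply/cvg_ex; exists l => S /nbhsC[e e0 eS].
have e2 : 0 < e / 2 by lra.
have [N NP] := ul _ e2; have [M MP] := small e e0; set n := maxn N M.
apply: filterS (uF n) => y uy; apply: eS.
apply: le_lt_trans (nm_tri _ (u n) _) _.
have := NP n (leq_maxl _ _); have := MP n (leq_maxr _ _); rewrite nmB => h1 h2.
by move: uy => /=; lra.
Qed.

(** The restriction e <= 1 lets quadratic error terms be bounded linearly. In the proof the summand
    d of the denominator keeps the chosen e below 1. *)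
Lemma eq_of_approx (V : normedModType C) (x y : V) (K : R) :
  (forall e, 0 < e -> e <= 1 -> nm (x - y) <= K * e) -> x = y.
Proof.
move=> h; apply/eqP; rewrite -subr_eq0; apply/eqP/nm_eq0.
rewrite leNgt; apply/negP => d0; set d := nm (x - y) in h d0.
have K0 : 0 < 2 * `|K| + 2 + d by have := normr_ge0 K; lra.
have e1 : d / (2 * `|K| + 2 + d) <= 1 by rewrite ler_pdivrMr // mul1r; have := normr_ge0 K; lra.
have := h _ (divr_gt0 d0 K0) e1.
by rewrite mulrA ler_pdivlMr //; have := ler_norm K; have := normr_ge0 K; nra.
Qed.

End SeqComplete.

(* Scalars act through their conjugate at the points where b holds: the pairs (T, T^star) of an
   operator and its adjoint form such a space. *)
Definition tw (R : realType) (b : bool) (c : complex R) : complex R := if b then c^* else c.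

(* Functions f with f w = O(weight w), for the norm sup |f w| / weight w. *)
Record fdata (R : realType) := Fdata {
  fW : Type;
  fU : normedModType (complex R);
  weight : fW -> R;
  twist : fW -> bool;
  fP : set (fW -> fU);
  fU_complete : seq_complete fU;
  weight_ge0 : forall w, 0 <= weight w;
  fP0 : fP (fun=> 0);
  fPD : forall f g, fP f -> fP g -> fP (fun w => f w + g w);
  fPZ : forall (c : complex R) f, fP f -> fP (fun w => tw (twist w) c *: f w);
  fP_bounded : forall f, fP f -> exists2 K, 0 <= K & forall w, nm (f w) <= K * weight w;
  fP_closed : forall f, (forall e : R, 0 < e -> exists2 g, fP g &
    forall w, nm (f w - g w) <= e * weight w) -> fP f
}.

Record fspace (R : realType) (D : fdata R) := Fspace { fval :> fW D -> fU D; fvalP : fP fval }.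

HB.instance Definition _ R (D : fdata R) := gen_eqMixin (fspace D).
HB.instance Definition _ R (D : fdata R) := gen_choiceMixin (fspace D).

Section FspaceModule.
Variables (R : realType) (D : fdata R).
Local Notation C := (complex R).
Implicit Types f g h : fspace D.

Lemma twM (b : bool) (a c : C) : tw b (a * c) = tw b a * tw b c.
Proof. by case: b; rewrite /tw ?rmorphM. Qed.

Lemma twD (b : bool) (a c : C) : tw b (a + c) = tw b a + tw b c.
Proof. by case: b; rewrite /tw ?rmorphD. Qed.

Lemma tw1 (b : bool) : tw b (1 : C) = 1.
Proof. by case: b; rewrite /tw ?conjC1. Qed.

Lemma twN1 (b : bool) : tw b (-1 : C) = -1.
Proof. by case: b; rewrite /tw ?conjCN1. Qed.

Lemma nm_tw (b : bool) (c : C) : nm (tw b c) = nm c.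
Proof. by case: b; rewrite /tw ?nm_conj. Qed.

Lemma fspace_ext f g : (forall w, f w = g w) -> f = g.
Proof.
case: f g => [f Pf] [g Pg] /= /funext E; subst g; congr Fspace; exact: Prop_irrelevance.
Qed.

Definition f_zero : fspace D := Fspace (fP0 D).
Definition f_add f g : fspace D := Fspace (fPD (fvalP f) (fvalP g)).
Definition f_scale (c : C) f : fspace D := Fspace (fPZ c (fvalP f)).
Definition f_opp f := f_scale (-1) f.

Lemma f_addA : associative f_add.
Proof. by move=> f g h; apply: fspace_ext => w /=; rewrite addrA. Qed.
Lemma f_addC : commutative f_add.
Proof. by move=> f g; apply: fspace_ext => w /=; rewrite addrC. Qed.
Lemma f_add0 : left_id f_zero f_add.
Proof. by move=> f; apply: fspace_ext => w /=; rewrite add0r. Qed.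
Lemma f_addN : left_inverse f_zero f_opp f_add.
Proof. by move=> f; apply: fspace_ext => w /=; rewrite twN1 scaleN1r addNr. Qed.
End FspaceModule.

HB.instance Definition _ R (D : fdata R) :=
  GRing.isZmodule.Build (fspace D) (@f_addA R D) (@f_addC R D) (@f_add0 R D) (@f_addN R D).

Section FspaceLmodule.
Variables (R : realType) (D : fdata R).
Local Notation C := (complex R).
Implicit Types f g h : fspace D.

Lemma f_scaleA (a c : C) f : f_scale a (f_scale c f) = f_scale (a * c) f.
Proof. by apply: fspace_ext => w /=; rewrite scalerA twM. Qed.
Lemma f_scale1 : left_id 1 (@f_scale R D).
Proof. by move=> f; apply: fspace_ext => w /=; rewrite tw1 scale1r. Qed.
Lemma f_scaleDr : right_distributive (@f_scale R D) +%R.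
Proof. by move=> c f g; apply: fspace_ext => w /=; rewrite scalerDr. Qed.
Lemma f_scaleDl f : {morph (@f_scale R D)^~ f : a c / a + c}.
Proof. by move=> a c; apply: fspace_ext => w /=; rewrite twD scalerDl. Qed.
End FspaceLmodule.

HB.instance Definition _ R (D : fdata R) :=
  GRing.Zmodule_isLmodule.Build (complex R) (fspace D) (@f_scaleA R D) (@f_scale1 R D)
    (@f_scaleDr R D) (@f_scaleDl R D).

Section FspaceNorm.
Variables (R : realType) (D : fdata R).
Local Notation C := (complex R).
Implicit Types f g h : fspace D.

Lemma fspaceD f g w : (f + g : fspace D) w = f w + g w. Proof. by []. Qed.
Lemma fspaceZ (c : C) f w : (c *: f : fspace D) w = tw (twist w) c *: f w. Proof. by []. Qed.
Lemma fspaceN f w : (- f : fspace D) w = - f w. Proof. by rewrite -scaleN1r fspaceZ twN1 scaleN1r. Qed.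

Let bounds f : set R := [set K | 0 <= K /\ forall w, nm (f w) <= K * weight w].

(** An infimum of bounds instead of a supremum of quotients, because a weight may vanish. *)
Definition fnorm f : R := inf (bounds f).

Let bounds_inf f : has_inf (bounds f).
Proof.
split; last by exists 0 => K [].
by have [K K0 KP] := fP_bounded (fvalP f); exists K.
Qed.

Lemma fnorm_ge0 f : 0 <= fnorm f.
Proof. by apply: lb_le_inf => [|K []//]; have [] := bounds_inf f. Qed.

Lemma fnorm_le f K : 0 <= K -> (forall w, nm (f w) <= K * weight w) -> fnorm f <= K.
Proof. by move=> K0 KP; apply: ge_inf; [have [] := bounds_inf f|]. Qed.

Lemma fnormP f w : nm (f w) <= fnorm f * weight w.
Proof.
have w0 := weight_ge0 w; have [wE|wN] := eqVneq (weight w) 0.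
  by have [K _ /(_ w)] := fP_bounded (fvalP f); rewrite wE !mulr0.
have wp : 0 < weight w by rewrite lt_neqAle eq_sym wN.
rewrite -ler_pdivrMr //; apply: lb_le_inf; first by have [] := bounds_inf f.
by move=> K [_ /(_ w)]; rewrite ler_pdivrMr.
Qed.

Lemma fnormD f g : ((fnorm (f + g))%:C <= (fnorm f)%:C + (fnorm g)%:C)%C.
Proof.
rewrite -rmorphD lecR; apply: fnorm_le; first by rewrite addr_ge0 ?fnorm_ge0.
move=> w; rewrite fspaceD mulrDl; apply: le_trans (nmD _ _) _.
by rewrite lerD // fnormP.
Qed.

Lemma fnormZ (c : C) f : ((fnorm (c *: f))%:C)%C = `|c| * ((fnorm f)%:C)%C.
Proof.
rewrite nmE -rmorphM; congr (_%:C)%C.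
have le (a : C) g : fnorm (a *: g) <= nm a * fnorm g.
  apply: fnorm_le => [|w]; first by rewrite mulr_ge0 ?nm_ge0 ?fnorm_ge0.
  by rewrite fspaceZ nmZ nm_tw -mulrA ler_wpM2l ?nm_ge0 ?fnormP.
apply/eqP; rewrite eq_le le /=.
have [->|c0] := eqVneq c 0; first by rewrite nm0 mul0r fnorm_ge0.
have := le c^-1 (c *: f); rewrite scalerA mulVf // scale1r => h.
have E : nm c * nm c^-1 = 1 by rewrite -nmM divff // nm1.
have := ler_wpM2l (nm_ge0 c) h; rewrite mulrA E mul1r; exact.
Qed.

Lemma fnorm_eq0 f : ((fnorm f)%:C)%C = 0 :> C -> f = 0.
Proof.
move=> /complexI f0; apply: fspace_ext => w; apply: nm_eq0.
by have := fnormP f w; rewrite f0 mul0r.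
Qed.
End FspaceNorm.

HB.instance Definition _ R (D : fdata R) :=
  Lmodule_isNormed.Build (complex R) (fspace D) (@fnormD R D) (@fnormZ R D) (@fnorm_eq0 R D).

Section FspaceComplete.
Variables (R : realType) (D : fdata R).
Local Notation C := (complex R).
Implicit Types f g h : fspace D.

Lemma nm_fspace f w : nm (f w) <= nm f * weight w.
Proof. exact: fnormP. Qed.

Lemma nm_fspace_le f K : 0 <= K -> (forall w, nm (f w) <= K * weight w) -> nm f <= K.
Proof. exact: fnorm_le. Qed.

Lemma fspace_seq_complete : seq_complete (fspace D).
Proof.
move=> u cu.
have pt w : exists l, forall e : R, 0 < e -> exists N : nat, forall n, (N <= n)%N -> nm (u n w - l) < e.
  apply: fU_complete => e e0; have w1 : 0 < weight w + 1 by rewrite ltr_wpDl // weight_ge0.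
  have [N NP] := cu _ (divr_gt0 e0 w1); exists N => m n Nm Nn.
  have := nm_fspace (u m - u n) w; rewrite fspaceD fspaceN => /le_lt_trans; apply.
  have := NP m n Nm Nn; rewrite ltr_pdivlMr //; have := nm_ge0 (u m - u n); have := weight_ge0 w; nra.
have [l lP] := choice pt.
have unif (e : R) : 0 < e -> exists N : nat, forall n, (N <= n)%N -> forall w, nm (u n w - l w) <= e * weight w.
  move=> e0; have [N NP] := cu e e0; exists N => n Nn w.
  apply/ler_addgt0Pr => d d0; have [M MP] := lP w d d0.
  apply: le_trans (nm_tri _ (u (maxn N M) w) _) _; apply: lerD; last first.
    by apply/ltW/MP; exact: leq_maxr.
  have := nm_fspace (u n - u (maxn N M)) w; rewrite fspaceD fspaceN => /le_trans; apply.
  by rewrite ler_wpM2r ?weight_ge0 // ltW // NP // leq_maxl.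
have Pl : fP l.
  apply: fP_closed => e /unif[N NP]; exists (u N); first exact: fvalP.
  by move=> w; rewrite nmB; exact: NP.
exists (Fspace Pl) => e e0; have e2 : 0 < e / 2 by lra.
have [N NP] := unif _ e2; exists N => n Nn.
apply: le_lt_trans (_ : e / 2 < e); last lra.
by apply: nm_fspace_le => [|w]; [lra | rewrite fspaceD fspaceN; exact: NP].
Qed.
End FspaceComplete.

HB.instance Definition _ R (D : fdata R) :=
  Uniform_isComplete.Build (fspace D) (seq_complete_filter (@fspace_seq_complete R D)).

(** The axioms are confined to the subset [pV], so vectors can remain plain functions inside a
    larger module. The form may be degenerate. *)
Record prehilbert (R : realType) := Prehilbert {
  pW : lmodType (complex R);
  pV : set pW;
  pip : pW -> pW -> complex R;
  pV0 : pV 0;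
  pVD : forall x y, pV x -> pV y -> pV (x + y);
  pVZ : forall (c : complex R) x, pV x -> pV (c *: x);
  pipDl : forall x y z, pV x -> pV y -> pV z -> pip (x + y) z = pip x z + pip y z;
  pipZl : forall (c : complex R) x y, pV x -> pV y -> pip (c *: x) y = c * pip x y;
  pipC : forall x y, pV x -> pV y -> pip x y = (pip y x)^*;
  pip_ge0 : forall x, pV x -> 0 <= pip x x
}.

(** * The completion of a pre-Hilbert space and extension of operators to it *)

Section Prehilbert.
Variables (R : realType) (E : prehilbert R).
Local Notation C := (complex R).
Local Notation V := (@pV R E).
Local Notation ip := (@pip R E).

Definition pn (x : pW E) : R := Num.sqrt (complex.Re (ip x x)).

Lemma pn_ge0 x : 0 <= pn x. Proof. exact: sqrtr_ge0. Qed.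

Lemma pn_sqr x : V x -> ip x x = (pn x ^+ 2)%:C%C.
Proof.
move=> /pip_ge0 h; rewrite sqr_sqrtr; first by rewrite RRe_real ?ger0_real.
by move: h; rewrite lecE => /andP[].
Qed.

Lemma pVB x y : V x -> V y -> V (x - y).
Proof. by move=> Vx Vy; apply: pVD => //; rewrite -scaleN1r; exact: pVZ. Qed.

Lemma pipDr x y z : V x -> V y -> V z -> ip z (x + y) = ip z x + ip z y.
Proof.
move=> Vx Vy Vz; rewrite pipC ?pipDl //; last exact: pVD.
by rewrite rmorphD /= -!(pipC Vz).
Qed.

Lemma pipZr (c : C) x y : V x -> V y -> ip y (c *: x) = c^* * ip y x.
Proof.
by move=> Vx Vy; rewrite (pipC Vy (pVZ c Vx)) pipZl // rmorphM /= -(pipC Vy Vx).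
Qed.

Lemma cauchy_schwarz x y : V x -> V y -> nm (ip x y) <= pn x * pn y.
Proof.
move=> Vx Vy; set c := ip x y.
(* This is the square of the length of x - s c y. *)
have key (s : R) : 0 <= pn x ^+ 2 - 2 * s * nm c ^+ 2 + s ^+ 2 * nm c ^+ 2 * pn y ^+ 2.
  have Vcy : V (- (s%:C%C * c) *: y) by exact: pVZ.
  have Vz := pVD Vx Vcy.
  have cj : (- (s%:C%C * c))^* = - (s%:C%C * c^*).
    have cs : (s%:C%C : C)^* = s%:C%C by rewrite conj_Creal // complex_real.
    by rewrite rmorphN rmorphM; exact: (congr1 (fun z => - (z * c^*)) cs).
  have := pip_ge0 Vz; rewrite pipDl ?pipDr ?pipZl ?pipZr //.
  rewrite (pipC Vy Vx) -/c !pn_sqr // cj.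
  have cc : c * c^* = (nm c ^+ 2)%:C%C by rewrite -normCK nmE rmorphXn.
  have -> : (pn x ^+ 2)%:C%C + - (s%:C%C * c^*) * c + (- (s%:C%C * c) * c^* + - (s%:C%C * c) * (- (s%:C%C * c^*) * (pn y ^+ 2)%:C%C))
     = (pn x ^+ 2)%:C%C - 2 * s%:C%C * (c * c^*) + s%:C%C ^+ 2 * (c * c^*) * (pn y ^+ 2)%:C%C by ring.
  have -> : (2 : C) = (2 : R)%:C%C by rewrite rmorph_nat.
  by rewrite cc -!rmorphM -rmorphXn -!rmorphM -rmorphB -rmorphD lecR.
have [c0|c0] := eqVneq (nm c) 0; first by rewrite c0 mulr_ge0 ?pn_ge0.
have cp : 0 < nm c ^+ 2 by rewrite exprn_gt0 // lt_neqAle eq_sym c0 nm_ge0.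
(* If y is a null vector, [key] is affine in s with negative slope and fails for large s; otherwise
   the best s is 1/|y|^2. *)
have [y0|y0] := eqVneq (pn y) 0.
  have := key ((pn x ^+ 2 + 1) / nm c ^+ 2); rewrite y0 expr0n mulr0 addr0 -mulrA divfK ?gt_eqF //.
  have := sqr_ge0 (pn x); lra.
have yp : 0 < pn y ^+ 2 by rewrite exprn_gt0 // lt_neqAle eq_sym y0 pn_ge0.
have := key (pn y ^+ 2)^-1.
have -> : pn x ^+ 2 - 2 * (pn y ^+ 2)^-1 * nm c ^+ 2 + (pn y ^+ 2)^-1 ^+ 2 * nm c ^+ 2 * pn y ^+ 2
   = pn x ^+ 2 - nm c ^+ 2 / pn y ^+ 2 by field.
rewrite subr_ge0 ler_pdivrMr // -exprMn ler_pXn2r // nnegrE ?mulr_ge0 ?nm_ge0 ?pn_ge0 //.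
Qed.

(* The vector v, seen as the antilinear functional <v, .> on V. *)
Definition vfun (v : pW E) (w : {w | V w}) : C^o := ip v (sval w).

(** The completion is the closure of the vectors among the functionals, in the dual norm. This needs
    neither classes of Cauchy sequences nor a quotient by null vectors. *)
Definition hP : set ({w | V w} -> C^o) := [set phi | forall e : R, 0 < e ->
  exists2 v, V v & forall w, nm (phi w - vfun v w) <= e * pn (sval w)].

Lemma vfunD u v w : V u -> V v -> vfun (u + v) w = vfun u w + vfun v w.
Proof. by move=> Vu Vv; case: w => w Vw; exact: pipDl. Qed.

Lemma vfunZ (c : C) v w : V v -> vfun (c *: v) w = c * vfun v w.
Proof. by move=> Vv; case: w => w Vw; exact: pipZl. Qed.

Lemma hP_vfun v : V v -> hP (vfun v).
Proof. by move=> Vv e e0; exists v => // w; rewrite subrr nm0 mulr_ge0 ?pn_ge0 // ltW. Qed.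

Lemma hP0 : hP (fun=> 0).
Proof.
move=> e e0; exists 0; first exact: pV0.
move=> [w Vw]; have := @vfunZ 0 0 (exist _ w Vw) (pV0 E); rewrite scale0r mul0r => ->.
by rewrite subrr nm0 mulr_ge0 ?pn_ge0 // ltW.
Qed.

Lemma hPD f g : hP f -> hP g -> hP (fun w => f w + g w).
Proof.
move=> hf hg e e0; have e2 : 0 < e / 2 by lra.
have [u Vu uf] := hf _ e2; have [v Vv vg] := hg _ e2.
exists (u + v); first exact: pVD.
move=> w; rewrite vfunD // opprD addrACA; apply: le_trans (nmD _ _) _.
by have := uf w; have := vg w; lra.
Qed.

Lemma hPZ (c : C) f : hP f -> hP (fun w => c *: f w).
Proof.
move=> hf e e0; have c1 : 0 < nm c + 1 by rewrite ltr_wpDl ?nm_ge0.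
have [v Vv vf] := hf _ (divr_gt0 e0 c1).
exists (c *: v); first exact: pVZ.
move=> w; rewrite vfunZ // -scalerBr nmZ.
apply: le_trans (ler_wpM2l (nm_ge0 _) (vf w)) _.
rewrite mulrA ler_wpM2r ?pn_ge0 // mulrA ler_pdivrMr //; have := nm_ge0 c; nra.
Qed.

Lemma hP_bounded f : hP f -> exists2 K, 0 <= K & forall w, nm (f w) <= K * pn (sval w).
Proof.
move=> /(_ 1 ltr01)[v Vv vf]; exists (1 + pn v); first by rewrite addr_ge0 ?pn_ge0.
move=> [w Vw]; have := nm_tri (f (exist _ w Vw)) (vfun v (exist _ w Vw)) 0.
rewrite !subr0 => /le_trans; apply; rewrite mulrDl; apply: lerD => //.
exact: cauchy_schwarz.
Qed.

Lemma hP_closed f : (forall e : R, 0 < e -> exists2 g, hP g &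
  forall w, nm (f w - g w) <= e * pn (sval w)) -> hP f.
Proof.
move=> h e e0; have e2 : 0 < e / 2 by lra.
have [g hg fg] := h _ e2; have [v Vv vg] := hg _ e2; exists v => // w.
by have := nm_tri (f w) (g w) (vfun v w); have := fg w; have := vg w; lra.
Qed.

Definition compl_data : fdata R := Fdata (twist := fun=> false) (@complex_seq_complete R)
  (fun w : {w | V w} => pn_ge0 (sval w)) hP0 hPD hPZ hP_bounded hP_closed.

Definition compl : completeNormedModType C := fspace compl_data.

Implicit Types f g h : compl.

Definition vec (v : pW E) (Vv : V v) : compl := Fspace (hP_vfun Vv : @fP R compl_data _).

Lemma nm_vec v (Vv : V v) : nm (vec Vv) = pn v.
Proof.
apply/eqP; rewrite eq_le; apply/andP; split.
  by apply: nm_fspace_le => [|[w Vw]]; [exact: pn_ge0 | exact: cauchy_schwarz].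
have := nm_fspace (vec Vv) (exist _ v Vv); rewrite [nm (_ _)](_ : _ = pn v ^+ 2); last first.
  by rewrite /= /vfun /= pn_sqr // nmR ger0_norm ?sqr_ge0.
rewrite /=; have [->|v0] := eqVneq (pn v) 0; first by rewrite nm_ge0.
by rewrite expr2 ler_pM2r // lt_neqAle eq_sym v0 pn_ge0.
Qed.

Lemma vec_dense f (e : R) : 0 < e -> exists v, exists Vv : V v, nm (f - vec Vv) <= e.
Proof.
move=> e0; have [v Vv vf] := (fvalP f : hP f) e e0; exists v, Vv.
by apply: nm_fspace_le => [|w]; [exact: ltW | rewrite fspaceD fspaceN; exact: vf].
Qed.

Lemma nm_vec_le f v (Vv : V v) (e : R) : nm (f - vec Vv) <= e -> pn v <= nm f + e.
Proof.
move=> h; rewrite -(nm_vec Vv); have := nm_tri (vec Vv) f 0; rewrite !subr0 (nmB (vec Vv)); lra.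
Qed.

Lemma vecD u v (Vu : V u) (Vv : V v) : vec (pVD Vu Vv) = vec Vu + vec Vv.
Proof. by apply: fspace_ext => w; exact: vfunD. Qed.

Lemma vecZ c u (Vu : V u) : vec (pVZ c Vu) = c *: vec Vu.
Proof. by apply: fspace_ext => w; exact: vfunZ. Qed.

Lemma vecB u v (Vu : V u) (Vv : V v) : vec (pVB Vu Vv) = vec Vu - vec Vv.
Proof.
apply: fspace_ext => w; rewrite fspaceD fspaceN /= -[X in vfun (_ + X)]scaleN1r.
by rewrite vfunD ?vfunZ ?mulN1r //; exact: pVZ.
Qed.

(** The inner product of v with f. The conjugate appears because f itself stands for w |-> <f,
    w>. *)
Definition feval f v (Vv : V v) : C := (f (exist _ v Vv))^*.

Lemma feval_le f v (Vv : V v) : nm (feval f Vv) <= nm f * pn v.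
Proof. by rewrite /feval nm_conj; have := nm_fspace f (exist _ v Vv). Qed.

Lemma feval_approx f u v (Vu : V u) (Vv : V v) :
  nm (feval f Vu - ip u v) <= nm (f - vec Vv) * pn u.
Proof.
rewrite (pipC Vu Vv) /feval -rmorphB nm_conj.
by have := nm_fspace (f - vec Vv) (exist _ u Vu); rewrite fspaceD fspaceN.
Qed.

Lemma fevalDr f u v (Vu : V u) (Vv : V v) :
  feval f (pVD Vu Vv) = feval f Vu + feval f Vv.
Proof.
apply: (@eq_of_approx _ C^o _ _ (pn (u + v) + pn u + pn v)) => e e0 _.
have [w [Vw fw]] := vec_dense f e0.
have -> : feval f (pVD Vu Vv) - (feval f Vu + feval f Vv) =
   (feval f (pVD Vu Vv) - ip (u + v) w) - ((feval f Vu - ip u w) + (feval f Vv - ip v w)).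
  by rewrite pipDl //; ring.
have := feval_approx f (pVD Vu Vv) Vw; have := feval_approx f Vu Vw; have := feval_approx f Vv Vw.
have := pn_ge0 (u + v); have := pn_ge0 u; have := pn_ge0 v.
set X := feval f (pVD Vu Vv) - _; set Y := feval f Vu - _; set Z := feval f Vv - _.
have := nmD X (- (Y + Z)); rewrite nmN; have := nmD Y Z; nra.
Qed.

Lemma fevalZr f c u (Vu : V u) : feval f (pVZ c Vu) = c * feval f Vu.
Proof.
apply: (@eq_of_approx _ C^o _ _ (pn (c *: u) + nm c * pn u)) => e e0 _.
have [w [Vw fw]] := vec_dense f e0.
have -> : feval f (pVZ c Vu) - c * feval f Vu =
   (feval f (pVZ c Vu) - ip (c *: u) w) - c * (feval f Vu - ip u w).
  by rewrite pipZl //; ring.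
have := feval_approx f (pVZ c Vu) Vw; have := feval_approx f Vu Vw.
have := pn_ge0 (c *: u); have := pn_ge0 u.
set X := feval f (pVZ c Vu) - _; set Y := feval f Vu - _ => a1 a2 a3 a4.
have := nmD X (- (c * Y)); rewrite nmN nmM => /le_trans; apply.
rewrite mulrDl; apply: lerD; first by apply: le_trans a4 _; rewrite mulrC ler_wpM2l.
by rewrite -mulrA ler_wpM2l ?nm_ge0 //; apply: le_trans a3 _; rewrite mulrC ler_wpM2l.
Qed.

Lemma fevalBr f u v (Vu : V u) (Vv : V v) :
  feval f (pVB Vu Vv) = feval f Vu - feval f Vv.
Proof.
have -> : feval f (pVB Vu Vv) = feval f (pVD Vu (pVZ (-1) Vv)).
  by rewrite /feval; congr ((f _)^*); apply: eq_exist; rewrite scaleN1r.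
by rewrite fevalDr fevalZr mulN1r.
Qed.

(** c is the limit of <u_n, g> for vectors u_n tending to f. By density the estimate determines c,
    and it is the working characterisation of the inner product. *)
Lemma hip_ex f g : exists c : C, forall v (Vv : V v), nm (c - feval g Vv) <= nm (f - vec Vv) * nm g.
Proof.
have /choice[u uP] : forall n, exists u : {v | V v}, nm (f - vec (proj2_sig u)) <= 2^-1 ^+ n.
  move=> n; have [v [Vv fv]] := @vec_dense f (2^-1 ^+ n) ltac:(by rewrite exprn_gt0 // invr_gt0).
  by exists (exist _ v Vv).
pose a n := feval g (proj2_sig (u n)) : C^o.
have dist v (Vv : V v) n : nm (a n - feval g Vv) <= (nm (f - vec Vv) + 2^-1 ^+ n) * nm g.
  rewrite /a -fevalBr; apply: le_trans (feval_le _ _) _; rewrite mulrC ler_wpM2r ?nm_ge0 //.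
  rewrite -(nm_vec (pVB (proj2_sig (u n)) Vv)) vecB; apply: le_trans (nm_tri _ f _) _.
  by rewrite addrC lerD // nmB.
have g1 : 0 < 2 * (nm g + 1) by have := nm_ge0 g; lra.
have small (e : R) : 0 < e -> exists N : nat, forall n, (N <= n)%N -> 2^-1 ^+ n * nm g < e / 2.
  move=> e0; have [N NP] := @expr_small R 2^-1 _ ltac:(by rewrite invr_ge0) ltac:(lra) (divr_gt0 e0 g1).
  exists N => n /NP; rewrite ltr_pdivlMr //.
  have : 0 <= 2^-1 ^+ n :> R by rewrite exprn_ge0 // invr_ge0.
  have := nm_ge0 g; nra.
have [|c cP] := @complex_seq_complete R a.
  move=> e /small[N NP]; exists N => m n /NP hm /NP hn.
  apply: le_lt_trans (dist _ (proj2_sig (u n)) m) _; rewrite mulrDl.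
  have := ler_wpM2r (nm_ge0 g) (uP n); lra.
exists c => v Vv; apply/ler_addgt0Pr => e e0; have e2 : 0 < e / 2 by lra.
have [N NP] := cP _ e2; have [M MP] := small e e0; set n := maxn N M.
have := NP n (leq_maxl _ _); have := MP n (leq_maxr _ _); have := dist v Vv n.
rewrite mulrDl; have := nm_tri c (a n) (feval g Vv); rewrite (nmB c (a n)); lra.
Qed.

Definition hip f g : C := sval (cid (hip_ex f g)).

Lemma hipP f g v (Vv : V v) : nm (hip f g - feval g Vv) <= nm (f - vec Vv) * nm g.
Proof. exact: (svalP (cid (hip_ex f g))). Qed.

Lemma hip_vecl g v (Vv : V v) : hip (vec Vv) g = feval g Vv.
Proof.
by apply/eqP; rewrite -subr_eq0; apply/eqP/nm_eq0; have := hipP (vec Vv) g Vv; rewrite subrr nm0 mul0r.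
Qed.

Lemma hip_vec u v (Vu : V u) (Vv : V v) : hip (vec Vu) (vec Vv) = ip u v.
Proof. by rewrite hip_vecl /feval /= /vfun /= -pipC. Qed.

Lemma hip_bound f g : nm (hip f g) <= nm f * nm g.
Proof.
have V0 := pV0 E; have := hipP f g V0.
have -> : vec V0 = 0 by apply: fspace_ext => w /=; rewrite /vfun -(scale0r 0) pipZl ?mul0r //; case: w.
have := feval_le g V0; rewrite -(nm_vec V0).
have -> : vec V0 = 0 by apply: fspace_ext => w /=; rewrite /vfun -(scale0r 0) pipZl ?mul0r //; case: w.
rewrite nm0 mulr0 subr0 => h; have -> : feval g V0 = 0 by apply: nm_eq0.
by rewrite subr0.
Qed.

Lemma hipDl f g h : hip (f + g) h = hip f h + hip g h.
Proof.
apply: (@eq_of_approx _ C^o _ _ (4 * nm h)) => e e0 e1.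
have [u [Vu fu]] := vec_dense f e0; have [v [Vv gv]] := vec_dense g e0.
have a1 := hipP (f + g) h (pVD Vu Vv); have a2 := hipP f h Vu; have a3 := hipP g h Vv.
have -> : hip (f + g) h - (hip f h + hip g h) =
  (hip (f + g) h - feval h (pVD Vu Vv)) - ((hip f h - feval h Vu) + (hip g h - feval h Vv)).
  by rewrite fevalDr; ring.
have a4 : nm (f + g - vec (pVD Vu Vv)) <= e + e.
  by rewrite vecD opprD addrACA; apply: le_trans (nmD _ _) _; exact: lerD.
have h0 := nm_ge0 h.
apply: le_trans (nmD _ _) _; rewrite nmN.
have a5 := nmD (hip f h - feval h Vu) (hip g h - feval h Vv).
have := ler_wpM2r h0 a4; have := ler_wpM2r h0 fu; have := ler_wpM2r h0 gv; lra.
Qed.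

Lemma hipZl c f g : hip (c *: f) g = c * hip f g.
Proof.
apply: (@eq_of_approx _ C^o _ _ (2 * nm c * nm g)) => e e0 e1.
have [u [Vu fu]] := vec_dense f e0.
have a1 := hipP (c *: f) g (pVZ c Vu); have a2 := hipP f g Vu.
have -> : hip (c *: f) g - c * hip f g =
  (hip (c *: f) g - feval g (pVZ c Vu)) - c * (hip f g - feval g Vu).
  by rewrite fevalZr; ring.
rewrite vecZ -scalerBr nmZ in a1.
apply: le_trans (nmD _ _) _; rewrite nmN nmM.
have h0 := nm_ge0 g; have c0 := nm_ge0 c.
have := ler_wpM2l c0 (ler_wpM2r h0 fu); have := ler_wpM2l c0 a2; nra.
Qed.

Lemma hipC f g : hip f g = (hip g f)^*.
Proof.
apply: (@eq_of_approx _ C^o _ _ (2 * (nm f + 1 + nm g))) => e e0 e1.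
have [u [Vu fu]] := vec_dense f e0; have [v [Vv gv]] := vec_dense g e0.
(* Additivity on the right cannot be borrowed from symmetry, which is what is being proved. *)
have Dr a c d : hip a (c - d) = hip a c - hip a d.
  apply: (@eq_of_approx _ C^o _ _ (nm (c - d) + nm c + nm d)) => e' e'0 _.
  have [w [Vw aw]] := vec_dense a e'0.
  have -> : hip a (c - d) - (hip a c - hip a d) = (hip a (c - d) - feval (c - d) Vw)
     - ((hip a c - feval c Vw) - (hip a d - feval d Vw)).
    by rewrite /feval fspaceD fspaceN rmorphB; ring.
  have := hipP a (c - d) Vw; have := hipP a c Vw; have := hipP a d Vw.
  have := ler_wpM2r (nm_ge0 c) aw; have := ler_wpM2r (nm_ge0 d) aw; have := ler_wpM2r (nm_ge0 (c - d)) aw.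
  set X := hip a (c - d) - _; set Y := hip a c - _; set Z := hip a d - _.
  have := nmD X (- (Y - Z)); have := nmD Y (- Z); rewrite !nmN; lra.
have Dl a c d : hip (a - c) d = hip a d - hip c d by rewrite hipDl -scaleN1r hipZl mulN1r.
(* Writing f = u + (f - u) and g = v + (g - v) leaves <u, v> on both sides, where symmetry is an
   axiom. *)
have -> : hip f g - (hip g f)^* =
  (hip (f - vec Vu) g + hip (vec Vu) (g - vec Vv)) - (hip g (f - vec Vu) + hip (g - vec Vv) (vec Vu))^*.
  by rewrite !Dr !Dl !rmorphD !rmorphN !hip_vec (pipC Vu Vv) /=; ring.
apply: le_trans (nmD _ _) _; rewrite nmN nm_conj.
have b1 := nmD (hip (f - vec Vu) g) (hip (vec Vu) (g - vec Vv)).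
have b2 := nmD (hip g (f - vec Vu)) (hip (g - vec Vv) (vec Vu)).
have f0 := nm_ge0 f; have g0 := nm_ge0 g.
have a1 := hip_bound (f - vec Vu) g; have a2 := hip_bound (vec Vu) (g - vec Vv).
have a3 := hip_bound g (f - vec Vu); have a4 := hip_bound (g - vec Vv) (vec Vu).
have uf := nm_vec_le fu; rewrite -(nm_vec Vu) in uf.
have v0 := nm_ge0 (vec Vu).
have c1 := ler_wpM2r g0 fu; have c2 := ler_wpM2l v0 gv.
have c3 : nm (vec Vu) * e <= (nm f + 1) * e by apply: ler_wpM2r; [exact: ltW|lra].
lra.
Qed.


Lemma hip_norm f : hip f f = `|f| ^+ 2.
Proof.
rewrite nmE -rmorphXn /=.
apply: (@eq_of_approx _ C^o _ _ (4 * (nm f + 1))) => e e0 e1.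
have [u [Vu fu]] := vec_dense f e0.
have a0 := hip_vec Vu Vu; rewrite pn_sqr // -(nm_vec Vu) in a0.
have -> : hip f f - (nm f ^+ 2)%:C%C =
   (hip (f - vec Vu) f + hip f (f - vec Vu) - hip (f - vec Vu) (f - vec Vu)) +
   ((nm (vec Vu) ^+ 2)%:C%C - (nm f ^+ 2)%:C%C).
  have Dl a c d : hip (a - c) d = hip a d - hip c d by rewrite hipDl -scaleN1r hipZl mulN1r.
  have Dr a c d : hip a (c - d) = hip a c - hip a d.
    by rewrite hipC Dl rmorphB /= -!hipC.
  by rewrite !Dl !Dr a0; ring.
have f0 := nm_ge0 f.
have uf : nm (vec Vu) <= nm f + e by rewrite nm_vec; exact: nm_vec_le fu.
have v0 := nm_ge0 (vec Vu).
have fu' : nm f <= nm (f - vec Vu) + nm (vec Vu).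
  by have := nm_tri f (vec Vu) 0; rewrite !subr0.
apply: le_trans (nmD _ _) _; rewrite -rmorphB nmR.
have b1 := nmD (hip (f - vec Vu) f + hip f (f - vec Vu)) (- hip (f - vec Vu) (f - vec Vu)).
rewrite nmN in b1.
have b2 := nmD (hip (f - vec Vu) f) (hip f (f - vec Vu)).
have a1 := hip_bound (f - vec Vu) f; have a2 := hip_bound f (f - vec Vu).
have a3 := hip_bound (f - vec Vu) (f - vec Vu).
have c1 := ler_wpM2r f0 fu; have c2 := nm_ge0 (f - vec Vu).
have c3 : nm (f - vec Vu) * nm (f - vec Vu) <= 1 * e by apply: ler_pM => //; lra.
have c4 : `|nm (vec Vu) ^+ 2 - nm f ^+ 2| <= e * (2 * nm f + 1).
  rewrite subr_sqr normrM; apply: ler_pM => //; first by rewrite ler_norml; apply/andP; split; lra.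
  by rewrite ger0_norm; lra.
lra.
Qed.

Definition compl_hilbert : hilbert R := Hilbert hipDl hipZl hipC hip_norm.

Section Operator.
Variables (T T' : pW E -> pW E) (K : R).
Hypothesis K0 : 0 <= K.
Hypothesis VT : forall x, V x -> V (T x).
Hypothesis VT' : forall x, V x -> V (T' x).
Hypothesis TT' : forall x y, V x -> V y -> ip (T x) y = ip x (T' y).
Hypothesis T'K : forall x, V x -> pn (T' x) <= K * pn x.

(** T is extended through its adjoint: <T f, w> = <f, T' w> makes sense for every functional f
    without passing to a limit. Accordingly the bound is assumed on T'. *)
Definition ext_fun f (w : {w | V w}) : C^o := f (exist _ (T' (sval w)) (VT' (proj2_sig w))).

Lemma ext_hP f : hP (ext_fun f).
Proof.
move=> e e0; have K0' := K0; have K1 : 0 < K + 1 by lra.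
have [v [Vv fv]] := vec_dense f (divr_gt0 e0 K1).
exists (T v); first exact: VT.
move=> [w Vw]; have := nm_fspace (f - vec Vv) (exist _ (T' w) (VT' Vw)).
have E1 : vec Vv (exist _ (T' w) (VT' Vw)) = vfun (T v) (exist _ w Vw) by rewrite /= /vfun /= TT'.
rewrite fspaceD fspaceN E1 => h.
refine (le_trans h _).
apply: (@le_trans _ _ (e / (K + 1) * (K * pn w))).
  by apply: ler_pM; rewrite ?nm_ge0 ?pn_ge0 //; exact: T'K.
rewrite mulrA ler_wpM2r ?pn_ge0 // mulrAC ler_pdivrMr //; nra.
Qed.

Definition ext f : compl := Fspace (ext_hP f : @fP R compl_data _).

Lemma ext_le f : nm (ext f) <= K * nm f.
Proof.
apply: nm_fspace_le => [|[w Vw]]; first by rewrite mulr_ge0 ?nm_ge0.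
have := nm_fspace f (exist _ (T' w) (VT' Vw)) => /le_trans; apply.
by have := ler_wpM2l (nm_ge0 f) (T'K Vw); rewrite mulrA (mulrC (nm f) K).
Qed.

Lemma ext_vec v (Vv : V v) : ext (vec Vv) = vec (VT Vv).
Proof. by apply: fspace_ext => -[w Vw] /=; rewrite /ext_fun /= /vfun /= -TT'. Qed.

Lemma extB f g : ext (f - g) = ext f - ext g.
Proof.
apply: fspace_ext => w; rewrite fspaceD fspaceN.
by have := fspaceD f (- g) (exist _ (T' (sval w)) (VT' (proj2_sig w))); rewrite fspaceN.
Qed.

End Operator.

Lemma ext_adj (T T' : pW E -> pW E) (K : R) (K0 : 0 <= K) (VT : forall x, V x -> V (T x))
  (VT' : forall x, V x -> V (T' x)) (TT' : forall x y, V x -> V y -> ip (T x) y = ip x (T' y))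
  (T'T : forall x y, V x -> V y -> ip (T' x) y = ip x (T y))
  (TK : forall x, V x -> pn (T x) <= K * pn x) (T'K : forall x, V x -> pn (T' x) <= K * pn x) f g :
  hip (ext K0 VT VT' TT' T'K f) g = hip f (ext K0 VT' VT T'T TK g).
Proof.
apply: (@eq_of_approx _ C^o _ _ (2 * K * nm g)) => e e0 e1.
have [v [Vv fv]] := vec_dense f e0.
have h1 := hipP (ext K0 VT VT' TT' T'K f) g (VT _ Vv).
have h2 := hipP f (ext K0 VT' VT T'T TK g) Vv.
have E1 : feval (ext K0 VT' VT T'T TK g) Vv = feval g (VT _ Vv) by [].
rewrite E1 in h2; rewrite -(ext_vec K0 VT VT' TT' T'K) -extB in h1.
have tri := nm_tri (hip (ext K0 VT VT' TT' T'K f) g : C^o) (feval g (VT _ Vv)) (hip f (ext K0 VT' VT T'T TK g)).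
rewrite (nmB (feval g _)) in tri.
have g0 := nm_ge0 g.
have k1 := ext_le K0 VT VT' TT' T'K (f - vec Vv).
have k2 := ler_wpM2l K0 fv.
have k3 : nm (ext K0 VT VT' TT' T'K (f - vec Vv)) * nm g <= K * e * nm g.
  by apply: ler_wpM2r => //; apply: le_trans k1 k2.
have k4 := ext_le K0 VT' VT T'T TK g.
have k5 : nm (f - vec Vv) * nm (ext K0 VT' VT T'T TK g) <= e * (K * nm g) by apply: ler_pM; rewrite ?nm_ge0.
lra.
Qed.

End Prehilbert.

(** * The C*-algebra of bounded operators on a Hilbert space *)

Section BoundedOperators.
Variables (R : realType) (H : hilbert R).
Local Notation C := (complex R).
Local Notation ip := (@hs_ip R H).

Definition hilbert_pre : prehilbert R.
Proof.
refine (@Prehilbert R H setT ip I (fun _ _ _ _ => I) (fun _ _ _ => I)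
  (fun x y z _ _ _ => hs_ipDl x y z) (fun c x y _ _ => hs_ipZl c x y)
  (fun x y _ _ => hs_ipC x y) _).
by move=> x _; rewrite hs_ip_norm exprn_ge0.
Defined.

Lemma pn_nm (x : H) : @pn R hilbert_pre x = nm x.
Proof.
rewrite /pn /= hs_ip_norm nmE -rmorphXn /= sqrtr_sqr ger0_norm //; exact: nm_ge0.
Qed.

Lemma hs_cauchy_schwarz (x y : H) : nm (ip x y) <= nm x * nm y.
Proof. by have := @cauchy_schwarz R hilbert_pre x y I I; rewrite !pn_nm. Qed.

Lemma hs_ipDr (x y z : H) : ip z (x + y) = ip z x + ip z y.
Proof. exact: (@pipDr R hilbert_pre x y z I I I). Qed.

Lemma hs_ipZr (c : C) (x y : H) : ip y (c *: x) = c^* * ip y x.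
Proof. exact: (@pipZr R hilbert_pre c x y I I). Qed.

Lemma hs_ipBl (x y z : H) : ip (x - y) z = ip x z - ip y z.
Proof. by rewrite hs_ipDl -scaleN1r hs_ipZl mulN1r. Qed.

Lemma hs_ipBr (x y z : H) : ip z (x - y) = ip z x - ip z y.
Proof. by rewrite hs_ipDr -scaleN1r hs_ipZr conjCN1 mulN1r. Qed.

Lemma hs_ip_inj (x y : H) : (forall z, ip x z = ip y z) -> x = y.
Proof.
move=> h; apply/eqP; rewrite -subr_eq0 -normr_eq0 -sqrf_eq0 -hs_ip_norm.
by rewrite hs_ipBl h subrr.
Qed.

Lemma hs_ip_injr (x y : H) : (forall z, ip z x = ip z y) -> x = y.
Proof. by move=> h; apply: hs_ip_inj => z; rewrite hs_ipC h -hs_ipC. Qed.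

Definition op_weight (w : H + H) : R := match w with inl x => nm x | inr x => nm x end.
Definition op_twist (w : H + H) : bool := if w is inr _ then true else false.

(* f (inl x) is T x and f (inr x) is T^* x, for a bounded operator T. *)
Definition opP : set (H + H -> H) := [set f |
  (forall x y, ip (f (inl x)) y = ip x (f (inr y))) /\
  exists2 K, 0 <= K & forall w, nm (f w) <= K * op_weight w].

Lemma op_weight_ge0 w : 0 <= op_weight w.
Proof. by case: w => x; exact: nm_ge0. Qed.

Lemma opP0 : opP (fun=> 0).
Proof.
split=> [x y|]; first by rewrite -(scale0r 0) hs_ipZl hs_ipZr conjC0 !mul0r.
by exists 0 => // w; rewrite nm0 mul0r.
Qed.

Lemma opPD f g : opP f -> opP g -> opP (fun w => f w + g w).
Proof.
move=> [fa [K K0 fK]] [ga [M M0 gM]]; split=> [x y|]; first by rewrite hs_ipDl hs_ipDr fa ga.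
exists (K + M) => [|w]; first exact: addr_ge0.
by rewrite mulrDl; apply: le_trans (nmD _ _) (lerD (fK w) (gM w)).
Qed.

Lemma opPZ c f : opP f -> opP (fun w => tw (op_twist w) c *: f w).
Proof.
move=> [fa [K K0 fK]]; split=> [x y|]; first by rewrite /tw /= hs_ipZl hs_ipZr conjCK fa.
exists (nm c * K) => [|w]; first by rewrite mulr_ge0 ?nm_ge0.
by rewrite nmZ nm_tw -mulrA ler_wpM2l ?nm_ge0.
Qed.

Lemma opP_bounded f : opP f -> exists2 K, 0 <= K & forall w, nm (f w) <= K * op_weight w.
Proof. by case. Qed.

Lemma opP_closed f : (forall e : R, 0 < e -> exists2 g, opP g &
  forall w, nm (f w - g w) <= e * op_weight w) -> opP f.
Proof.
move=> h; split=> [x y|].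
  apply: (@eq_of_approx _ C^o _ _ (2 * (nm x * nm y))) => e e0 _.
  have [g [ga _] fg] := h e e0.
  have -> : ip (f (inl x)) y - ip x (f (inr y)) =
     ip (f (inl x) - g (inl x)) y - ip x (f (inr y) - g (inr y)).
    by rewrite hs_ipBl hs_ipBr ga; ring.
  apply: le_trans (nmD _ _) _; rewrite nmN.
  have a1 := hs_cauchy_schwarz (f (inl x) - g (inl x)) y.
  have a2 := hs_cauchy_schwarz x (f (inr y) - g (inr y)).
  have b1 := ler_wpM2r (nm_ge0 y) (fg (inl x)); have b2 := ler_wpM2l (nm_ge0 x) (fg (inr y)).
  by move: b1 b2 => /=; lra.
have [g [_ [K K0 gK]] fg] := h 1 ltr01; exists (1 + K) => [|w]; first by rewrite addr_ge0.
have := nm_tri (f w) (g w) 0; rewrite !subr0 mulrDl => /le_trans; apply.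
exact: lerD (fg w) (gK w).
Qed.

Definition op_data : fdata R := Fdata (@complete_seq R H) op_weight_ge0 opP0 opPD opPZ
  opP_bounded opP_closed.

Definition BHs : completeNormedModType C := fspace op_data.
Implicit Types f g h : BHs.

Definition mk_op (u : H + H -> H) (Pu : opP u) : BHs := Fspace (Pu : @fP R op_data u).

Lemma op_adj f x y : ip (f (inl x)) y = ip x (f (inr y)).
Proof. by have [] := (fvalP f : opP f). Qed.

Lemma op_adjr f x y : ip (f (inr x)) y = ip x (f (inl y)).
Proof. by rewrite hs_ipC -op_adj -hs_ipC. Qed.

Lemma opD f x y : f (inl (x + y)) = f (inl x) + f (inl y).
Proof. by apply: hs_ip_inj => z; rewrite op_adj !hs_ipDl !op_adj. Qed.

Lemma opZ f c x : f (inl (c *: x)) = c *: f (inl x).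
Proof. by apply: hs_ip_inj => z; rewrite op_adj !hs_ipZl !op_adj. Qed.

(* Two operators agree as soon as they agree as maps, the adjoint being determined. *)
Lemma op_ext f g : (forall x, f (inl x) = g (inl x)) -> f = g.
Proof.
move=> fg; apply: fspace_ext => -[x|y]; first exact: fg.
by apply: hs_ip_injr => z; rewrite -!op_adj fg.
Qed.

Lemma nm_op f w : nm (f w) <= nm f * op_weight w.
Proof. exact: nm_fspace. Qed.

(* A bound for T bounds its adjoint as well. *)
Lemma nm_op_le f K : 0 <= K -> (forall x, nm (f (inl x)) <= K * nm x) -> nm f <= K.
Proof.
move=> K0 fK; apply: nm_fspace_le => // -[x|y] /=; first exact: fK.
set z := f (inr y).
have [z0|z0] := eqVneq (nm z) 0; first by rewrite z0 mulr_ge0 ?nm_ge0.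
have zp : 0 < nm z by rewrite lt_neqAle eq_sym z0 nm_ge0.
have : nm (ip z z) = nm z * nm z by rewrite hs_ip_norm nmE -rmorphXn nmR /= ger0_norm ?sqr_ge0 // expr2.
rewrite {1}/z op_adjr -/z => E.
have := hs_cauchy_schwarz y (f (inl z)); rewrite E => h.
rewrite -(ler_pM2r zp); apply: le_trans h _; rewrite mulrAC mulrC.
by apply: ler_wpM2r; [exact: nm_ge0 | exact: fK].
Qed.

Lemma op_mulP f g : opP (fun w => match w with
  | inl x => f (inl (g (inl x))) | inr x => g (inr (f (inr x))) end).
Proof.
split=> [x y|]; first by rewrite !op_adj.
exists (nm f * nm g); first by rewrite mulr_ge0 ?nm_ge0.
case=> x /=; first by rewrite -mulrA; apply: le_trans (nm_op f _) _; rewrite ler_wpM2l ?nm_ge0 // (nm_op g (inl x)).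
rewrite (mulrC (nm f)) -mulrA; apply: le_trans (nm_op g _) _.
by rewrite ler_wpM2l ?nm_ge0 // (nm_op f (inr x)).
Qed.

Definition op_mul f g : BHs := mk_op (op_mulP f g).

Lemma op_starP f : opP (fun w => match w with inl x => f (inr x) | inr x => f (inl x) end).
Proof.
split=> [x y|]; first exact: op_adjr.
by exists (nm f) => [|[x|x]]; [exact: nm_ge0 | exact: (nm_op f (inr x)) | exact: (nm_op f (inl x))].
Qed.

Definition op_star f : BHs := mk_op (op_starP f).

Lemma op_addE f g w : (f + g) w = f w + g w. Proof. exact: fspaceD. Qed.
Lemma op_scaleE c f x : (c *: f) (inl x) = c *: f (inl x). Proof. exact: fspaceZ. Qed.

Lemma nm_op_mul f g : nm (op_mul f g) <= nm f * nm g.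
Proof.
apply: nm_op_le => [|x]; first by rewrite mulr_ge0 ?nm_ge0.
rewrite -mulrA; apply: le_trans (nm_op f _) _.
by rewrite ler_wpM2l ?nm_ge0 // (nm_op g (inl x)).
Qed.

Lemma nm_op_star f : nm (op_star f) <= nm f.
Proof. by apply: nm_op_le => [|x]; [exact: nm_ge0 | exact: (nm_op f (inr x))]. Qed.

Definition BH : cstar R.
Proof.
refine (@Cstar R BHs op_mul op_star _ _ _ _ _ _ _ _ _ _ _).
- by move=> f g h; apply: op_ext => x.
- by move=> f g h; apply: op_ext => x; rewrite op_addE.
- by move=> f g h; apply: op_ext => x; rewrite op_addE /= -opD.
- by move=> c f g; apply: op_ext => x; rewrite op_scaleE; exact: (op_scaleE c f (g (inl x))).
- move=> c f g; apply: op_ext => x; rewrite op_scaleE; transitivity (f (inl (c *: g (inl x)))); last exact: opZ.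
  by rewrite -(op_scaleE c g x).
- by move=> f; apply: op_ext => x.
- by move=> f g; apply: op_ext => x; rewrite op_addE.
- move=> c f; apply: op_ext => x; rewrite op_scaleE; exact: (fspaceZ c f (inr x)).
- by move=> f g; apply: op_ext => x.
- by move=> f g; rewrite !nmE -rmorphM lecR; exact: nm_op_mul.
- move=> f; rewrite !nmE -rmorphXn; congr (_%:C)%C; apply/eqP; rewrite eq_le; apply/andP; split.
    apply: le_trans (nm_op_mul _ _) _; rewrite /= expr2.
    by apply: ler_wpM2r; [exact: nm_ge0 | exact: nm_op_star].
  set K := nm (op_mul _ _); have K0 : 0 <= K by exact: nm_ge0.
  (* From |f x|^2 = <x, f^# f x> <= K |x|^2. *)
  suff : nm f <= Num.sqrt K.
    by move=> h; rewrite /= -[K in _ <= K]sqr_sqrtr // ler_pXn2r ?nnegrE ?nm_ge0 ?sqrtr_ge0.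
  apply: nm_op_le => [|x]; first exact: sqrtr_ge0.
  rewrite -(@ler_pXn2r _ 2) ?nnegrE ?mulr_ge0 ?nm_ge0 ?sqrtr_ge0 //.
  have -> : nm (f (inl x)) ^+ 2 = nm (ip (f (inl x)) (f (inl x))).
    by rewrite hs_ip_norm nmE -rmorphXn nmR /= ger0_norm ?sqr_ge0.
  rewrite op_adj exprMn sqr_sqrtr //; apply: le_trans (hs_cauchy_schwarz _ _) _.
  rewrite expr2 mulrA mulrC ler_wpM2r ?nm_ge0 //.
  exact: (nm_op (op_mul (op_star f) f) (inl x)).
Defined.

End BoundedOperators.

(** * Paths in k-graphs *)

(* Applications of finite functions have types that must be reduced before they are visible to lia. *)
Ltac flia := first [lia | cbn in *; lia].

Section Segments.
Variables (k : nat) (L : kgraph k).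
Implicit Types (p q : Nk k) (x y z : L) (m n : Zk k).
Local Notation "x \; y" := (kg_comp x y).

Definition cst (N : nat) : Nk k := [ffun=> N].
Definition cz (N : nat) : Zk k := [ffun=> N%:Z].
Definition lek p q := forall i, (p i <= q i)%N.
Definition subk p q : Nk k := [ffun i => (q i - p i)%N].
Definition subz m n : Nk k := [ffun i => `|n i - m i|%N].

Lemma subkK p q : lek p q -> p + subk p q = q.
Proof. by move=> pq; apply/ffunP => i; rewrite !ffunE; exact: subnKC (pq i). Qed.

Lemma Nk_addI p q q' : p + q = p + q' -> q = q'.
Proof. by move=> E; apply/ffunP => i; have /ffunP/(_ i) := E; rewrite !ffunE => /addnI. Qed.

Lemma toZ_inj : injective (@toZ k).
Proof. by move=> p q E; apply/ffunP => i; have /ffunP/(_ i) := E; rewrite !ffunE => -[]. Qed.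

Lemma toZ_subz m n : lez m n -> toZ (subz m n) = n - m.
Proof. move=> /forallP mn; apply/ffunP => i; rewrite !ffunE; have := mn i; flia. Qed.

Lemma factor x p q : kg_d x = p + q ->
  exists y z, [/\ kg_s y = kg_r z, x = y \; z, kg_d y = p & kg_d z = q].
Proof. by move=> /kg_factor[[y z] [h _]]; exists y, z. Qed.

Lemma comp_inj x y x' y' : kg_s x = kg_r y -> kg_s x' = kg_r y' ->
  x \; y = x' \; y' -> kg_d x = kg_d x' -> x = x' /\ y = y'.
Proof.
move=> xy xy' E dx; have dy : kg_d y = kg_d y'.
  by apply: (@Nk_addI (kg_d x)); rewrite -kg_d_comp // E kg_d_comp // dx.
have [[a b] [_ U]] := kg_factor (kg_d_comp xy).
have E1 : (a, b) = (x, y) by exact: U.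
have : (a, b) = (x', y') by apply: U; split; rewrite ?dx ?dy.
by rewrite E1 => -[].
Qed.

Lemma deg0_id x : kg_d x = 0 -> x = kg_id (kg_r x).
Proof.
move=> d0; have [] := @comp_inj x (kg_id (kg_s x)) (kg_id (kg_r x)) x.
- by rewrite kg_r_id.
- by rewrite kg_s_id.
- by rewrite kg_comp_id kg_id_comp.
- by rewrite d0 kg_d_id.
- by [].
Qed.

(* x is the factor of y that starts at degree p. *)
Definition seg y p x := exists a b,
  [/\ kg_s a = kg_r x, kg_s x = kg_r b, kg_d a = p & y = a \; (x \; b)].

Lemma seg_uniq y p x x' : seg y p x -> seg y p x' -> kg_d x = kg_d x' -> x = x'.
Proof.
move=> [a [b [ax xb da E]]] [a' [b' [ax' xb' da' E']]] dx.
have [||||_ E2] := @comp_inj a (x \; b) a' (x' \; b').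
- by rewrite kg_r_comp.
- by rewrite kg_r_comp.
- by rewrite -E.
- by rewrite da.
by have [] := comp_inj xb xb' E2 dx.
Qed.

Lemma seg_ex y p q : lek (p + q) (kg_d y) -> exists2 x, kg_d x = q & seg y p x.
Proof.
move=> le; have E : kg_d y = p + (q + subk (p + q) (kg_d y)) by rewrite addrA subkK.
have [a [c [ac yE da dc]]] := factor E; have [x [b [xb cE dx db]]] := factor dc.
by subst c; exists x => //; exists a, b; split => //; rewrite ac kg_r_comp.
Qed.

Lemma seg_refl x : seg x 0 x.
Proof.
exists (kg_id (kg_r x)), (kg_id (kg_s x)).
by rewrite kg_s_id kg_r_id kg_d_id kg_comp_id kg_id_comp.
Qed.

Lemma seg_trans y p x q z : seg y p x -> seg x q z -> seg y (p + q) z.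
Proof.
move=> [a [b [ax xb da ->]]] [c [d [cz' zd dc E]]].
have rx : kg_r x = kg_r c by rewrite E kg_r_comp // kg_r_comp.
have sx : kg_s x = kg_s d by rewrite E !kg_s_comp // kg_r_comp.
exists (a \; c), (d \; b); split; rewrite ?kg_s_comp ?kg_r_comp ?kg_d_comp -?sx ?da ?dc -?rx //.
rewrite E -!kg_compA ?kg_s_comp ?kg_r_comp -?rx -?sx //.
Qed.

Lemma seg_d y p x : seg y p x -> lek (p + kg_d x) (kg_d y).
Proof.
move=> [a [b [ax xb da ->]]] i; rewrite kg_d_comp ?kg_r_comp // kg_d_comp // da !ffunE.
flia.
Qed.

(** Cutting y at degree p + d(x) in the two given ways, uniqueness of factorisation identifies the
    rest b after x with x' b'. *)
Lemma seg_comp y p x x' : seg y p x -> seg y (p + kg_d x) x' ->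
  kg_s x = kg_r x' /\ seg y p (x \; x').
Proof.
move=> [a [b [ax xb da E]]] [a' [b' [ax' xb' da' E']]].
have [||||Ea Eb] := @comp_inj (a \; x) b a' (x' \; b').
- by rewrite kg_s_comp.
- by rewrite kg_r_comp.
- by rewrite -kg_compA // -E.
- by rewrite kg_d_comp // da.
have sx : kg_s x = kg_r x' by rewrite xb Eb kg_r_comp.
split=> //; exists a, b'; rewrite kg_r_comp // kg_s_comp // -kg_compA //.
by split=> //; rewrite E Eb.
Qed.

Lemma seg_right x y : kg_s x = kg_r y -> seg (x \; y) (kg_d x) y.
Proof.
by move=> xy; exists x, (kg_id (kg_s y)); rewrite kg_r_id kg_comp_id.
Qed.

Definition sub y p q : L := xget y [set x | kg_d x = q /\ seg y p x].

Lemma subP y p q : lek (p + q) (kg_d y) -> kg_d (sub y p q) = q /\ seg y p (sub y p q).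
Proof. by move=> /seg_ex[x dx sx]; by apply: (@xgetPex _ y [set x | kg_d x = q /\ seg y p x]); exists x. Qed.

Lemma subE y p x : seg y p x -> sub y p (kg_d x) = x.
Proof.
move=> h; have [d s] := subP (seg_d h); exact: seg_uniq s h d.
Qed.

End Segments.

(** * Two-sided paths, their gluing from finite pieces, and their windows *)

Section Bipaths.
Variables (k : nat) (L : kgraph k).
Implicit Types (x y z : bipath L) (m n : Zk k).
Local Notation "x \; y" := (kg_comp x y).
Local Notation cz := (@cz k).
Local Notation cst := (@cst k).

Lemma bp_irr x m n (h h' : lez m n) : bp x h = bp x h'.
Proof. by congr (bp x _); exact: bool_irrelevance. Qed.

Lemma bipath_ext x y : (forall m n (h : lez m n), bp x h = bp y h) -> x = y.
Proof.
case: x y => [xo xb xr xs xi xc xd] [yo yb yr ys yi yc yd] /= E.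
have Eb : xb = yb.
  by apply: functional_extensionality_dep => m; apply: functional_extensionality_dep => n;
     apply: functional_extensionality_dep => h; exact: E.
have Eo : xo = yo by apply/funext => n; rewrite -(xr _ _ (lezz n)) -(yr _ _ (lezz n)) Eb.
subst yb yo; congr Bipath; exact: Prop_irrelevance.
Qed.

Lemma bp_seg x m n (h : lez m n) m' n' (h1 : lez m m') (h2 : lez m' n') (h3 : lez n' n) :
  seg (bp x h) (subz m m') (bp x h2).
Proof.
exists (bp x h1), (bp x h3); rewrite !bp_s !bp_r; split => //.
  by apply: toZ_inj; rewrite bp_d toZ_subz.
by rewrite -!bp_comp; exact: bp_irr.
Qed.

Lemma kg_d_bp x m n (h : lez m n) : kg_d (bp x h) = subz m n.
Proof. by apply: toZ_inj; rewrite bp_d toZ_subz. Qed.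

Lemma agree_from_le m m' x y : lez m m' -> agree_from m x y -> agree_from m' x y.
Proof.
move=> mm' xy n h; have := xy n (lez_trans mm' h); rewrite !bp_comp => /comp_inj[].
- by rewrite bp_s bp_r.
- by rewrite bp_s bp_r.
- by rewrite !kg_d_bp.
- by [].
Qed.

(* The bipath that glues a nested family l N of degree 2N, placed on [-N, N]. *)
Section Glue.
Variable l : nat -> L.
Hypothesis dl : forall N, kg_d (l N) = cst (N + N).
Hypothesis segl : forall N, seg (l N.+1) (cst 1) (l N).

Lemma seg_glue N M : (N <= M)%N -> seg (l M) (cst (M - N)) (l N).
Proof.
move=> /subnKC <-; elim: (M - N)%N => [|j IH].
  by rewrite addn0 subnn (_ : cst 0 = 0); [exact: seg_refl | apply/ffunP => i; rewrite !ffunE].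
rewrite addnS (_ : cst _ = cst 1 + cst (N + j - N)); first exact: seg_trans (segl _) IH.
by apply/ffunP => i; rewrite !ffunE; flia.
Qed.

Definition bnd m n : nat := \max_i maxn `|m i|%N `|n i|%N.
(** The degree at which position m sits in a path placed on [-N, N]; the absolute value only
    converts the nonnegative m + N. *)
Definition off (N : nat) m : Nk k := [ffun i => absz (m i + N%:Z)].

Lemma bndP m n i : (`|m i| <= bnd m n)%N && (`|n i| <= bnd m n)%N.
Proof. by rewrite -geq_max /bnd; exact: (leq_bigmax i). Qed.

Definition gl m n : L := sub (l (bnd m n)) (off (bnd m n) m) (subz m n).

(** [gl] reads x(m, n) off the smallest window containing it; finding it in every larger window lets
    [gl_comp] compare three segments in a common one. *)
Lemma glP m n N : lez m n -> (bnd m n <= N)%N ->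
  kg_d (gl m n) = subz m n /\ seg (l N) (off N m) (gl m n).
Proof.
move=> /forallP mn bN; have [|dg sg] := @subP _ L (l (bnd m n)) (off (bnd m n) m) (subz m n).
  by move=> i; rewrite dl !ffunE; have := mn i; have /andP[] := bndP m n i; flia.
split=> //; rewrite (_ : off N m = cst (N - bnd m n) + off (bnd m n) m).
  by apply: seg_trans sg; exact: seg_glue.
by apply/ffunP => i; rewrite !ffunE; have /andP[] := bndP m n i; flia.
Qed.

Lemma gl_comp a b c : lez a b -> lez b c ->
  kg_s (gl a b) = kg_r (gl b c) /\ gl a c = gl a b \; gl b c.
Proof.
move=> ab bc; set N := maxn (bnd a b) (maxn (bnd b c) (bnd a c)).
have [d1 s1] := @glP a b N ab ltac:(by rewrite leq_max leqnn).
have [d2 s2] := @glP b c N bc ltac:(by rewrite !leq_max leqnn orbT).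
have [d3 s3] := @glP a c N (lez_trans ab bc) ltac:(by rewrite !leq_max leqnn !orbT).
have [||E s4] := @seg_comp _ _ (l N) (off N a) (gl a b) (gl b c) => //.
  rewrite d1 (_ : _ + _ = off N b) //; apply/ffunP => i; rewrite !ffunE.
  have /andP[] := bndP a b i; have : (bnd a b <= N)%N by rewrite leq_max leqnn.
  by move/forallP: ab => /(_ i); flia.
split=> //; apply: seg_uniq s3 s4 _; rewrite kg_d_comp // d1 d2 d3; apply/ffunP => i.
by rewrite !ffunE; move/forallP: ab => /(_ i); move/forallP: bc => /(_ i); flia.
Qed.

Lemma gl_nn n : gl n n = kg_id (kg_r (gl n n)).
Proof.
apply: deg0_id; have [-> _] := glP (lezz n) (leqnn _).
by apply/ffunP => i; rewrite !ffunE subrr.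
Qed.

Lemma gl_r m n (h : lez m n) : kg_r (gl m n) = kg_r (gl m m).
Proof. by have [<- _] := gl_comp (lezz m) h; rewrite gl_nn kg_s_id kg_r_id. Qed.

Lemma gl_s m n (h : lez m n) : kg_s (gl m n) = kg_r (gl n n).
Proof. by have [-> _] := gl_comp h (lezz n). Qed.

Lemma gl_d m n (h : lez m n) : toZ (kg_d (gl m n)) = n - m.
Proof. by have [-> _] := glP h (leqnn _); rewrite toZ_subz. Qed.

Definition glue : bipath L := @Bipath k L (fun n => kg_r (gl n n)) (fun m n _ => gl m n)
  gl_r gl_s gl_nn (fun a b c h h' => (gl_comp h h').2) gl_d.

End Glue.

Lemma lez_cz N : lez (- cz N) (cz N).
Proof. by apply/forallP => i; rewrite !ffunE; flia. Qed.

Lemma lez_czS N M : (N <= M)%N -> lez (cz N) (cz M).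
Proof. by move=> NM; apply/forallP => i; rewrite !ffunE; flia. Qed.

Lemma lez_czN N M : (N <= M)%N -> lez (- cz M) (- cz N).
Proof. by move=> NM; apply/forallP => i; rewrite !ffunE; flia. Qed.

Definition win N x : L := bp x (lez_cz N).

Lemma win_glue l (dl : forall N, kg_d (l N) = cst (N + N))
  (segl : forall N, seg (l N.+1) (cst 1) (l N)) N : win N (glue dl segl) = l N.
Proof.
have bN : (bnd (- cz N) (cz N) <= N)%N.
  by apply/bigmax_leqP => i _; rewrite !ffunE; flia.
have [dg sg] := glP dl segl (lez_cz N) bN.
apply: (seg_uniq sg).
  rewrite (_ : off _ _ = 0); first exact: seg_refl.
  by apply/ffunP => i; rewrite !ffunE; flia.
by rewrite dg dl; apply/ffunP => i; rewrite !ffunE; flia.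
Qed.

Lemma kg_d_win N x : kg_d (win N x) = cst (N + N).
Proof. by rewrite kg_d_bp; apply/ffunP => i; rewrite !ffunE; flia. Qed.

Lemma win_eq N x y m n (h : lez m n) : lez (- cz N) m -> lez n (cz N) ->
  win N x = win N y -> bp x h = bp y h.
Proof.
move=> h1 h2 E; have sx := bp_seg x (lez_cz N) h1 h h2.
have sy := bp_seg y (lez_cz N) h1 h h2; rewrite -/(win N x) E in sx.
by apply: seg_uniq sx sy _; rewrite !kg_d_bp.
Qed.

Lemma win_mono N M x y : (N <= M)%N -> win M x = win M y -> win N x = win N y.
Proof. by move=> NM; apply: win_eq; [exact: lez_czN | exact: lez_czS]. Qed.

Lemma bnd_cz m n : lez (- cz (bnd m n)) m /\ lez n (cz (bnd m n)).
Proof.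
by split; apply/forallP => i; have /andP[] := bndP m n i; rewrite !ffunE; flia.
Qed.

Lemma seg_win N M x : (N <= M)%N -> seg (win M x) (cst (M - N)) (win N x).
Proof.
move=> NM; have := bp_seg x (lez_cz M) (lez_czN NM) (lez_cz N) (lez_czS NM).
by rewrite (_ : subz _ _ = cst (M - N)) //; apply/ffunP => i; rewrite !ffunE; flia.
Qed.

Section Existence.
Hypothesis hr : surjective_finite_to_one (@kg_r k L).
Hypothesis hs : surjective_finite_to_one (@kg_s k L).

(** From any vertex, surjectivity of s prolongs a path backwards and surjectivity of r forwards by
    (1, ..., 1); the nested paths glue. *)
Lemma bipath_exists : inhabited (kg_obj L) -> exists x : bipath L, True.
Proof.
case=> v; have /choice[f fP] : forall a : L, exists a', seg a' (cst 1) a /\ kg_d a' = kg_d a + cst 2.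
  move=> a; have [[b [db rb]] _] := hs (cst 1) (kg_r a); have [[c [dc rc]] _] := hr (cst 1) (kg_s a).
  exists (b \; (a \; c)); split; first by exists b, c.
  rewrite kg_d_comp ?kg_r_comp // kg_d_comp // db dc; apply/ffunP => i; rewrite !ffunE; flia.
pose l N := iter N f (kg_id v).
have dl N : kg_d (l N) = cst (N + N).
  elim: N => [|N IH]; first by rewrite kg_d_id; apply/ffunP => i; rewrite !ffunE.
  by rewrite /= (fP _).2 -/(l N) IH; apply/ffunP => i; rewrite !ffunE; flia.
have segl N : seg (l N.+1) (cst 1) (l N) by exact: (fP _).1.
by exists (glue dl segl).
Qed.

End Existence.

End Bipaths.

(** * The core of the k-graph algebra *)

Section PathTypes.
Variables (k : nat) (L : kgraph k).
Local Notation "x \; y" := (kg_comp x y).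

(** [fset_set] would be empty on an infinite set; [finite_deg] ensures that these are all paths of
    degree n. *)
Definition pathT (n : Nk k) : finType := fset_set [set x : L | kg_d x = n].
Definition pv n (i : pathT n) : L := fsval i.

Hypothesis hL : inhabited (kg_obj L).
Hypothesis hprim : primitive L.
Hypothesis hr : surjective_finite_to_one (@kg_r k L).
Hypothesis hs : surjective_finite_to_one (@kg_s k L).

(** By primitivity every vertex is the source of a path of degree p with range v, and there are
    finitely many of those. *)
Lemma finite_obj : finite_set [set: kg_obj L].
Proof.
case: hL => v; have [p _ pP] := hprim; have [_ fin] := hr p v.
apply: sub_finite_set (finite_image (@kg_s k L) fin) => u _.
by have [x [dx rx sx]] := pP v u; exists x.
Qed.

Lemma finite_deg n : finite_set [set x : L | kg_d x = n].
Proof.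
rewrite (_ : [set x | _] = \bigcup_(v in [set: kg_obj L]) [set x : L | kg_d x = n /\ kg_r x = v]).
  by apply: bigcup_finite => [|v _]; [exact: finite_obj | have [_] := hr n v].
by apply/seteqP; split=> [x dx|x [v _ []]] //; exists (kg_r x).
Qed.

Lemma pvP n (i : pathT n) : kg_d (pv i) = n.
Proof. by have := fsvalP i; rewrite (in_fset_set (finite_deg n)) => /set_mem. Qed.

Lemma pathT_ex n x : kg_d x = n -> exists i : pathT n, pv i = x.
Proof.
move=> dx; have h : x \in fset_set [set x : L | kg_d x = n].
  by rewrite (in_fset_set (finite_deg n)); apply/mem_set.
by exists [` h]%fset.
Qed.

Lemma pv_inj n : injective (@pv n). Proof. exact: val_inj. Qed.

Lemma fsum_path (V : zmodType) n v (F : L -> V) :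
  \sum_(x \in [set x : L | kg_d x = n /\ kg_r x = v]) F x = \sum_(i : pathT n | kg_r (pv i) == v) F (pv i).
Proof.
have fin := (hr n v).2; rewrite fsbig_finite //=.
have -> : fset_set [set x : L | kg_d x = n /\ kg_r x = v] =
   [fset x in fset_set [set x : L | kg_d x = n] | kg_r x == v]%fset.
  apply/fsetP => x; rewrite (in_fset_set fin) in_fsetE /= inE /= (in_fset_set (finite_deg n)).
  apply/idP/andP => [/set_mem[dx rx]|[/set_mem dx /eqP rx]]; last exact/mem_set.
  by split; [exact/mem_set | exact/eqP].
by rewrite -big_fset_condE big_seq_fsetE.
Qed.

(** A degree that dominates p is reached by an arbitrary path of the excess degree followed by one
    of degree p, which primitivity can direct to any vertex. *)
Lemma connect_exists N : exists M0, forall M, (M0 <= M)%N -> forall u v : kg_obj L,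
  exists x : L, [/\ kg_d x = cst k (M - N), kg_r x = u & kg_s x = v].
Proof.
have [p _ pP] := hprim; exists (N + \max_i p i)%N => M MP u v.
have le : lek p (cst k (M - N)).
  by move=> i; rewrite ffunE; have := leq_bigmax (F := fun i => p i) i; lia.
have [[a [da ra]] _] := hr (subk p (cst k (M - N))) u.
have [b [db rb sb]] := pP (kg_s a) v.
exists (a \; b); rewrite kg_d_comp // kg_r_comp // kg_s_comp // da db; split=> //.
by rewrite addrC subkK.
Qed.

Section CK.
Variables (R : realType) (A : cstar R) (S : L -> A).
Local Notation C := (complex R).
Hypothesis ck : ck_family S.
Local Notation p v := (S (kg_id v)).

Lemma ck_proj v : p v ** p v = p v /\ (p v)^# = p v.
Proof. by case: ck => _ []. Qed.
Lemma ck_orth u v : u <> v -> p u ** p v = 0.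
Proof. by case: ck => _ [_ h] _ _ _; exact: h. Qed.
Lemma ck_comp x y : kg_s x = kg_r y -> S (x \; y) = S x ** S y.
Proof. by case: ck => _ _ h _ _; exact: h. Qed.
Lemma ck_star x : (S x)^# ** S x = p (kg_s x).
Proof. by case: ck => _ _ _ h _; exact: h. Qed.
Lemma ck_sum v n : p v = \sum_(i : pathT n | kg_r (pv i) == v) S (pv i) ** (S (pv i))^#.
Proof. by case: ck => _ _ _ _ h; rewrite (h v n) fsum_path. Qed.

Lemma ck_l x : p (kg_r x) ** S x = S x.
Proof. by rewrite -ck_comp ?kg_s_id // kg_id_comp. Qed.
Lemma ck_r x : S x ** p (kg_s x) = S x.
Proof. by rewrite -ck_comp ?kg_r_id // kg_comp_id. Qed.
Lemma ck_lJ x : (S x)^# ** p (kg_r x) = (S x)^#.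
Proof. by rewrite -{2}(ck_l x) cs_adjM (ck_proj _).2. Qed.
Lemma ck_rJ x : p (kg_s x) ** (S x)^# = (S x)^#.
Proof. by rewrite -{2}(ck_r x) cs_adjM (ck_proj _).2. Qed.

Lemma ck_mul0 x y : kg_s x <> kg_r y -> S x ** S y = 0.
Proof. by move=> xy; rewrite -ck_r -(ck_l y) cs_mulA -(cs_mulA (S x)) ck_orth // cs_mul0 cs_0mul. Qed.

Lemma ck_mulJ0 x y : kg_s x <> kg_s y -> S x ** (S y)^# = 0.
Proof. by move=> xy; rewrite -ck_r -(ck_rJ y) cs_mulA -(cs_mulA (S x)) ck_orth // cs_mul0 cs_0mul. Qed.

(** Orthogonality of ranges is not among the relations; it follows from [proj_sum_orthogonal], as
    the range projections of degree n at a vertex add up to a projection. *)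
Lemma ck_orth_deg x y : kg_d x = kg_d y -> x <> y -> (S x)^# ** S y = 0.
Proof.
move=> dxy xy; have [rxy|rxy] := eqVneq (kg_r x) (kg_r y); last first.
  rewrite -ck_lJ -(ck_l y) cs_mulA -(cs_mulA (S x)^#) ck_orth ?cs_mul0 ?cs_0mul //; exact/eqP.
set v := kg_r x; pose n := kg_d x.
have [i iE] := @pathT_ex n x erefl; have [j jE] := @pathT_ex n y (esym dxy).
(* Paths with another range contribute 0, so that one finite type indexes the sum. *)
pose q (i : pathT n) := if kg_r (pv i) == v then S (pv i) ** (S (pv i))^# else 0.
have qS : \sum_i q i = p v by rewrite (ck_sum v n) [RHS]big_mkcond.
have SSS x' : S x' ** (S x')^# ** S x' = S x' by case: ck => h _ _ _ _; exact: h.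
have qqi i' : q i' ** q i' = q i'.
  by rewrite /q; case: ifP => _; rewrite ?cs_mul0 // cs_mulA SSS.
have := @proj_sum_orthogonal R A _ q j i.
have qs i' : (q i')^# = q i' by rewrite /q; case: ifP => _; rewrite ?cs_adj0 // cs_adjM cs_adjK.
have pq i' : (\sum_j q j) ** q i' = q i'.
  rewrite qS /q; case: eqP => h; last by rewrite cs_mul0.
  by rewrite cs_mulA -h ck_l.
have ji : j != i by apply/eqP => E; apply: xy; rewrite -iE -jE E.
move=> /(_ qs qqi pq ji); rewrite /q iE jE /v rxy !eqxx => E.
have h1 : (S x)^# ** S x ** (S x)^# = (S x)^# by rewrite ck_star ck_rJ.
rewrite -h1 -[S y](SSS y) (_ : _ ** _ = (S x)^# ** (S x ** (S x)^# ** (S y ** (S y)^#)) ** S y).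
  by rewrite E cs_mul0 cs_0mul.
by rewrite !cs_mulA.
Qed.

Lemma ck_expand x y m : kg_s x = kg_s y -> S x ** (S y)^# =
  \sum_(i : pathT m | kg_r (pv i) == kg_s x) S (x \; pv i) ** (S (y \; pv i))^#.
Proof.
move=> xy; rewrite -{1}(ck_r x) (ck_sum _ m) cs_sumr cs_suml; apply: eq_bigr => i /eqP ri.
by rewrite !ck_comp -?xy ?ri // cs_adjM !cs_mulA.
Qed.

Definition ck_unit n (i j : pathT n) : A := S (pv i) ** (S (pv j))^#.
Let b n (i : pathT n) := kg_s (pv i).

Lemma ck_unit_block n (i j : pathT n) : b i != b j -> ck_unit i j = 0.
Proof. by move=> /eqP ij; exact: ck_mulJ0. Qed.

Lemma ck_unitM n (i j l : pathT n) : b i = b j -> ck_unit i j ** ck_unit j l = ck_unit i l.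
Proof.
move=> ij; rewrite /ck_unit cs_mulA -(cs_mulA (S (pv i))) ck_star.
by rewrite -[kg_s (pv j)]ij ck_r.
Qed.

Lemma ck_unitM0 n (i j l m : pathT n) : j != l -> ck_unit i j ** ck_unit l m = 0.
Proof.
move=> jl; rewrite /ck_unit cs_mulA -(cs_mulA (S (pv i))) ck_orth_deg ?pvP ?cs_mul0 ?cs_0mul //.
by move/pv_inj/eqP; apply/negP.
Qed.

Lemma ck_unitJ n (i j : pathT n) : (ck_unit i j)^# = ck_unit j i.
Proof. by rewrite cs_adjM cs_adjK. Qed.

Definition ck_level N : pathT (cst k N) -> pathT (cst k N) -> A := @ck_unit (cst k N).

Lemma ck_level_span N x y : kg_d x = cst k N -> kg_d y = cst k N -> mx_span (@ck_level N) (S x ** (S y)^#).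
Proof.
by move=> /pathT_ex[i <-] /pathT_ex[j <-]; exact: (mx_span_e (@ck_level N) i j).
Qed.

Lemma ck_level_up N x y : kg_d x = kg_d y -> lek (kg_d x) (cst k N) ->
  mx_span (@ck_level N) (S x ** (S y)^#).
Proof.
move=> dxy le; have [xy|/eqP xy] := eqVneq (kg_s x) (kg_s y); last first.
  by rewrite ck_mulJ0 //; have [] := mx_span_subspace (@ck_level N).
rewrite (ck_expand (subk (kg_d x) (cst k N)) xy); apply: subspace_sum => [|i /eqP ri].
  exact: mx_span_subspace.
by apply: ck_level_span; rewrite kg_d_comp -?xy ?ri // pvP -?dxy subkK.
Qed.

Lemma ck_core_simple_AF : (exists v, p v <> 0) -> simple_AF_algebra (closure (af_core ck_level)).
Proof.
move=> [v pv0]; apply: (@matrix_units_simple_AF R A (kg_obj L) (fun N => pathT (cst k N)) (fun N => @b (cst k N))).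
- by move=> N i j; exact: ck_unit_block.
- by move=> N i j l; exact: ck_unitM.
- by move=> N i j l m; exact: ck_unitM0.
- by move=> N i j; exact: ck_unitJ.
- by move=> N i j; apply: ck_level_up; rewrite ?pvP // => l; rewrite !ffunE.
- move=> N i; have [M0 MP] := connect_exists N.
  exists (maxn M0 N) => M; rewrite geq_max => /andP[/MP conn NM] j.
  (* nu leads from the source of i to that of j. With l = i nu, the product of e_jl, e_ii and e_lj
     is e_jj. *)
  have [nu [dn rn sn]] := conn (kg_s (pv i)) (kg_s (pv j)).
  have [|l lE] := @pathT_ex (cst k M) (pv i \; nu).
    by rewrite kg_d_comp // pvP dn; apply/ffunP => a; rewrite !ffunE; flia.
  exists (ck_level j l), (ck_level l j); split; [exact: mx_span_e|exact: mx_span_e|].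
  rewrite /ck_level /ck_unit lE (ck_comp (esym rn)) cs_adjM.
  rewrite -!cs_mulA.
  have -> : (S (pv i))^# ** (S (pv i) ** ((S (pv i))^# ** (S (pv i) ** (S nu ** (S (pv j))^#)))) = S nu ** (S (pv j))^#.
    by rewrite (cs_mulA (S (pv i))^#) ck_star (cs_mulA (S (pv i))^#) ck_star -rn !cs_mulA (ck_proj _).1 ck_l.
  by rewrite (cs_mulA (S nu)^#) ck_star sn ck_rJ.
- have [i iE] := @pathT_ex (cst k 0) (kg_id v) ltac:(by rewrite kg_d_id; apply/ffunP => a; rewrite !ffunE).
  by exists 0%N, i; rewrite /ck_level /ck_unit iE (ck_proj _).2 (ck_proj _).1.
Qed.

End CK.
End PathTypes.

(** * Fixed points of the gauge action *)

Section Gauge.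
Variables (k : nat) (L : kgraph k).
Hypothesis hL : inhabited (kg_obj L).
Hypothesis hprim : primitive L.
Hypothesis hr : surjective_finite_to_one (@kg_r k L).
Hypothesis hs : surjective_finite_to_one (@kg_s k L).
Variables (R : realType) (A : cstar R) (S : L -> A) (al : ('I_k -> complex R) -> A -> A).
Local Notation C := (complex R).
Local Notation "x \; y" := (kg_comp x y).
Local Notation p v := (S (kg_id v)).
Hypothesis ck : ck_family S.

(** Explicit lists of terms, because [kill_terms] is an induction on their number. *)
Definition sp_sum (l : seq (C * (L * L))) : A := \sum_(t <- l) t.1 *: (S t.2.1 ** (S t.2.2)^#).
Definition sp : set A := [set a | exists l, a = sp_sum l].

Lemma sp_subspace : subspace sp.
Proof.
split; first by exists [::]; rewrite /sp_sum big_nil.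
- by move=> _ _ [l ->] [l' ->]; exists (l ++ l'); rewrite /sp_sum big_cat.
- move=> c _ [l ->]; exists [seq (c * t.1, t.2) | t <- l].
  by rewrite /sp_sum big_map scaler_sumr; apply: eq_bigr => t _; rewrite scalerA.
Qed.

Lemma sp_gen x y : sp (S x ** (S y)^#).
Proof. by exists [:: (1, (x, y))]; rewrite /sp_sum big_seq1 scale1r. Qed.

Lemma sp_ind (P : set A) : subspace P -> (forall x y, P (S x ** (S y)^#)) -> sp `<=` P.
Proof. by move=> sP Pg _ [l ->]; apply: subspace_sum => // t _; have [_ _ PZ] := sP; exact: PZ. Qed.

Lemma sp0 : sp 0. Proof. by have [] := sp_subspace. Qed.

Lemma sp_mull x a : sp a -> sp (S x ** a).
Proof.
have [s0 sD sZ] := sp_subspace; apply: (@sp_ind [set a | sp (S x ** a)]) => [|y z] /=.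
  split=> /= [|a1 b|c a1]; rewrite ?cs_mul0 ?cs_mulDr ?cs_mulZr //; [exact: sD|exact: sZ].
rewrite cs_mulA; have [xy|/eqP xy] := eqVneq (kg_s x) (kg_r y); last by rewrite (ck_mul0 ck) // cs_0mul.
by rewrite -(ck_comp ck) //; exact: sp_gen.
Qed.

Lemma sp_adj a : sp a -> sp a^#.
Proof.
have [s0 sD sZ] := sp_subspace; apply: (@sp_ind [set a | sp a^#]) => [|y z] /=.
  split=> /= [|a1 b|c a1]; rewrite ?cs_adj0 ?cs_adjD ?cs_adjZ //; [exact: sD|exact: sZ].
by rewrite cs_adjM cs_adjK; exact: sp_gen.
Qed.

Lemma sp_mulr x a : sp a -> sp (a ** (S x)^#).
Proof. by move=> /sp_adj/(sp_mull x)/sp_adj; rewrite cs_adjM cs_adjK. Qed.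

Lemma ck_cancel y x : lek (kg_d y) (kg_d x) ->
  (S y)^# ** S x = 0 \/ exists z, (S y)^# ** S x = S z.
Proof.
move=> /subkK/esym/factor[y' [z [yz -> dy _]]]; rewrite (ck_comp ck) //.
have [yE|/eqP ny] := eqVneq y y'.
  by right; exists z; rewrite yE cs_mulA (ck_star ck) yz (ck_l ck).
by left; rewrite cs_mulA (ck_orth_deg hL hprim hr ck) ?cs_0mul // dy.
Qed.

(** Inserting the range projections of all paths of degree d(y) + d(z) makes each factor 0, a
    generator or the adjoint of one, by [ck_cancel]. *)
Lemma sp_starmul y z : sp ((S y)^# ** S z).
Proof.
pose n := kg_d y + kg_d z.
rewrite -(ck_lJ ck y) -cs_mulA (ck_sum hL hprim hr ck (kg_r y) n) cs_suml cs_sumr.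
apply: subspace_sum => [|i _]; first exact: sp_subspace.
have dn := pvP hL hprim hr i; rewrite -cs_mulA cs_mulA.
have [|->|[a ->]] := @ck_cancel y (pv i); first by move=> j; rewrite dn ffunE leq_addr.
  by rewrite cs_0mul; exact: sp0.
have -> : (S (pv i))^# ** S z = ((S z)^# ** S (pv i))^# by rewrite cs_adjM cs_adjK.
have [|->|[c ->]] := @ck_cancel z (pv i); first by move=> j; rewrite dn ffunE leq_addl.
  by rewrite cs_adj0 cs_mul0; exact: sp0.
exact: sp_gen.
Qed.

Lemma sp_star : star_subalgebra sp.
Proof.
split; [exact: sp_subspace | | exact: sp_adj].
have [s0 sD sZ] := sp_subspace.
move=> a a' ha ha'; move: a ha a' ha'; apply: sp_ind => [|x y].
  split=> /= [a1 _|a1 b ha hb a2 ha'|c a1 ha a2 ha']; first by rewrite cs_0mul; exact: sp0.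
    by rewrite cs_mulDl; apply: sD; [exact: ha|exact: hb].
  by rewrite cs_mulZl; apply: sZ; exact: ha.
apply: sp_ind => [|z w] /=.
  split=> /= [|a1 b ha hb|c a1 ha]; first by rewrite cs_mul0; exact: sp0.
    by rewrite cs_mulDr; exact: sD.
  by rewrite cs_mulZr; exact: sZ.
rewrite cs_mulA -(cs_mulA (S x)); apply: sp_mulr; apply: sp_mull; exact: sp_starmul.
Qed.

Hypothesis gen : forall B : set A, cstar_subalgebra B -> (forall x, B (S x)) -> B = setT.
Hypothesis gauge : is_gauge_action S al.

Lemma sp_dense : closure sp = setT.
Proof.
apply: gen; first exact/closure_star_subalgebra/sp_star.
move=> x; apply: subset_closure; rewrite -(ck_r ck) -(ck_proj ck _).2; exact: sp_gen.
Qed.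

Lemma gauge_gen z x y : torus z ->
  al z (S x ** (S y)^#) = (mpow z (kg_d x) * (mpow z (kg_d y))^*) *: (S x ** (S y)^#).
Proof.
move=> /gauge[[_ _ aM aJ] aS].
by rewrite aM aJ !aS cs_adjZ cs_mulZl cs_mulZr scalerA.
Qed.

Lemma mpow_unit (z : 'I_k -> C) (d : Nk k) : torus z -> `|mpow z d| = 1.
Proof.
by move=> tz; rewrite normr_prod big1 // => i _; rewrite normrX tz expr1n.
Qed.

Lemma gauge_neutral z x y : torus z -> kg_d x = kg_d y -> al z (S x ** (S y)^#) = S x ** (S y)^#.
Proof.
by move=> tz dxy; rewrite gauge_gen // dxy -normCK mpow_unit // expr1n scale1r.
Qed.

Lemma unit_root_m1 n : (0 < n)%N -> exists2 w : C, `|w| = 1 & w ^+ n = -1.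
Proof.
move=> n0; exists (n.-root (-1)); last exact: rootCK.
by apply/eqP; rewrite -(pexpr_eq1 n0) // -normrX rootCK // normrN1.
Qed.

Lemma gauge_neg x y : kg_d x <> kg_d y ->
  exists2 z, torus z & al z (S x ** (S y)^#) = - (S x ** (S y)^#).
Proof.
move=> dxy; have /existsNP[i di] : ~ forall i, kg_d x i = kg_d y i by move=> /ffunP.
(* Subtraction is truncated, so n is the distance of the two degrees in coordinate i. An n-th root
   of -1 placed there acts on the term by -1. *)
pose n := ((kg_d x i - kg_d y i) + (kg_d y i - kg_d x i))%N.
have [|w w1 wn] := @unit_root_m1 n; first by rewrite /n; flia.
have tz : torus (fun j : 'I_k => if j == i then w else 1).
  by move=> j; case: eqP => // _; rewrite normr1.
exists (fun j => if j == i then w else 1) => //.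
rewrite gauge_gen //.
have pw d : mpow (fun j : 'I_k => if j == i then w else 1) d = w ^+ d i.
  by rewrite /mpow (bigD1 i) //= eqxx big1 ?mulr1 // => j /negPf ->; rewrite expr1n.
have ww m : w ^+ m * (w ^+ m)^* = 1 by rewrite -normCK normrX w1 !expr1n.
rewrite !pw (_ : _ * _ = -1) ?scaleN1r //.
have [le|lt] := leqP (kg_d x i) (kg_d y i).
  have -> : kg_d y i = (kg_d x i + n)%N by rewrite /n; flia.
  by rewrite exprD rmorphM /= wn mulrA ww mul1r conjCN1.
have -> : kg_d x i = (kg_d y i + n)%N by rewrite /n; flia.
by rewrite exprD mulrAC ww mul1r.
Qed.

Lemma al_contractive z a : torus z -> nm (al z a) <= nm a.
Proof. by move=> /gauge[h _]; exact: star_hom_contractive. Qed.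

Local Notation core := (af_core (@ck_level k L R A S)).

Lemma core_subspace : subspace core.
Proof.
have h : star_subalgebra core.
  apply: bigcup_star_subalgebra => [N|N].
    apply: (mx_span_star (b := fun i => kg_s (pv i))).
    - by move=> i j; exact: ck_unit_block.
    - by move=> i j l; exact: ck_unitM.
    - by move=> i j l m; exact: ck_unitM0.
    - by move=> i j; exact: ck_unitJ.
  apply: mx_span_sub => [|i j]; first exact: mx_span_subspace.
  by apply: ck_level_up; rewrite ?(pvP hL hprim hr) // => l; rewrite !ffunE.
by case: h.
Qed.

Lemma core_gen x y : kg_d x = kg_d y -> core (S x ** (S y)^#).
Proof.
move=> dxy; exists (\max_i kg_d x i) => //; apply: ck_level_up => // i.
by rewrite ffunE; exact: (leq_bigmax i).
Qed.

Lemma core_fixed : core `<=` fixed_points al.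
Proof.
move=> a [N _ [c ->]] z tz; have [[aD aZ _ _] _] := gauge tz.
have a0 : al z 0 = 0 by have := aZ 0 0; rewrite !scale0r.
rewrite /mx_sum (big_morph (al z) (id1 := 0) (op1 := +%R)) //; apply: eq_bigr => i _.
rewrite (big_morph (al z) (id1 := 0) (op1 := +%R)) //; apply: eq_bigr => j _.
by rewrite aZ gauge_neutral // !(pvP hL hprim hr).
Qed.

(* Averaging over {1, z} kills a term on which z acts as -1 and does not move a. *)
Lemma kill_terms a (e : R) : fixed_points al a -> forall n l y0, size l = n -> core y0 ->
  nm (a - (y0 + sp_sum l)) < e -> exists2 y, core y & nm (a - y) < e.
Proof.
move=> fa; have [c0 cD cZ] := core_subspace.
elim=> [|n IH] [|[c [x y]] l] y0 //= sl cy0.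
  by rewrite /sp_sum big_nil addr0; exists y0.
case: sl => sl; rewrite /sp_sum big_cons -/(sp_sum l) /=.
have [dxy|/eqP dxy] := eqVneq (kg_d x) (kg_d y).
  by rewrite addrA; apply: IH => //; apply/cD/cZ/core_gen.
have [z tz az] := gauge_neg dxy; have [[aD aZ _ _] _] := gauge tz.
have a0 : al z 0 = 0 by have := aZ 0 0; rewrite !scale0r.
have aB u v : al z (u - v) = al z u - al z v by rewrite aD -scaleN1r aZ scaleN1r.
set Y := y0 + _ => aY.
pose w (t : L * L) := mpow z (kg_d t.1) * (mpow z (kg_d t.2))^*.
(* The average of Y and al_z Y keeps y0, loses the head term and only rescales the others: the list
   is shorter by one, and the distance to a has not grown. *)
pose l' := [seq ((2^-1 : R)%:C%C * (t.1 + t.1 * w t.2), t.2) | t <- l].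
have E : half (Y + al z Y) = y0 + sp_sum l'.
  have alY : al z Y = y0 - c *: (S x ** (S y)^#) + al z (sp_sum l).
    by rewrite /Y !aD aZ az scalerN (core_fixed cy0 tz) addrA.
  have -> : Y + al z Y = (y0 + y0) + (sp_sum l + al z (sp_sum l)).
    rewrite alY /Y; set q := c *: _.
    by rewrite addrACA -[q + _ + _]addrA [y0 + (y0 - q)]addrA [LHS]addrA subrK.
  rewrite /half scalerDr -/(half (y0 + y0)) {1}/half scalerDr half_add; congr (_ + _).
  have -> : al z (sp_sum l) = \sum_(t <- l) (t.1 * w t.2) *: (S t.2.1 ** (S t.2.2)^#).
    rewrite /sp_sum (big_morph (al z) (id1 := 0) (op1 := +%R)) //; apply: eq_bigr => t _.
    by rewrite aZ gauge_gen // scalerA.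
  rewrite /sp_sum -big_split scaler_sumr big_map; apply: eq_bigr => t _.
  by rewrite /= -scalerDl scalerA.
apply: (IH l' y0) => //; first by rewrite size_map.
rewrite -E; have -> : a - half (Y + al z Y) = half ((a - Y) + al z (a - Y)).
  by rewrite aB (fa z tz) addrACA -opprD halfB; congr (_ - _); rewrite /half scalerDr half_add.
rewrite nm_half; have := nmD (a - Y) (al z (a - Y)); have := al_contractive (a - Y) tz; lra.
Qed.

Lemma fixed_points_core : fixed_points al = closure core.
Proof.
apply/seteqP; split=> a.
  move=> fa; apply/closureC => e e0.
  have : closure sp a by rewrite sp_dense.
  move=> /closureC/(_ e e0)[_ [l ->] al_]; have [c0 _ _] := core_subspace.
  by apply: (@kill_terms a e fa _ l 0 erefl c0); rewrite add0r.
move=> /closureC ca z tz; apply/eqP; rewrite -subr_eq0; apply/eqP.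
apply: (@eq_of_approx R _ _ 0 2) => e e0 _; rewrite subr0.
have [y cy ay] := ca e e0; have [[aD aZ _ _] _] := gauge tz.
have aB u v : al z (u - v) = al z u - al z v by rewrite aD -scaleN1r aZ scaleN1r.
have := nm_tri (al z a) y a; rewrite -{1}(core_fixed cy tz) -aB.
have := al_contractive (a - y) tz; rewrite (nmB y a); lra.
Qed.

End Gauge.

(** * One-sided infinite paths, prepending and shifting *)

Section OneSidedPaths.
Variables (k : nat) (L : kgraph k).
Implicit Types (x y z u v : L) (n m p : Nk k).
Local Notation "x \; y" := (kg_comp x y).

Definition pre y x := exists2 b, kg_s x = kg_r b & y = x \; b.

Lemma seg0_pre y x : seg y 0 x -> pre y x.
Proof.
move=> [a [b [ax xb /deg0_id aE E]]]; exists b => //.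
have ra : kg_r a = kg_r x by rewrite -ax {2}aE kg_s_id.
by rewrite E aE ra -(kg_r_comp xb) kg_id_comp.
Qed.

Lemma pre_refl x : pre x x.
Proof. by exists (kg_id (kg_s x)); rewrite ?kg_r_id ?kg_comp_id. Qed.

Lemma pre_trans x y z : pre z y -> pre y x -> pre z x.
Proof.
move=> [b yb ->] [c xc yE]; move: yb; rewrite yE kg_s_comp // => cb.
by exists (c \; b); rewrite ?kg_r_comp // kg_compA.
Qed.

Lemma pre_r y x : pre y x -> kg_r y = kg_r x.
Proof. by move=> [b xb ->]; rewrite kg_r_comp. Qed.

Lemma pre_uniq y x x' : pre y x -> pre y x' -> kg_d x = kg_d x' -> x = x'.
Proof. by move=> [b xb ->] [b' xb' E] dx; have [] := comp_inj xb xb' E dx. Qed.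

Lemma pre_ex y n : lek n (kg_d y) -> exists2 x, kg_d x = n & pre y x.
Proof.
by move=> le; have [|x dx /seg0_pre px] := @seg_ex _ _ y 0 n; [rewrite add0r | exists x].
Qed.

Lemma pre_le y u v : pre y u -> pre y v -> lek (kg_d v) (kg_d u) -> pre u v.
Proof.
move=> yu yv /pre_ex[w dw uw]; rewrite (_ : v = w) //.
by apply: (pre_uniq yv (pre_trans yu uw)).
Qed.

Lemma pre_comp x y z : kg_s z = kg_r y -> pre y x -> pre (z \; y) (z \; x).
Proof.
move=> zy [b xb yE]; have zx : kg_s z = kg_r x by rewrite zy yE kg_r_comp.
by exists b; rewrite ?kg_s_comp // yE kg_compA.
Qed.

(** An infinite path x, recorded by its initial segments x(0, n). *)
Record opath := Opath {
  op_val :> Nk k -> L;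
  op_d : forall n, kg_d (op_val n) = n;
  op_pre : forall n m, pre (op_val (n + m)) (op_val n)
}.

HB.instance Definition _ := gen_eqMixin opath.
HB.instance Definition _ := gen_choiceMixin opath.

Implicit Types f g : opath.

Lemma opath_ext f g : (forall n, f n = g n) -> f = g.
Proof.
case: f g => [f fd fp] [g gd gp] /= /funext E; subst g; congr Opath; exact: Prop_irrelevance.
Qed.

Definition op_r f : kg_obj L := kg_r (f 0).

Lemma op_rE f n : kg_r (f n) = op_r f.
Proof. by have := op_pre f 0 n; rewrite add0r => /pre_r. Qed.

Definition pfx x n : L := xget x [set u | kg_d u = n /\ pre x u].

Lemma pfxP x n : lek n (kg_d x) -> kg_d (pfx x n) = n /\ pre x (pfx x n).
Proof. by move=> /pre_ex[u du pu]; apply: (@xgetPex _ x [set u | kg_d u = n /\ pre x u]); exists u. Qed.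

Section Prepend.
Variables (x : L) (f : opath).
Hypothesis xf : kg_s x = op_r f.

Lemma xfn n : kg_s x = kg_r (f n). Proof. by rewrite op_rE. Qed.

Lemma pp_pfxP n : kg_d (pfx (x \; f n) n) = n /\ pre (x \; f n) (pfx (x \; f n) n).
Proof. by apply: pfxP => i; rewrite (kg_d_comp (xfn n)) op_d ffunE leq_addl. Qed.

Lemma pp_pre n m : pre (pfx (x \; f (n + m)) (n + m)) (pfx (x \; f n) n).
Proof.
have [d1 p1] := pp_pfxP (n + m); have [d2 p2] := pp_pfxP n.
apply: pre_le p1 (pre_trans (pre_comp (xfn _) (op_pre f n m)) p2) _.
by rewrite d1 d2 => i; rewrite ffunE leq_addr.
Qed.

Definition pp0 : opath := @Opath (fun n => pfx (x \; f n) n) (fun n => (pp_pfxP n).1) pp_pre.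

End Prepend.

Definition prepend x f : opath :=
  if pselect (kg_s x = op_r f) is left h then pp0 h else f.

Lemma prependP x f n : kg_s x = op_r f -> pre (x \; f n) (prepend x f n).
Proof. by move=> h; rewrite /prepend; case: pselect => // h'; exact: (pp_pfxP h' n).2. Qed.

Lemma prepend_uniq x f n u : kg_s x = op_r f -> pre (x \; f n) u -> kg_d u = n -> prepend x f n = u.
Proof. by move=> h pu du; apply: (pre_uniq (prependP n h) pu); rewrite op_d. Qed.

Lemma oshift_pfxP p f n : kg_s (f p) = kg_r (sub (f (p + n)) p n) /\
  f (p + n) = f p \; sub (f (p + n)) p n.
Proof.
have [|d s] := @subP _ L (f (p + n)) p n; first by rewrite op_d => i.
have [b pb E] := op_pre f p n.
have s0 : seg (f (p + n)) p b by have := seg_right pb; rewrite -E op_d.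
rewrite (_ : sub _ _ _ = b) //; apply: (seg_uniq s s0); rewrite d.
by apply: (@Nk_addI _ (kg_d (f p))); rewrite -kg_d_comp // -E !op_d.
Qed.

Lemma oshift_d p f n : kg_d (sub (f (p + n)) p n) = n.
Proof. by have [|-> //] := @subP _ L (f (p + n)) p n; rewrite op_d => i. Qed.

Lemma oshift_pre p f n m : pre (sub (f (p + (n + m))) p (n + m)) (sub (f (p + n)) p n).
Proof.
have [r1 E1] := oshift_pfxP p f (n + m); have [r2 E2] := oshift_pfxP p f n.
have [b pb] := op_pre f (p + n) m; rewrite -addrA.
set a := sub _ _ (n + m) in r1 E1 *; set c := sub _ _ n in r2 E2 *.
move: pb; rewrite {1}E2 kg_s_comp // E1 E2 => pb; rewrite -kg_compA // => /comp_inj[] //.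
  by rewrite kg_r_comp.
by move=> _ E'; exists b.
Qed.

Definition oshift p f : opath := @Opath (fun n => sub (f (p + n)) p n) (oshift_d p f) (oshift_pre p f).

Lemma oshiftE p f n : f (p + n) = f p \; oshift p f n.
Proof. by have [] := oshift_pfxP p f n. Qed.

Lemma oshift_r p f : kg_s (f p) = op_r (oshift p f).
Proof. by have [] := oshift_pfxP p f 0. Qed.

Lemma prepend_at x f : kg_s x = op_r f -> prepend x f (kg_d x) = x.
Proof. by move=> h; apply: prepend_uniq => //; exists (f (kg_d x)); rewrite ?op_rE. Qed.

Lemma prepend_r x f : kg_s x = op_r f -> op_r (prepend x f) = kg_r x.
Proof. by move=> h; rewrite -(op_rE _ (kg_d x)) prepend_at. Qed.

Lemma prependK x f : kg_s x = op_r f -> oshift (kg_d x) (prepend x f) = f.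
Proof.
move=> h; apply: opath_ext => n.
have E : prepend x f (kg_d x + n) = x \; f n.
  apply: prepend_uniq => //; last by rewrite kg_d_comp ?op_rE // op_d.
  by apply: pre_comp; [rewrite op_rE | rewrite addrC; exact: op_pre].
have := oshiftE (kg_d x) (prepend x f) n; rewrite E prepend_at // => /comp_inj[] //.
- by rewrite op_rE.
- by rewrite op_rE -oshift_r prepend_at.
Qed.

Lemma oshiftK x f : f (kg_d x) = x -> prepend x (oshift (kg_d x) f) = f.
Proof.
move=> h; have hx : kg_s x = op_r (oshift (kg_d x) f) by rewrite -oshift_r h.
apply: opath_ext => n; apply: prepend_uniq; rewrite ?op_d //.
have := oshiftE (kg_d x) f n; rewrite h => <-; rewrite addrC; exact: op_pre.
Qed.

Lemma prepend_comp x y f : kg_s x = kg_r y -> kg_s y = op_r f ->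
  prepend (x \; y) f = prepend x (prepend y f).
Proof.
move=> xy yf; apply: opath_ext => n; apply: prepend_uniq; rewrite ?kg_s_comp ?op_d //.
have xyf : kg_s x = op_r (prepend y f) by rewrite prepend_r.
apply: pre_trans (prependP n xyf); rewrite -kg_compA ?op_rE //.
apply: pre_comp; last exact: prependP.
by rewrite kg_r_comp ?op_rE.
Qed.

Lemma prepend_id f : prepend (kg_id (op_r f)) f = f.
Proof.
apply: opath_ext => n; apply: prepend_uniq; rewrite ?kg_s_id ?op_d //.
by rewrite -(op_rE f n) kg_id_comp; exact: pre_refl.
Qed.

Lemma op0_id f : f 0 = kg_id (op_r f).
Proof. by apply: deg0_id; rewrite op_d. Qed.

Lemma lez_0 n : lez 0 (toZ n).
Proof. by apply/forallP => i; rewrite !ffunE. Qed.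

(** Supplies an infinite path, so that the path representation is nonzero at some vertex. *)
Definition future (b : bipath L) : opath.
Proof.
refine (@Opath (fun n => bp b (lez_0 n)) _ _).
- by move=> n; rewrite kg_d_bp; apply/ffunP => i; rewrite !ffunE subr0.
- move=> n m; have h : lez (toZ n) (toZ (n + m)) by apply/forallP => i; rewrite !ffunE; flia.
  exists (bp b h); first by rewrite bp_s bp_r.
  by rewrite -bp_comp; exact: bp_irr.
Defined.

End OneSidedPaths.

(** * Finitely supported functions and the operators given by partial bijections *)

Section FiniteSupport.
Variables (R : realType) (X : choiceType).
Local Notation C := (complex R).
Implicit Types f g h : X -> C.

Definition fsupp : set (X -> C) := [set f | finite_set [set x | f x != 0]].
Definition fip f g : C := \sum_(x \in [set: X]) f x * (g x)^*.

Lemma fipE (D : {fset X}) f g : (forall x, f x != 0 -> x \in D) ->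
  fip f g = \sum_(x <- D) f x * (g x)^*.
Proof.
move=> fD; rewrite /fip (fsbigE (enum_fset D)) ?fset_uniq //.
  by apply: eq_bigl => x; rewrite in_setT.
by move=> x _; apply: contraNeq; rewrite mulf_eq0 negb_or => /andP[/fD].
Qed.

Lemma fsupp_in f : fsupp f -> exists D : {fset X}, forall x, f x != 0 -> x \in D.
Proof.
by move=> ff; exists (fset_set [set x | f x != 0]) => x fx; rewrite in_fset_set //; exact/mem_set.
Qed.

Lemma fsupp0 : fsupp 0.
Proof. by rewrite /fsupp /= (_ : [set x | _] = set0) //; apply/seteqP; split=> x //=; rewrite eqxx. Qed.

Lemma fsuppD f g : fsupp f -> fsupp g -> fsupp (f + g).
Proof.
move=> ff fg; have fU : finite_set ([set x | f x != 0] `|` [set x | g x != 0]) by rewrite finite_setU.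
apply: sub_finite_set fU => x /= fgx; have [f0|?] := eqVneq (f x) 0; [right|by left].
by apply: contraNneq fgx => g0; rewrite -[_ x]/(f x + g x) f0 g0 addr0.
Qed.

Lemma fsuppZ (c : C) f : fsupp f -> fsupp (c *: f).
Proof.
move=> ff; apply: sub_finite_set ff => x /=.
by rewrite -[_ x]/(c * f x) mulf_eq0 negb_or => /andP[].
Qed.

Lemma fipDl f g h : fsupp f -> fsupp g -> fsupp h -> fip (f + g) h = fip f h + fip g h.
Proof.
move=> /fsupp_in[D fD] /fsupp_in[D' gD'] _.
have f1 x : f x != 0 -> x \in (D `|` D')%fset by move=> /fD h1; rewrite inE h1.
have g1 x : g x != 0 -> x \in (D `|` D')%fset by move=> /gD' h1; rewrite inE h1 orbT.
rewrite (fipE h f1) (fipE h g1) (@fipE (D `|` D')%fset) -?big_split.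
  by apply: eq_bigr => x _; rewrite /= -mulrDl.
move=> x fgx; have [f0|/f1 //] := eqVneq (f x) 0; apply: g1.
by apply: contraNneq fgx => g0; rewrite -[_ x]/(f x + g x) f0 g0 addr0.
Qed.

Lemma fipZl (c : C) f g : fsupp f -> fsupp g -> fip (c *: f) g = c * fip f g.
Proof.
move=> /fsupp_in[D fD] _; rewrite (fipE g fD) (@fipE D) ?mulr_sumr.
  by apply: eq_bigr => x _; rewrite mulrA.
by move=> x; rewrite -[_ x]/(c * f x) mulf_eq0 negb_or => /andP[_ /fD].
Qed.

Lemma fipC f g : fsupp f -> fsupp g -> fip f g = (fip g f)^*.
Proof.
move=> /fsupp_in[D fD] /fsupp_in[D' gD'].
have f1 x : f x != 0 -> x \in (D `|` D')%fset by move=> /fD h1; rewrite inE h1.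
have g1 x : g x != 0 -> x \in (D `|` D')%fset by move=> /gD' h1; rewrite inE h1 orbT.
rewrite (fipE g f1) (fipE f g1) rmorph_sum; apply: eq_bigr => x _.
by rewrite rmorphM /= conjCK mulrC.
Qed.

Lemma fip_ge0 f : fsupp f -> 0 <= fip f f.
Proof.
by move=> /fsupp_in[D fD]; rewrite (fipE f fD); apply: sumr_ge0 => x _; rewrite -normCK exprn_ge0.
Qed.

Definition l2pre : prehilbert R :=
  @Prehilbert R (X -> C) fsupp fip fsupp0 fsuppD fsuppZ fipDl fipZl fipC fip_ge0.

(** The generators of the path representation and their adjoints are both of this form, for a
    partial bijection and its inverse. *)
Definition pullb (P : set X) (h : X -> X) f : X -> C := fun x => if `[< P x >] then f (h x) else 0.

Lemma pullb_in P (h : X -> X) f x : P x -> pullb P h f x = f (h x).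
Proof. by move=> Px; rewrite /pullb asboolT. Qed.

Lemma pullb_out P (h : X -> X) f x : ~ P x -> pullb P h f x = 0.
Proof. by move=> Px; rewrite /pullb asboolF. Qed.

Definition part_bij (P Q : set X) (h h' : X -> X) :=
  (forall x, P x -> Q (h x) /\ h' (h x) = x) /\ (forall y, Q y -> P (h' y) /\ h (h' y) = y).

Section Pullback.
Variables (P Q : set X) (h h' : X -> X).
Hypothesis hP : part_bij P Q h h'.

Lemma part_bij_sym : part_bij Q P h' h. Proof. by case: hP. Qed.

Lemma fsupp_pullb f : fsupp f -> fsupp (pullb P h f).
Proof.
move=> ff; apply: (sub_finite_set (B := h' @` [set x | f x != 0])); last exact: finite_image.
move=> x /=; have [Px|Px] := pselect (P x); last by rewrite pullb_out ?eqxx.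
by rewrite pullb_in // => fx; exists (h x) => //; have [] := hP.1 x Px.
Qed.

Lemma fip_pullb f g : fip (pullb P h f) g = fip f (pullb Q h' g).
Proof.
rewrite /fip -[LHS](fsbig_widen P) //; last first.
  by move=> x [_ /= Px]; rewrite pullb_out ?mul0r.
rewrite -[RHS](fsbig_widen Q) //; last first.
  by move=> x [_ /= Qx]; rewrite (pullb_out h' g Qx) rmorph0 mulr0.
have bij : set_bij P Q h.
  split; first by move=> x Px; have [] := hP.1 x Px.
    by move=> x y /set_mem Px /set_mem Py E; rewrite -(hP.1 x Px).2 E (hP.1 y Py).2.
  by move=> y Qy; have [Py yE] := hP.2 y Qy; exists (h' y).
rewrite (reindex_fsbig _ _ _ _ bij); apply: eq_fsbigr => x /set_mem Px.
have [Qx xE] := hP.1 x Px; by rewrite !pullb_in // xE.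
Qed.

Lemma pn_pullb f : fsupp f -> @pn R l2pre (pullb P h f) <= 1 * @pn R l2pre f.
Proof.
move=> ff; rewrite mul1r ler_sqrt; last first.
  by have := fip_ge0 ff; rewrite lecE => /andP[].
suff : fip (pullb P h f) (pullb P h f) <= fip f f by rewrite lecE => /andP[].
rewrite fip_pullb; have [D fD] := fsupp_in ff; rewrite !(fipE _ fD).
apply: ler_sum => x _; have [Qx|Qx] := pselect (Q x); last by rewrite pullb_out // conjC0 mulr0 mul_conjC_ge0.
by have [Px xE] := hP.2 x Qx; rewrite pullb_in // pullb_in // xE.
Qed.

End Pullback.

Local Notation H := (compl_hilbert l2pre).

Section PullbackOperator.
Variables (P Q : set X) (h h' : X -> X).
Hypothesis hP : part_bij P Q h h'.

Definition pb_fun (w : H + H) : H := match w with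
  | inl f => @ext R l2pre (pullb P h) (pullb Q h') 1 ler01 (fsupp_pullb hP) (fsupp_pullb (part_bij_sym hP))
      (fun f g _ _ => fip_pullb hP f g) (pn_pullb (part_bij_sym hP)) f
  | inr f => @ext R l2pre (pullb Q h') (pullb P h) 1 ler01 (fsupp_pullb (part_bij_sym hP)) (fsupp_pullb hP)
      (fun f g _ _ => fip_pullb (part_bij_sym hP) f g) (pn_pullb hP) f
  end.

Lemma pb_funP : opP pb_fun.
Proof.
split=> [f g|]; first exact: ext_adj.
by exists 1 => // -[f|f]; exact: ext_le.
Qed.

Definition pb_op : BH H := mk_op pb_funP.

End PullbackOperator.

Lemma functional_eq (f : compl l2pre) (u v : X -> C) (Vu : fsupp u) (Vv : fsupp v) :
  u = v -> f (exist _ u Vu) = f (exist _ v Vv).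
Proof. by move=> E; subst v; congr (f (exist _ _ _)); exact: Prop_irrelevance. Qed.

Lemma functional0 (f : compl l2pre) (V0 : fsupp 0) : f (exist _ 0 V0) = 0.
Proof.
have := fevalZr f 0 V0; rewrite mul0r /feval => E; apply: (can_inj conjCK).
by rewrite conjC0 -E; congr (_^*); apply: functional_eq; rewrite scale0r.
Qed.

Lemma functional_sum (f : compl l2pre) (I : Type) (r : seq I) (u : I -> X -> C)
  (Vu : forall i, fsupp (u i)) (Vs : fsupp (\sum_(i <- r) u i)) :
  f (exist _ _ Vs) = \sum_(i <- r) f (exist _ (u i) (Vu i)).
Proof.
elim: r Vs => [|i r IH] Vs.
  by rewrite (functional_eq f Vs fsupp0 (big_nil _ _ _ _)) functional0 [RHS]big_nil.
have Vr : fsupp (\sum_(i <- r) u i).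
  by elim/big_ind: _ => //; [exact: fsupp0 | exact: fsuppD].
rewrite [RHS]big_cons -(IH Vr) (functional_eq f Vs (fsuppD (Vu i) Vr) (big_cons _ _ _ _ _ _)).
by apply: (can_inj conjCK); rewrite rmorphD; exact: (fevalDr f (Vu i) Vr).
Qed.

End FiniteSupport.

(** * The representation of C*(Lambda) on l^2 of the infinite paths *)

Section PathRepresentation.
Variables (k : nat) (L : kgraph k) (R : realType).
Local Notation C := (complex R).
Local Notation "x \; y" := (kg_comp x y).
Local Notation H := (compl_hilbert (l2pre R (opath L))).
Hypothesis hL : inhabited (kg_obj L).
Hypothesis hprim : primitive L.
Hypothesis hr : surjective_finite_to_one (@kg_r k L).

Definition cylP (x : L) : set (opath L) := [set f | f (kg_d x) = x].
Definition srcQ (x : L) : set (opath L) := [set f | op_r f = kg_s x].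

Lemma path_bij x : part_bij (cylP x) (srcQ x) (oshift (kg_d x)) (prepend x).
Proof.
split=> f; rewrite /cylP /srcQ /= => h; first by rewrite -oshift_r h oshiftK.
by rewrite prepend_at // prependK.
Qed.

(** S_x sends the basis vector of f to that of x f. Vectors of the completion are functionals, so
    S_x acts by precomposition with [T'] and the relations are checked on functions in reversed
    order. *)
Definition pathS (x : L) : BH H := pb_op R (path_bij x).

Local Notation T x w := (pullb (cylP x) (oshift (kg_d x)) w).
Local Notation T' x w := (pullb (srcQ x) (prepend x) w).

Lemma T'T x w : T' x (T x w) = T' (kg_id (kg_s x)) w :> (opath L -> C).
Proof.
apply/funext => f; have [h|h] := pselect (srcQ x f); last first.
  by rewrite !pullb_out // /srcQ /= kg_s_id.
have [c e] := (path_bij x).2 f h; rewrite !pullb_in // ?e; last by rewrite /srcQ /= kg_s_id.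
by rewrite -[kg_s x]h prepend_id.
Qed.

Lemma T'_id v w : T' (kg_id v) w = (fun f => if `[< op_r f = v >] then w f else 0) :> (opath L -> C).
Proof.
apply/funext => f; rewrite /pullb /srcQ /= kg_s_id; case: asboolP => // <-.
by rewrite prepend_id.
Qed.

Lemma T_id v w : T (kg_id v) w = T' (kg_id v) w :> (opath L -> C).
Proof.
apply/funext => f; rewrite T'_id; case: asboolP => [fv|fv].
  have c : cylP (kg_id v) f by rewrite /cylP /= kg_d_id op0_id fv.
  rewrite pullb_in //; congr w; have e := oshiftK c.
  have gv : op_r (oshift (kg_d (kg_id v)) f) = v by rewrite -oshift_r c kg_s_id.
  by have := prepend_id (oshift (kg_d (kg_id v)) f); rewrite gv e => /esym.
by rewrite pullb_out // /cylP /= kg_d_id op0_id => /(congr1 (@kg_r _ L)); rewrite !kg_r_id.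
Qed.

Lemma T'_comp x y w : kg_s x = kg_r y -> T' (x \; y) w = T' y (T' x w) :> (opath L -> C).
Proof.
move=> xy; apply/funext => f; have [h|h] := pselect (srcQ y f); last first.
  by rewrite !pullb_out // /srcQ /= kg_s_comp.
rewrite !pullb_in // ?prepend_comp // /srcQ /= ?kg_s_comp //.
by rewrite prepend_r.
Qed.

Lemma TT' x w f : T x (T' x w) f = if `[< cylP x f >] then w f else 0 :> C.
Proof.
case: asboolP => h; last by rewrite pullb_out.
have [q e] := (path_bij x).1 f h; by rewrite !pullb_in // e.
Qed.

Lemma pathS_l x (f : H) w Vw : pathS x (inl f) (exist _ w Vw) =
  f (exist _ (T' x w) (fsupp_pullb (part_bij_sym (path_bij x)) Vw)).
Proof. by []. Qed.

Lemma pathS_r x (f : H) w Vw : pathS x (inr f) (exist _ w Vw) =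
  f (exist _ (T x w) (fsupp_pullb (path_bij x) Vw)).
Proof. by []. Qed.

Lemma BH_ext (a c : BH H) : (forall (f : H) w Vw, a (inl f) (exist _ w Vw) = c (inl f) (exist _ w Vw)) -> a = c.
Proof. by move=> h; apply: op_ext => f; apply: fspace_ext => -[w Vw]; exact: h. Qed.

Lemma BH_mulE (a c : BH H) f : (a ** c) (inl f) = a (inl (c (inl f))). Proof. by []. Qed.
Lemma BH_mulrE (a c : BH H) f : (a ** c) (inr f) = c (inr (a (inr f))). Proof. by []. Qed.
Lemma BH_adjE (a : BH H) f : a^# (inl f) = a (inr f). Proof. by []. Qed.

Definition pathE := (BH_mulE, BH_mulrE, BH_adjE, pathS_l, pathS_r).

Lemma pathS_ck : ck_family pathS.
Proof.
split.
- move=> x; apply: BH_ext => f w Vw; rewrite !pathE; apply: functional_eq.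
  apply/funext => g; have [h|h] := pselect (srcQ x g); last by rewrite !(pullb_out _ _ h).
  have [c e] := (path_bij x).2 g h.
  by rewrite (pullb_in _ _ h) TT' asboolT // (pullb_in _ _ h).
- split=> [v|u v uv].
    split; apply: BH_ext => f w Vw; rewrite !pathE; apply: functional_eq; last exact: T_id.
    by rewrite !T'_id; apply/funext => g; case: asboolP.
  apply: BH_ext => f w Vw; rewrite !pathE; transitivity (f (exist _ 0 (fsupp0 R _))); last by rewrite functional0.
  apply: functional_eq; rewrite !T'_id; apply/funext => g /=.
  by case: asboolP => // gv; case: asboolP => // gu; case: uv; rewrite -gv -gu.
- move=> x y xy; apply: BH_ext => f w Vw; rewrite !pathE; apply: functional_eq; exact: T'_comp.
- by move=> x; apply: BH_ext => f w Vw; rewrite !pathE; apply: functional_eq; exact: T'T.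
- move=> v n; have fin := (hr n v).2; apply: BH_ext => f w Vw.
  rewrite fsbig_finite //=; set r := fset_set _.
  have VV x : fsupp (T x (T' x w)).
    by apply: (fsupp_pullb (path_bij x)); apply: (fsupp_pullb (part_bij_sym (path_bij x))).
  have -> : (\sum_(x <- r) pathS x ** (pathS x)^#) (inl f) (exist _ w Vw) =
      \sum_(x <- r) f (exist _ _ (VV x)).
    elim: (enum_fset r) => [|x l IH]; first by rewrite !big_nil.
    rewrite !big_cons -IH; exact: (congr2 +%R (functional_eq f _ _ (erefl _)) (erefl _)).
  have Vs : fsupp (\sum_(x <- r) T x (T' x w)).
    by elim/big_ind: _ => //; [exact: fsupp0 | exact: fsuppD].
  rewrite -(functional_sum f VV Vs); apply: (etrans (pathS_l (kg_id v) f Vw)); apply: functional_eq.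
  rewrite T'_id; apply/funext => g; rewrite fct_sumE.
  under eq_bigr do rewrite TT'.
  (* An infinite path with range v has exactly one initial segment of degree n, so one summand
     survives; with another range none does. *)
  case: asboolP => gv.
    have gr : g n \in r by rewrite in_fset_set //; apply/mem_set; rewrite /= op_d op_rE.
    rewrite (bigD1_seq (g n)) ?fset_uniq //= asboolT; last by rewrite /cylP /= op_d.
    rewrite big_seq_cond big1 ?addr0 // => x /andP[]; rewrite in_fset_set // => /set_mem[dx rx] xg.
    by rewrite asboolF // /cylP /= dx => E; rewrite E eqxx in xg.
  rewrite big_seq big1 // => x; rewrite in_fset_set // => /set_mem[dx rx].
  by rewrite asboolF // /cylP /= dx => E; apply: gv; rewrite -rx -E op_rE.
Qed.

Lemma pathS_neq0 (f : opath L) : pathS (kg_id (op_r f)) <> 0.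
Proof.
pose d : opath L -> C := fun g => (g == f)%:R.
have fd x : d x != 0 -> x \in [fset f]%fset by rewrite /d inE; case: (x == f) => //=; rewrite eqxx.
have Vd : fsupp d.
  apply: (sub_finite_set (B := [set` [fset f]%fset])) => [x /fd //|]; exact: finite_fset.
move=> S0; have := congr1 (fun a : BH H => a (inl (@vec R (l2pre R (opath L)) d Vd)) (exist _ d Vd)) S0.
rewrite pathS_l /= /vfun /= T'_id; rewrite (fipE _ fd) big_seq_fset1 asboolT // /d eqxx conjC1 mul1r.
by move=> /eqP; rewrite oner_eq0.
Qed.

End PathRepresentation.

Lemma kgraph_core_simple_AF (R : realType) (k : nat) (L : kgraph k)
    (hL : inhabited (kg_obj L)) (hprim : primitive L)
    (hr : surjective_finite_to_one (@kg_r k L)) (hs : surjective_finite_to_one (@kg_s k L))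
    (A : cstar R) (s : L -> A) (al : ('I_k -> complex R) -> A -> A) :
  is_kgraph_algebra s -> is_gauge_action s al -> simple_AF_algebra (fixed_points al).
Proof.
move=> [ck gen univ] gauge; rewrite (fixed_points_core hL hprim hr ck gen gauge).
apply: (ck_core_simple_AF hL hprim hr ck).
have [b _] := bipath_exists hr hs hL.
exists (op_r (future b)) => s0.
have [f [_ fZ _ _] fT] := univ _ _ (@pathS_ck k L R hr).
apply: (@pathS_neq0 k L R (future b)); rewrite -fT s0.
by have := fZ 0 0; rewrite !scale0r.
Qed.

(** * The stable groupoid *)

Section GsTopology.
Variables (k : nat) (L : kgraph k).
Implicit Types (x y z : bipath L) (m n : Zk k) (g h : Gs L).
Local Notation cz := (@cz k).
Local Notation cst := (@cst k).

Lemma bp_cast x m n m' n' (h : lez m n) (h' : lez m' n') : m = m' -> n = n' -> bp x h = bp x h'.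
Proof. by move=> E E'; subst m' n'; exact: bp_irr. Qed.

Definition agN N x y := agree_from (cz N) x y.

Lemma agN_le N M x y : (N <= M)%N -> agN N x y -> agN M x y.
Proof. by move=> NM; apply: agree_from_le; exact: lez_czS. Qed.

(** Within G_{s,M}, agreement from N is visible in the finite piece x(N, M), hence in windows of
    level M. *)
Lemma agN_mid N M x y (NM : (N <= M)%N) :
  agN N x y <-> agN M x y /\ bp x (lez_czS k NM) = bp y (lez_czS k NM).
Proof.
split=> [h|[h E] n hn]; first by split; [exact: agN_le h | exact: h].
have [M1 [M1M nM]] : exists M1, (M <= M1)%N /\ lez n (cz M1).
  exists (maxn M (bnd (cz N) n)); rewrite leq_maxl; split=> //.
  by apply: lez_trans (bnd_cz (cz N) n).2 (lez_czS _ (leq_maxr _ _)).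
have h1 : lez (cz N) (cz M1) by exact/lez_czS/(leq_trans NM).
have E1 : bp x h1 = bp y h1.
  rewrite (bp_irr x h1 (lez_trans (lez_czS k NM) (lez_czS k M1M))).
  rewrite (bp_irr y h1 (lez_trans (lez_czS k NM) (lez_czS k M1M))) !bp_comp E; congr kg_comp; exact: h.
move: E1; rewrite (bp_irr x h1 (lez_trans hn nM)) (bp_irr y h1 (lez_trans hn nM)) !bp_comp.
by move=> /comp_inj[]; rewrite ?bp_s ?bp_r ?kg_d_bp.
Qed.

(** The piece x(N, M) lies in the window of level M, so agreement from N passes to pairs with the
    same windows. This nests the cells and makes G_{s,N} closed. *)
Lemma agN_win N M x y x' y' : (N <= M)%N -> win M x' = win M x -> win M y' = win M y ->
  agN N x y -> agN M x' y' -> agN N x' y'.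
Proof.
move=> NM ex ey /(agN_mid x y NM)[_ E] h; apply/(agN_mid x' y' NM); split=> //.
have l1 : lez (- cz M) (cz N) by apply: lez_trans (lez_czN _ NM) (lez_cz k N).
by rewrite (win_eq _ l1 (lezz _) ex) (win_eq _ l1 (lezz _) ey).
Qed.

Lemma stable_agN x y : stable x y <-> exists N, agN N x y.
Proof.
split=> [[m xy]|[N xy]]; last by exists (cz N).
by exists (bnd m m); apply: agree_from_le xy; exact: (bnd_cz m m).2.
Qed.

Lemma cylinder_open a n : open (@cylinder k L a n).
Proof.
exists [set cylinder a n]; last by rewrite bigcup_set1.
move=> _ ->; exists [fset cylinder a n]%fset; first by move=> U; rewrite !inE => /eqP ->; apply/mem_set; exists a, n.
by rewrite predeqE => y; split=> [h|yc U /=]; [apply: (h (cylinder a n)); rewrite /= inE | rewrite inE => /eqP ->].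
Qed.

Lemma win_open N x : open [set y | win N y = win N x].
Proof.
rewrite (_ : [set y | _] = cylinder (win N x) (- cz N)); first exact: cylinder_open.
apply/seteqP; split=> y; rewrite /cylinder /= /win.
  move=> <-; apply: bp_cast => //; apply/ffunP => i; rewrite !ffunE kg_d_bp !ffunE; lia.
move=> E; rewrite -[RHS]E; apply: bp_cast => //; apply/ffunP => i; rewrite !ffunE kg_d_bp !ffunE; lia.
Qed.

Lemma bipath_openP (U : set (bipath L)) :
  open U <-> forall x, U x -> exists N, forall y, win N y = win N x -> U y.
Proof.
split=> [[D sD <-] x [B DB Bx]|hU].
  have [F sF BE] := sD B DB; rewrite -BE in Bx.
  have /choice[f fP] : forall V : set (bipath L), exists N, forall y, V \in F -> win N y = win N x -> V y.
    move=> V; have [VF|VF] := boolP (V \in F); last by exists 0%N.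
    have [a [n VE]] : exists a n, V = cylinder a n by have /set_mem := sF V VF.
    exists (bnd n (n + toZ (kg_d a))) => y _ xy; have := Bx V VF; rewrite VE /cylinder /= => E.
    have [b1 b2] := bnd_cz n (n + toZ (kg_d a)); rewrite -[RHS]E; exact: win_eq b1 b2 xy.
  exists (\max_(V <- F) f V) => y xy; suff By : B y by exists B.
  rewrite -BE => V VF; apply: (fP V y VF); apply: win_mono xy; exact: leq_bigmax_seq.
rewrite (_ : U = \bigcup_(p in [set p : nat * bipath L | forall y, win p.1 y = win p.1 p.2 -> U y])
   [set y | win p.1 y = win p.1 p.2]).
  by apply: bigcup_open => -[N x] _; exact: win_open.
by apply/seteqP; split=> [x /hU[N NP]|x [[N y] /= h /h //]]; exists (N, x).
Qed.

Lemma nbhs_win x (U : set (bipath L)) : nbhs x U <-> exists N, forall y, win N y = win N x -> U y.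
Proof.
split=> [|[N NU]].
  rewrite nbhsE => -[B [/bipath_openP oB Bx] BU]; have [N NP] := oB x Bx.
  by exists N => y /NP /BU.
by rewrite nbhsE; exists [set y | win N y = win N x]; [split=> //; exact: win_open|].
Qed.

(* A basis of neighbourhoods of g, as N runs over the levels at which g is an agreeing pair. *)
Definition cellG N g : set (Gs L) := [set h |
  [/\ win N (sval h).1 = win N (sval g).1, win N (sval h).2 = win N (sval g).2 &
      agN N (sval h).1 (sval h).2]].

Definition inG N g := agN N (sval g).1 (sval g).2.

Lemma inG_ex g : exists N, inG N g.
Proof. by have /stable_agN := svalP g. Qed.

Lemma cellG_mono N M g h : (N <= M)%N -> inG N g -> cellG M g h -> cellG N g h.
Proof.
move=> NM gN [e1 e2 hM]; split; [exact: win_mono NM e1 | exact: win_mono NM e2 |].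
exact: agN_win NM e1 e2 gN hM.
Qed.

Lemma Gs_openP (U : set (Gs L)) :
  open U <-> forall g, U g -> exists2 N, inG N g & cellG N g `<=` U.
Proof.
rewrite (_ : open U = Gs_open U) //; split=> [oU g Ug|hU m].
  have [N0 gN] := inG_ex g; have [V oV UV] := oU (cz N0).
  have : nbhs (sval g) V by apply: open_nbhs_nbhs; split=> //; apply/UV.
  move=> [[A B] [/= /nbhs_win[N1 N1A] /nbhs_win[N2 N2B]] AB].
  set N := maxn N0 (maxn N1 N2); have N0N : (N0 <= N)%N by exact: leq_maxl.
  exists N; first exact: agN_le gN.
  move=> h ch; have [e1 e2 _] := ch; have [_ _ hN0] := cellG_mono N0N gN ch.
  apply/UV => //; apply: AB; split=> /=.
    by apply: N1A; apply: win_mono e1; rewrite /N !leq_max leqnn orbT.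
  by apply: N2B; apply: win_mono e2; rewrite /N !leq_max leqnn !orbT.
(* The level is also taken beyond m: a pair that agrees from m then satisfies the agreement
   condition of the cell, and the window conditions alone define V. *)
have /choice[f fP] : forall g, exists N, U g -> [/\ inG N g, lez m (cz N) & cellG N g `<=` U].
  move=> g; have [Ug|] := pselect (U g); last by exists 0%N.
  have [N gN NU] := hU g Ug; exists (maxn N (bnd m m)) => _.
  have NM : (N <= maxn N (bnd m m))%N by exact: leq_maxl.
  split; [exact: agN_le gN| |by move=> h /(cellG_mono NM gN)/NU].
  exact: lez_trans (bnd_cz m m).2 (lez_czS _ (leq_maxr _ _)).
exists (\bigcup_(g in U) ([set x | win (f g) x = win (f g) (sval g).1] `*` [set y | win (f g) y = win (f g) (sval g).2])).
  apply: bigcup_open => g _; rewrite openE => -[x y] [/= e1 e2].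
  exists ([set x | win (f g) x = win (f g) (sval g).1], [set y | win (f g) y = win (f g) (sval g).2]) => //.
  by split; apply: open_nbhs_nbhs; split=> //; exact: win_open.
move=> h hm; split=> [Uh|[g Ug [/= e1 e2]]]; first by exists h.
have [gN mN] := fP g Ug; apply; split=> //; exact: agree_from_le hm.
Qed.

Lemma cellG_open N g : open (cellG N g).
Proof.
apply/Gs_openP => h [e1 e2 hN]; exists N => // h' [e1' e2' hN'].
by split; rewrite ?e1' ?e2'.
Qed.

Lemma nbhs_cellG N g : inG N g -> nbhs g (cellG N g).
Proof. by move=> gN; apply: open_nbhs_nbhs; split; [exact: cellG_open | split]. Qed.

Lemma nbhs_Gs g (U : set (Gs L)) : nbhs g U -> exists2 N, inG N g & cellG N g `<=` U.
Proof.
rewrite nbhsE => -[B [/Gs_openP oB Bg] BU]; have [N gN NB] := oB g Bg.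
by exists N => // h /NB /BU.
Qed.

Section CellCompact.
Hypothesis hL : inhabited (kg_obj L).
Hypothesis hprim : primitive L.
Hypothesis hr : surjective_finite_to_one (@kg_r k L).

Lemma ultra_win (F : set_system (Gs L)) (u : Gs L -> bipath L) : UltraFilter F ->
  forall M, exists a : L, F [set g | win M (u g) = a].
Proof.
move=> UF M; apply: contrapT => no; have fin := finite_deg hL hprim hr (cst (M + M)).
have : F (\bigcap_(a in [set` fset_set [set x : L | kg_d x = cst (M + M)]]) ~` [set g | win M (u g) = a]).
  apply: filter_bigI => a _; have [|//] := @in_ultra_setVsetC _ F [set g | win M (u g) = a] UF.
  by move=> Fa; case: no; exists a.
move=> /filter_ex[g /(_ (win M (u g)))]; apply => //=.
by rewrite in_fset_set //; apply/mem_set; exact: kg_d_win.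
Qed.

(** At each level an ultrafilter selects one of the finitely many windows of either coordinate.
    These glue to paths x and y, which agree from N because each piece beyond N is seen in some
    window. *)
Lemma inG_compact N : compact [set g | inG N g].
Proof.
rewrite compact_ultra => F UF Fc.
have [a aF] := choice (ultra_win (fun h => (sval h).1) UF).
have [b bF] := choice (ultra_win (fun h => (sval h).2) UF).
have d1 (u : Gs L -> bipath L) c : (forall M, F [set h | win M (u h) = c M]) ->
    (forall M, kg_d (c M) = cst (M + M)) /\ forall M, seg (c M.+1) (cst 1) (c M).
  move=> cF; split=> M; first by have [h <-] := filter_ex (cF M); exact: kg_d_win.
  have [h [<- <-]] := filter_ex (filterI (cF M.+1) (cF M)).
  by have := seg_win (u h) (leqnSn M); rewrite subSn // subnn.
have [da sa] := d1 _ a aF; have [db sb] := d1 _ b bF.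
set x := glue da sa; set y := glue db sb.
have near M : F [set h | [/\ win M (sval h).1 = win M x, win M (sval h).2 = win M y & inG N h]].
  by apply: filterS (filterI (filterI (aF M) (bF M)) Fc) => h [[]]; rewrite !win_glue.
have xy : agN N x y.
  move=> n hn; have [b1 b2] := bnd_cz (cz N) n.
  have [h [e1 e2 hN]] := filter_ex (near (bnd (cz N) n)).
  by rewrite -(win_eq hn b1 b2 e1) -(win_eq hn b1 b2 e2); exact: hN.
have st : stable x y by apply/stable_agN; exists N.
exists (exist (fun xy => stable xy.1 xy.2) (x, y) st); split => //.
move=> U /nbhs_Gs[M hM MU]; apply: filterS (near (maxn N M)) => h [e1 e2 hN]; apply: MU.
apply: (cellG_mono (leq_maxr N M) hM); split=> //.
exact: agN_le (leq_maxl _ _) hN.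
Qed.

(** If g is outside G_{s,N}, so is by [agN_win] every pair in the cell of g at a higher level at
    which g agrees. *)
Lemma inG_closed N : closed [set g : Gs L | inG N g].
Proof.
rewrite -openC; apply/Gs_openP => g /= gN; have [M gM] := inG_ex g.
exists (maxn N M); first exact: agN_le (leq_maxr _ _) gM.
move=> h [e1 e2 _] hN; apply: gN; apply: (agN_win (leq_maxl N M) (esym e1) (esym e2) hN).
exact: agN_le (leq_maxr _ _) gM.
Qed.

End CellCompact.

End GsTopology.

(** * Functions constant on cells and their density in C_c(G_s) *)

Section LevelFunctions.
Variables (k : nat) (L : kgraph k) (R : realType).
Local Notation C := (complex R).
Implicit Types (x y z : bipath L) (g h : Gs L) (c d : L -> L -> C).
Local Notation cst := (@cst k).
Local Notation cz := (@cz k).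

Definition Ef N c : Gs L -> C := fun g =>
  if `[< inG N g >] then c (win N (sval g).1) (win N (sval g).2) else 0.

Definition lev2 N c x y : C := if `[< agN N x y >] then c (win N x) (win N y) else 0.

Lemma ev_Ef N c x y : ev (Ef N c) x y = lev2 N c x y.
Proof.
rewrite /ev /lev2; case: pselect => // h.
by rewrite asboolF // => xy; apply: h; apply/stable_agN; exists N.
Qed.

(** On l = x(-M, M) these recover x(-N, N) and x(N, M). *)
Definition mid N M (l : L) : L := sub l (cst (M - N)) (cst (N + N)).
Definition tl N M (l : L) : L := sub l (cst (M + N)) (cst (M - N)).

Lemma mid_win N M x : (N <= M)%N -> mid N M (win M x) = win N x.
Proof. by move=> NM; have := subE (seg_win x NM); rewrite kg_d_win. Qed.

Lemma tl_win N M x (NM : (N <= M)%N) : tl N M (win M x) = bp x (lez_czS k NM).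
Proof.
have l1 : lez (- cz M) (cz N) by apply: lez_trans (lez_czN _ NM) (lez_cz k N).
have := subE (bp_seg x (lez_cz k M) l1 (lez_czS k NM) (lezz _)); rewrite kg_d_bp => <-.
by rewrite /tl /win; congr sub; apply/ffunP => i; rewrite !ffunE; lia.
Qed.

Lemma agN_tl N M x y : (N <= M)%N ->
  agN N x y <-> agN M x y /\ tl N M (win M x) = tl N M (win M y).
Proof. by move=> NM; rewrite !(tl_win _ NM); exact: agN_mid. Qed.

(** The inclusion of level N in level M on coefficients: an entry is repeated for every pair of
    windows with a common tail. *)
Definition raise2 N M c l l' : C := if tl N M l == tl N M l' then c (mid N M l) (mid N M l') else 0.

Lemma lev2_raise N M c x y : (N <= M)%N -> lev2 N c x y = lev2 M (raise2 N M c) x y.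
Proof.
move=> NM; rewrite /lev2 /raise2 !mid_win //.
have := agN_tl x y NM; case: asboolP => [h|h] [h1 h2].
  by have [h3 h4] := h1 h; rewrite asboolT // h4 eqxx.
by case: asboolP => // h3; case: eqP => // h4; case: h; apply: h2.
Qed.

Lemma EfE N c g : Ef N c g = lev2 N c (sval g).1 (sval g).2.
Proof. by []. Qed.

Lemma Ef_raise N M c : (N <= M)%N -> Ef N c = Ef M (raise2 N M c).
Proof. by move=> NM; apply/funext => g; rewrite !EfE (lev2_raise _ _ _ NM). Qed.

Lemma Ef_neq0 N c g : Ef N c g != 0 -> inG N g.
Proof. by rewrite /Ef; case: asboolP => //; rewrite eqxx. Qed.

Lemma Ef_cell N c g h : inG N g -> cellG N g h -> Ef N c h = Ef N c g.
Proof. by move=> gN [e1 e2 hN]; rewrite /Ef !asboolT // e1 e2. Qed.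

Hypothesis hL : inhabited (kg_obj L).
Hypothesis hprim : primitive L.
Hypothesis hr : surjective_finite_to_one (@kg_r k L).

Lemma Ef_Cc N c : Cc (Ef N c).
Proof.
split.
  move=> g U /= nU; have [M gM] := inG_ex g.
  have gM' := agN_le (leq_maxr N M) gM.
  apply: filterS (nbhs_cellG gM') => h ch /=.
  rewrite (Ef_raise _ (leq_maxl N M)) (Ef_cell _ gM' ch) -Ef_raise ?leq_maxl //.
  exact: (nbhs_singleton nU).
refine (subclosed_compact _ (@inG_compact k L hL hprim hr N) _); first exact: closed_closure.
rewrite [X in _ `<=` X](closure_id _).1; last exact: inG_closed.
apply: closure_subset => g; exact: Ef_neq0.
Qed.

Section Approximation.
Variable f : Gs L -> C.
Hypothesis fCc : Cc f.

(** The support is compact and the sets G_{s,N} form an increasing open cover. *)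
Lemma Cc_supp : exists N, forall g, f g != 0 -> inG N g.
Proof.
have [_ /compact_near_coveringP K] := fCc.
have [x Kx|N _ NP] := K nat \oo (fun N g => inG N g) _.
  have [N xN] := inG_ex x; exists (cellG N x, [set i | (N <= i)%N]) => /=.
    by split; [exact: nbhs_cellG | exists N].
  by move=> [g i] /= [[_ _ gN] Ni]; exact: agN_le gN.
by exists N => g fg; apply: (NP N (leqnn N)); apply: subset_closure.
Qed.

Lemma Cc_unif (e : R) : 0 < e -> exists N0, forall N, (N0 <= N)%N ->
  forall g h, inG N g -> cellG N g h -> nm (f g - f h) <= e.
Proof.
move=> e0; have e2 : 0 < e / 2 by lra.
have [cf /compact_near_coveringP K] := fCc.
have [x Kx|N0 _ NP] := K nat \oo (fun N g => forall h, cellG N g h -> nm (f g - f h) <= e) _.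
  have : nbhs x (f @^-1` [set w : C^o | nm (f x - w) < e / 2]).
    by apply: (cf x); apply/(@nbhsC R C^o); exists (e / 2).
  move=> /nbhs_Gs[N xN Nc]; exists (cellG N x, [set i | (N <= i)%N]) => /=.
    by split; [exact: nbhs_cellG | exists N].
  move=> [g i] /= [cg Ni] h ch; have [_ _ gN] := cg.
  have ch' := cellG_mono Ni gN ch.
  have cxh : cellG N x h.
    by case: cg ch' => a1 a2 a3 [b1 b2 b3]; split; rewrite ?b1 ?b2 ?a1 ?a2.
  have := Nc _ cg; have := Nc _ cxh => /= h1 h2.
  have := nm_tri (f g) (f x) (f h); rewrite (nmB (f g) (f x)); lra.
exists N0 => N /NP KP g h gN ch.
have [gK|gK] := pselect (closure [set g | f g != 0] g); first exact: (KP g gK).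
have fg : f g = 0 by apply/eqP; apply: contrapT => /negP fg; apply: gK; exact: subset_closure.
(* When only h lies in the support, g and h exchange their roles. *)
have [hK|hK] := pselect (closure [set g | f g != 0] h).
  by rewrite nmB; apply: (KP h hK); case: ch => a1 a2 a3; split.
have -> : f h = 0 by apply/eqP; apply: contrapT => /negP fh; apply: hK; exact: subset_closure.
by rewrite fg subrr nm0 ltW.
Qed.

(** c samples f once in each cell. N may be large, but the support stays in G_{s,N0}; this turns
    uniform estimates into I-norm estimates. *)
Lemma Cc_approx N0 (e : R) : (forall g, f g != 0 -> inG N0 g) -> 0 < e ->
  exists N c, [/\ (N0 <= N)%N, forall g, nm (f g - Ef N c g) <= e & forall g, Ef N c g != 0 -> inG N0 g].
Proof.
move=> fN0 e0; have [N1 NP] := Cc_unif e0; set N := maxn N0 N1.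
have /choice[r rP] : forall ll : L * L, exists v : C, (exists g, [/\ inG N g,
    win N (sval g).1 = ll.1, win N (sval g).2 = ll.2 & v = f g]) \/
    (v = 0 /\ forall g, inG N g -> win N (sval g).1 = ll.1 -> win N (sval g).2 = ll.2 -> False).
  move=> ll; have [[g [gN g1 g2]]|no] := pselect (exists g, [/\ inG N g,
    win N (sval g).1 = ll.1 & win N (sval g).2 = ll.2]).
    by exists (f g); left; exists g.
  by exists 0; right; split=> // g gN g1 g2; apply: no; exists g.
exists N, (fun l l' => r (l, l')); split; first exact: leq_maxl.
  move=> g; rewrite /Ef; case: asboolP => gN; last first.
    have -> : f g = 0.
      by apply/eqP; apply: contrapT => /negP/fN0 g0; apply: gN; exact: agN_le (leq_maxl _ _) g0.
    by rewrite subrr nm0 ltW.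
  have [[g' [g'N e1 e2 ->]]|[_ /(_ g gN erefl erefl)//]] := rP (win N (sval g).1, win N (sval g).2).
  by apply: (NP N (leq_maxr _ _)).
move=> g; rewrite /Ef; case: asboolP => [gN|]; last by rewrite eqxx.
have [[g' [g'N e1 e2 ->]]|[-> _]] := rP (win N (sval g).1, win N (sval g).2); last by rewrite eqxx.
by move=> /fN0 g'0; exact: agN_win (leq_maxl _ _) (esym e1) (esym e2) g'0 gN.
Qed.

End Approximation.

End LevelFunctions.

(** * Integrals of finite combinations of indicators *)

Section SimpleIntegral.
Context (d : measure_display) (T : measurableType d) (R : realType) (mu : {measure set T -> \bar R}).

Lemma indic_integrable (B : set T) (v : R) : measurable B -> mu B = v%:E ->
  mu.-integrable setT (EFin \o (\1_B : T -> R)) /\ (\int[mu]_z ((\1_B : T -> R) z)%:E)%E = v%:E.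
Proof.
move=> mB Bv; have E : (\int[mu]_z ((\1_B : T -> R) z)%:E)%E = v%:E.
  by rewrite integral_indic // setIT.
split=> //; apply/integrableP; split.
  by apply/measurable_EFinP; exact: measurable_indic.
rewrite (eq_integral (fun z => ((\1_B : T -> R) z)%:E)) ?E ?ltry // => z _.
by rewrite /= ger0_norm // indicE; case: (_ \in _).
Qed.

Lemma simple_integral (I : Type) (r : seq I) (B : I -> set T) (v a : I -> R) :
  (forall i, measurable (B i) /\ mu (B i) = (v i)%:E) ->
  mu.-integrable setT (fun z => (\sum_(i <- r) a i * (\1_(B i) : T -> R) z)%:E) /\
  (\int[mu]_z (\sum_(i <- r) a i * (\1_(B i) : T -> R) z)%:E)%E = (\sum_(i <- r) a i * v i)%:E.
Proof.
move=> BP; elim: r => [|i r [IH1 IH2]].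
  split; last by rewrite big_nil; under eq_integral do rewrite big_nil; rewrite integral0.
  by under eq_fun do rewrite big_nil; exact: integrable0.
have [mB Bv] := BP i; have [i1 e1] := indic_integrable mB Bv.
have i2 : mu.-integrable setT (fun z => ((a i)%:E * ((\1_(B i) : T -> R) z)%:E)%E) by exact: integrableZl.
split.
  under eq_fun do rewrite big_cons EFinD EFinM.
  exact: integrableD.
under eq_integral do rewrite big_cons EFinD EFinM.
by rewrite integralD // integralZl // e1 IH2 big_cons EFinD EFinM.
Qed.

Lemma measurable_uniform_limit (f : T -> R) :
  (forall e : R, 0 < e -> exists2 g : T -> R, measurable_fun setT g & forall z, `|f z - g z| <= e) ->
  measurable_fun setT f.
Proof.
move=> h; have /choice[g gP] : forall n : nat, exists g : T -> R,
    measurable_fun setT g /\ forall z, `|f z - g z| <= n.+1%:R^-1.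
  by move=> n; have [|g mg gf] := h n.+1%:R^-1; [rewrite invr_gt0 | exists g].
apply: (@measurable_fun_cvg _ T R setT g) => [n|z _]; first by have [] := gP n.
apply/cvgrPdist_le => e e0; near=> n; apply: le_trans ((gP n).2 z) _.
by apply/ltW; near: n; exact: near_infty_natSinv_lt (PosNum e0).
Unshelve. all: by end_near. Qed.

End SimpleIntegral.

(** * The Haar system on cells, and integrals of uniform limits *)

Section HaarMeasure.
Variables (k : nat) (L : kgraph k) (R : realType).
Local Notation C := (complex R).
Implicit Types (x y z : bipath L) (c : L -> C).
Local Notation cst := (@cst k).
Local Notation cz := (@cz k).
Hypothesis hL : inhabited (kg_obj L).
Hypothesis hprim : primitive L.
Hypothesis hr : surjective_finite_to_one (@kg_r k L).
Variables (t : 'I_k -> R) (a : kg_obj L -> R).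
Variable mut : forall x : bipath L, {measure set (borel_at x) -> \bar R}.
Hypothesis t_gt0 : forall i, 0 < t i.
Hypothesis a_gt0 : forall v, 0 < a v.
Hypothesis haar : stable_haar_system t a mut.

Lemma open_measurable_at x (U : set (bipath L)) : open U -> measurable (U : set (borel_at x)).
Proof. by move=> oU; exact: sub_sigma_algebra. Qed.

Lemma measurable_bp x m n (h : lez m n) (l : L) :
  measurable ([set z | bp z h = l] : set (borel_at x)).
Proof.
apply: open_measurable_at; apply/bipath_openP => z zl; exists (bnd m n) => y yz.
by have [b1 b2] := bnd_cz m n; rewrite -zl; exact: win_eq b1 b2 yz.
Qed.

Lemma measurable_agN x N : measurable ([set z | agN N x z] : set (borel_at x)).
Proof.
rewrite (_ : [set z | _] = \bigcap_j [set z | bp z (lez_czS k (leq_addr j N)) = bp x (lez_czS k (leq_addr j N))]).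
  by apply: bigcapT_measurable => j; exact: measurable_bp.
apply/seteqP; split=> z /= h; first by move=> j _ /=; rewrite h.
move=> n hn; have [_ b2] := bnd_cz (cz N) n; set j := bnd _ _ in b2.
have nM : lez n (cz (N + j)) by apply: lez_trans b2 (lez_czS _ (leq_addl _ _)).
have /= := h j I; rewrite (bp_irr z _ (lez_trans hn nM)) (bp_irr x _ (lez_trans hn nM)) !bp_comp.
by move=> /comp_inj[]; rewrite ?bp_s ?bp_r ?kg_d_bp.
Qed.

Definition cellS N x (l : L) : set (bipath L) := [set z | agN N x z /\ win N z = l].

Lemma measurable_cellS x N l : measurable (cellS N x l : set (borel_at x)).
Proof. by apply: measurableI; [exact: measurable_agN | exact: measurable_bp]. Qed.

Definition wt N (l : L) : R := (mpow t (cst N))^-1 * a (kg_r l).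

Lemma mpow_gt0 (p : Nk k) : 0 < mpow t p.
Proof. by apply: prodr_gt0 => i _; rewrite exprn_gt0. Qed.

Lemma wt_gt0 N l : 0 < wt N l.
Proof. by rewrite mulr_gt0 ?invr_gt0 ?mpow_gt0. Qed.

Lemma path_shiftK p z : path_shift p (path_shift (- p) z) = z.
Proof.
apply: bipath_ext => m n h; rewrite /path_shift /= /shift_bp /= /shift_bp.
by apply: bp_cast; rewrite addrK.
Qed.

(** The shift by (N, ..., N) turns the cell into a cylinder of degree (2N, ..., 2N) in the local
    stable set, which gives t^N t^(-2N) a(r(l)). *)
Lemma mut_cellS N x l : kg_d l = cst (N + N) -> kg_s l = bp_obj x (cz N) ->
  mut x (cellS N x l) = (wt N l)%:E.
Proof.
move=> dl sl; have [mu lm /(_ x)[_ mutP]] := haar.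
have pE : toZ (cst N) = cz N by apply/ffunP => i; rewrite !ffunE.
have toE z : agN N x z -> local_stable_set (path_shift (toZ (cst N)) x) (path_shift (toZ (cst N)) z).
  move=> xz m n h m0; rewrite /= /shift_bp; apply/esym.
  apply: (agree_from_le _ xz); rewrite -pE; have := lez_add (toZ (cst N)) m0.
  by rewrite add0r.
rewrite (mutP (cst N)); [| exact: measurable_cellS |]; last by move=> z [xz _]; exact: toE.
have -> : path_shift (toZ (cst N)) @` cellS N x l =
   local_stable_set (path_shift (toZ (cst N)) x) `&` cylinder l (- toZ (kg_d l)).
  have winE z : bp (path_shift (toZ (cst N)) z) (lez_addN (- toZ (kg_d l)) (kg_d l)) = win N z.
    rewrite /= /shift_bp; apply: bp_cast; rewrite dl; apply/ffunP => i; rewrite !ffunE.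
      by rewrite PoszD opprD subrK.
    by rewrite addNr add0r.
  apply/seteqP; split=> [_ [z [xz zl] <-]|z' [E c]]; first by split; [exact: toE | exact: etrans (winE z) zl].
  exists (path_shift (- toZ (cst N)) z'); last exact: path_shiftK.
  split; last by rewrite -winE path_shiftK.
  move=> n hn; have hn' : lez 0 (n - toZ (cst N)).
    by have := lez_add (- toZ (cst N)) hn; rewrite pE subrr.
  have h1 : lez (cz N - toZ (cst N)) (n - toZ (cst N)) by exact: lez_add.
  have h2 : lez 0 (cz N - toZ (cst N)) by rewrite pE subrr lezz.
  rewrite /= /shift_bp (bp_irr z' _ h1) E //= /shift_bp; apply: bp_cast; by rewrite subrK.
have [_ ->] := lm (path_shift (toZ (cst N)) x).
  rewrite dl -EFinM; congr (_%:E); rewrite /wt mulrA; congr (_ * _).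
  have -> : mpow t (cst (N + N)) = mpow t (cst N) * mpow t (cst N).
    by rewrite /mpow -big_split; apply: eq_bigr => i _; rewrite !ffunE exprD.
  by rewrite invfM mulrA divff ?mul1r // gt_eqF ?mpow_gt0.
by rewrite sl /= add0r pE.
Qed.

Definition lev N x c z : C := if `[< agN N x z >] then c (win N z) else 0.

Definition blk N v : seq (pathT L (cst (N + N))) := [seq i <- index_enum _ | kg_s (pv i) == v].

Lemma sum_blk (V : nmodType) N v (F : pathT L (cst (N + N)) -> V) :
  \sum_(i | kg_s (pv i) == v) F i = \sum_(i <- blk N v) F i.
Proof. by rewrite big_filter. Qed.

Definition isum N v c : C := \sum_(i <- blk N v) (wt N (pv i))%:C%C * c (pv i).

Lemma win_pathT N z : exists i : pathT L (cst (N + N)), pv i = win N z.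
Proof. by apply: (pathT_ex hL hprim hr); exact: kg_d_win. Qed.

Lemma agN_src N x z : agN N x z -> kg_s (win N z) = bp_obj x (cz N).
Proof. by move=> /(_ _ (lezz _)) h; rewrite bp_s -(bp_r z (lezz (cz N))) -h bp_r. Qed.

(** psi will be the real part, the imaginary part or the norm; psi 0 = 0 keeps the values off the
    cells equal to 0. *)
Lemma lev_simple N x c (psi : C -> R) z : psi 0 = 0 ->
  psi (lev N x c z) = \sum_(i <- blk N (bp_obj x (cz N))) psi (c (pv i)) * (\1_(cellS N x (pv i)) z : R).
Proof.
move=> p0; rewrite /lev; case: asboolP => xz; last first.
  by rewrite p0 big1 // => i _; rewrite indicE memNset ?mulr0 // => -[].
have [i iE] := win_pathT N z.
have bi : i \in blk N (bp_obj x (cz N)) by rewrite mem_filter mem_index_enum andbT iE (agN_src xz) eqxx.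
rewrite (bigD1_seq i) ?filter_uniq ?index_enum_uniq //= indicE mem_set ?mulr1; last by split.
rewrite iE big1 ?addr0 // => j ji; rewrite indicE memNset ?mulr0 // => -[_ jE].
by case/eqP: ji; apply: pv_inj; rewrite -jE.
Qed.

Lemma lev_integral N x c (psi : C -> R) : psi 0 = 0 ->
  (mut x).-integrable setT (fun z => (psi (lev N x c z))%:E) /\
  (\int[mut x]_z (psi (lev N x c z))%:E)%E =
    (\sum_(i <- blk N (bp_obj x (cz N))) psi (c (pv i)) * wt N (pv i))%:E.
Proof.
move=> p0; set r := blk _ _.
(* [simple_integral] asks for the measure at every index, so windows with the wrong source get the
   empty set. *)
pose B (i : pathT L (cst (N + N))) : set (borel_at x) :=
  if kg_s (pv i) == bp_obj x (cz N) then cellS N x (pv i) else set0.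
pose v (i : pathT L (cst (N + N))) := if kg_s (pv i) == bp_obj x (cz N) then wt N (pv i) else 0.
have BP i : measurable (B i) /\ mut x (B i) = (v i)%:E.
  rewrite /B /v; case: eqP => h; last by rewrite measure0; split=> //; exact: measurable0.
  by split; [exact: measurable_cellS | apply: mut_cellS => //; exact: (pvP hL hprim hr)].
have [i1 i2] := simple_integral r (fun i => psi (c (pv i))) BP.
have E : (fun z => (psi (lev N x c z))%:E) = (fun z => (\sum_(i <- r) psi (c (pv i)) * (\1_(B i) z : R))%:E).
  apply/funext => z; rewrite lev_simple //; congr (_%:E); rewrite !big_filter.
  by apply: eq_bigr => i si; rewrite /B si.
rewrite E; split=> //; rewrite i2; congr (_%:E); rewrite !big_filter.
by apply: eq_bigr => i si; rewrite /v si.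
Qed.

Lemma Cintegral_lev N x c : Cintegral mut x (lev N x c) = isum N (bp_obj x (cz N)) c.
Proof.
have [_ e1] := @lev_integral N x c (@complex.Re R) erefl.
have [_ e2] := @lev_integral N x c (@complex.Im R) erefl.
rewrite /Cintegral /Rintegral e1 e2 /=; apply/eqP; rewrite eq_complex /= /isum.
have S (J : Type) (r : seq J) (F : J -> C) :
    complex.Re (\sum_(i <- r) F i) = \sum_(i <- r) complex.Re (F i) /\
    complex.Im (\sum_(i <- r) F i) = \sum_(i <- r) complex.Im (F i).
  elim: r => [|j r [IH1 IH2]]; rewrite ?big_nil // !big_cons -IH1 -IH2.
  by case: (F j) (\sum_(_ <- r) _) => ? ? [].
have [-> ->] := S _ (blk N (bp_obj x (cz N))) (fun i => (wt N (pv i))%:C%C * c (pv i)).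
by apply/andP; split; apply/eqP; apply: eq_bigr => i _; case: (c _) => u v /=; rewrite mulrC; ring.
Qed.

(** Bounds the measure of the paths that agree with x from N, uniformly in x. *)
Definition wtot N : R := \sum_(i : pathT L (cst (N + N))) wt N (pv i).

Lemma wtot_ge0 N : 0 <= wtot N.
Proof. by apply: sumr_ge0 => i _; exact/ltW/wt_gt0. Qed.

Lemma blk_le_wtot N v : \sum_(i <- blk N v) wt N (pv i) <= wtot N.
Proof.
rewrite -sum_blk /wtot [leRHS](bigID (fun i => kg_s (pv i) == v)) /= lerDl.
by apply: sumr_ge0 => i _; exact/ltW/wt_gt0.
Qed.

Lemma mut_agN N x (e : R) : 0 <= e ->
  (mut x).-integrable setT (fun z => (e * (\1_[set z | agN N x z] : bipath L -> R) z)%:E) /\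
  (\int[mut x]_z (e * (\1_[set z | agN N x z] : bipath L -> R) z)%:E <= (e * wtot N)%:E)%E.
Proof.
move=> e0; have [h1 h2] := @lev_integral N x (fun=> 1) (fun u => e * complex.Re u) (mulr0 e).
have E : (fun z => (e * complex.Re (lev N x (fun=> 1) z))%:E) = (fun z => (e * (\1_[set z | agN N x z] : bipath L -> R) z)%:E).
  apply/funext => z; rewrite /lev indicE; case: asboolP => xz; first by rewrite mem_set.
  by rewrite memNset.
rewrite -E; split=> //; rewrite h2 lee_fin.
under eq_bigr do rewrite /= mulr1; rewrite -mulr_sumr ler_wpM2l //; exact: blk_le_wtot.
Qed.

(** Rows and columns of functions in C_c, and products of the two, satisfy this; it gives
    measurability and domination by an indicator of finite integral. *)
Definition uapp N0 x (F : bipath L -> C) := (forall z, F z != 0 -> agN N0 x z) /\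
  forall e : R, 0 < e -> exists N c, (forall z, nm (F z - lev N x c z) <= e).

Definition lip (psi : C -> R) := psi 0 = 0 /\ forall u v, `|psi u - psi v| <= nm (u - v).

Lemma lip_Re : lip (@complex.Re R).
Proof. by split=> // u v; rewrite -raddfB; exact: Re_le_nm. Qed.
Lemma lip_Im : lip (@complex.Im R).
Proof. by split=> // u v; rewrite -raddfB; exact: Im_le_nm. Qed.
Lemma lip_nm : lip (@nm R C).
Proof.
split=> [|u v]; first exact: nm0.
have := nm_tri u v 0; have := nm_tri v u 0; rewrite !subr0 (nmB v u) ler_norml => h1 h2.
by apply/andP; split; lra.
Qed.

Lemma uapp_bounded N0 x F : uapp N0 x F -> exists2 K, 0 <= K & forall z, nm (F z) <= K.
Proof.
move=> [_ /(_ 1 ltr01)[N [c Fc]]].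
exists (1 + \sum_(i : pathT L (cst (N + N))) nm (c (pv i))).
  by rewrite addr_ge0 // sumr_ge0 // => i _; exact: nm_ge0.
move=> z; have := nm_tri (F z) (lev N x c z) 0; rewrite !subr0 => /le_trans; apply; apply: lerD => //.
rewrite /lev; case: asboolP => _; last by rewrite nm0 sumr_ge0 // => i _; exact: nm_ge0.
have [i <-] := win_pathT N z; rewrite (bigD1 i) //= lerDl sumr_ge0 // => j _; exact: nm_ge0.
Qed.

Lemma uapp_measurable N0 x F psi : lip psi -> uapp N0 x F ->
  measurable_fun setT (psi \o F : borel_at x -> R).
Proof.
move=> [p0 pl] [_ Fa]; apply: measurable_uniform_limit => e /Fa[N [c Fc]].
exists (psi \o lev N x c); last by move=> z; exact: le_trans (pl _ _) (Fc z).
have [/measurable_int h _] := @lev_integral N x c psi p0.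
by apply/measurable_EFinP.
Qed.

Lemma uapp_dom N0 x F psi K : lip psi -> uapp N0 x F -> (forall z, nm (F z) <= K) -> forall z,
  `|psi (F z)| <= K * (\1_[set z | agN N0 x z] : bipath L -> R) z.
Proof.
move=> [p0 pl] [Fs _] FK z; have := pl (F z) 0; rewrite p0 !subr0 indicE.
have [F0|/Fs xz] := eqVneq (F z) 0; last by rewrite mem_set // mulr1 => /le_trans; apply.
rewrite F0 nm0 => /le_trans; apply; rewrite mulr_ge0 //.
exact: le_trans (nm_ge0 _) (FK z).
Qed.

Lemma uapp_integrable N0 x F psi : lip psi -> uapp N0 x F ->
  (mut x).-integrable setT (EFin \o (psi \o F : borel_at x -> R)).
Proof.
move=> lp ua; have [K K0 FK] := uapp_bounded ua.
have [i1 _] := mut_agN N0 x K0.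
apply: (le_integrable measurableT _ _ i1).
  by apply/measurable_EFinP; exact: (uapp_measurable lp ua).
move=> z _ /=; rewrite lee_fin; apply: le_trans (uapp_dom lp ua FK z) _; exact: ler_norm.
Qed.

Lemma Cintegral_close N0 x F G (e : R) : 0 <= e -> uapp N0 x F -> uapp N0 x G ->
  (forall z, nm (F z - G z) <= e) -> nm (Cintegral mut x F - Cintegral mut x G) <= 2 * (e * wtot N0).
Proof.
move=> e0 uF uG FG; have [i1 i2] := mut_agN N0 x e0.
have S psi : lip psi -> `|\int[mut x]_(z in setT) psi (F z) - \int[mut x]_(z in setT) psi (G z)| <= e * wtot N0.
  move=> lp; have lp' := lp; case: lp' => p0 pl.
  have iF := uapp_integrable lp uF; have iG := uapp_integrable lp uG.
  have iB : (mut x).-integrable setT (EFin \o (fun z => psi (F z) - psi (G z) : R)).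
    by have := integrableB measurableT iF iG; rewrite /comp /=.
  rewrite -RintegralB //; apply: le_trans (le_normr_Rintegral _ iB) _ => //.
  apply: (@le_trans _ _ (\int[mut x]_(z in setT) (e * (\1_[set z | agN N0 x z] : bipath L -> R) z))).
    apply: le_Rintegral => //; first exact: integrable_norm iB.
    move=> z _; rewrite indicE; have [xz|xz] := pselect (agN N0 x z).
      by rewrite mem_set // mulr1; exact: le_trans (pl _ _) (FG z).
    have z0 H : uapp N0 x H -> H z = 0.
      by case=> Hs _; apply/eqP; apply: contrapT => /negP/Hs.
    by rewrite (z0 _ uF) (z0 _ uG) subrr normr0 memNset // mulr0.
  by rewrite -lee_fin /Rintegral fineK //; exact: integrable_fin_num.
have h1 := S _ lip_Re; have h2 := S _ lip_Im.
apply: le_trans (nm_le_ReIm _) _; rewrite /Cintegral /=; lra.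
Qed.

Lemma nm_integral_le N0 x F (e : R) : uapp N0 x F -> 0 <= e -> (forall z, nm (F z) <= e) ->
  (\int[mut x]_z (nm (F z))%:E <= (e * wtot N0)%:E)%E.
Proof.
move=> uF e0 Fe; have [i1 /(le_trans _)] := mut_agN N0 x e0; apply.
apply: le_integral => //; first exact: (uapp_integrable lip_nm uF).
by move=> z _; rewrite lee_fin; apply: le_trans (ler_norm _) (uapp_dom lip_nm uF Fe z).
Qed.

Lemma nm_integral_close N0 x F G (e : R) : uapp N0 x F -> uapp N0 x G -> 0 <= e ->
  (forall z, nm (F z - G z) <= e) ->
  (\int[mut x]_z (nm (G z))%:E <= \int[mut x]_z (nm (F z))%:E + (e * wtot N0)%:E)%E.
Proof.
move=> uF uG e0 FG; have [i1 i2] := mut_agN N0 x e0.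
have iF := uapp_integrable lip_nm uF; have iG := uapp_integrable lip_nm uG.
apply: (@le_trans _ _ (\int[mut x]_z ((nm (F z))%:E + (e * (\1_[set z | agN N0 x z] : bipath L -> R) z)%:E))%E).
  apply: le_integral => //; first exact: integrableD.
  move=> z _; rewrite -EFinD lee_fin indicE; have [xz|xz] := pselect (agN N0 x z).
    rewrite mem_set // mulr1; have := nm_tri (G z) (F z) 0; have := FG z; rewrite !subr0 (nmB (F z) (G z)); lra.
  have z0 H : uapp N0 x H -> H z = 0.
    by case=> Hs _; apply/eqP; apply: contrapT => /negP/Hs.
  by rewrite (z0 _ uF) (z0 _ uG) memNset // mulr0 addr0.
by rewrite integralD //; apply: leeD.
Qed.

End HaarMeasure.

(** * The regular representation *)

Section LevelConvolution.
Variables (k : nat) (L : kgraph k) (R : realType).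
Local Notation C := (complex R).
Implicit Types (x y z : bipath L) (c d : L -> L -> C) (b : L -> C) (f g : Gs L -> C).
Local Notation cst := (@cst k).
Local Notation cz := (@cz k).
Hypothesis hL : inhabited (kg_obj L).
Hypothesis hprim : primitive L.
Hypothesis hr : surjective_finite_to_one (@kg_r k L).
Variables (t : 'I_k -> R) (a : kg_obj L -> R).
Variable mut : forall x : bipath L, {measure set (borel_at x) -> \bar R}.
Hypothesis t_gt0 : forall i, 0 < t i.
Hypothesis a_gt0 : forall v, 0 < a v.
Hypothesis haar : stable_haar_system t a mut.
Local Notation wt := (wt t a).
Local Notation isum := (isum t a).
Local Notation blk := (@blk k L).

Lemma cell_inhabited N x l : kg_d l = cst (N + N) -> kg_s l = bp_obj x (cz N) ->
  exists z, agN N x z /\ win N z = l.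
Proof.
move=> dl sl; apply: contrapT => no; have := mut_cellS t_gt0 haar dl sl.
have -> : cellS N x l = set0 by apply/seteqP; split=> z // zl; apply: no; exists z.
by rewrite measure0 => -[] /eqP; rewrite lt_eqF // wt_gt0.
Qed.

Lemma agN_sym N x y : agN N x y -> agN N y x.
Proof. by move=> h n hn; rewrite h. Qed.

Lemma agN_trans N x y z : agN N x y -> agN N y z -> agN N x z.
Proof. by move=> h h' n hn; rewrite h h'. Qed.

Lemma lev2_row N c x : lev2 N c x = lev N x (c (win N x)).
Proof. by []. Qed.

Lemma lev2_col N c x z : lev2 N c z x = lev N x (fun l => c l (win N x)) z.
Proof.
rewrite /lev2 /lev; case: asboolP => [/agN_sym h|h]; first by rewrite asboolT.
by rewrite asboolF // => /agN_sym.
Qed.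

Lemma blk_in N v (i : pathT L (cst (N + N))) : (i \in blk N v) = (kg_s (pv i) == v).
Proof. by rewrite mem_filter mem_index_enum andbT. Qed.

Lemma eq_isum N v b b' : (forall i : pathT L (cst (N + N)), kg_s (pv i) = v -> b (pv i) = b' (pv i)) ->
  isum N v b = isum N v b'.
Proof.
move=> h; rewrite /isum big_seq [RHS]big_seq; apply: eq_bigr => i; rewrite blk_in => /eqP iv.
by rewrite h.
Qed.

Lemma isum0 N v : isum N v (fun=> 0) = 0.
Proof. by rewrite /isum big1 // => i _; rewrite mulr0. Qed.

Lemma isumD N v b b' : isum N v (fun l => b l + b' l) = isum N v b + isum N v b'.
Proof. by rewrite /isum -big_split; apply: eq_bigr => i _; rewrite mulrDr. Qed.

Lemma isumZ N v (u : C) b : isum N v (fun l => u * b l) = u * isum N v b.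
Proof. by rewrite /isum mulr_sumr; apply: eq_bigr => i _; rewrite mulrCA. Qed.

Lemma isumZr N v (u : C) b : isum N v (fun l => b l * u) = isum N v b * u.
Proof. by rewrite /isum mulr_suml; apply: eq_bigr => i _; rewrite mulrA. Qed.

Lemma isumC N v b : (isum N v b)^* = isum N v (fun l => (b l)^*).
Proof.
rewrite /isum rmorph_sum; apply: eq_bigr => i _; rewrite rmorphM; congr (_ * _).
by apply/eqP; rewrite eq_complex /= oppr0 !eqxx.
Qed.

Lemma exchange_isum N v (b : L -> L -> C) :
  isum N v (fun l => isum N v (b l)) = isum N v (fun l => isum N v (b^~ l)).
Proof.
rewrite /isum; under eq_bigr do rewrite mulr_sumr.
rewrite exchange_big; apply: eq_bigr => j _; rewrite mulr_sumr; apply: eq_bigr => i _; exact: mulrCA.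
Qed.

Lemma ev_mul_lev N c d x y :
  (fun z => ev (Ef N c) x z * ev (Ef N d) z y) =
  lev N x (fun i => if `[< agN N x y >] then c (win N x) i * d i (win N y) else 0).
Proof.
apply/funext => z; rewrite !ev_Ef /lev2 /lev; case: asboolP => [xz|]; last by rewrite mul0r.
case: asboolP => [zy|zy]; first by rewrite asboolT //; exact: agN_trans zy.
by rewrite mulr0 asboolF // => /(agN_trans (agN_sym xz)).
Qed.

(** On one level convolution is matrix multiplication weighted by the measures of the cells. *)
Lemma convol_Ef N c d :
  convol mut (Ef N c) (Ef N d) = Ef N (fun l m => isum N (kg_s l) (fun i => c l i * d i m)).
Proof.
apply/funext => -[[x y] xy]; rewrite EfE /lev2 /convol /= ev_mul_lev.
rewrite (Cintegral_lev hL hprim hr t_gt0 haar) -(bp_s x (lez_cz k N)).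
by case: asboolP => // _; rewrite isum0.
Qed.

Lemma invol_Ef N c : invol (Ef N c) = Ef N (fun l m => (c m l)^*).
Proof.
apply/funext => -[[x y] xy]; rewrite EfE /invol /= ev_Ef lev2_col /lev2 /lev.
by case: asboolP => // _; rewrite conjC0.
Qed.

Definition level_fun f := exists N c, f = Ef N c.

Lemma level_at f : level_fun f -> exists N, forall M, (N <= M)%N -> exists c, f = Ef M c.
Proof. by move=> [N [c ->]]; exists N => M NM; eexists; exact: Ef_raise. Qed.

Lemma level_at2 f g : level_fun f -> level_fun g ->
  exists N, forall M, (N <= M)%N -> exists c d, f = Ef M c /\ g = Ef M d.
Proof.
move=> /level_at[N hN] /level_at[N' hN']; exists (maxn N N') => M; rewrite geq_max => /andP[].
by move=> /hN[c cE] /hN'[d dE]; exists c, d.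
Qed.

Lemma level_funD (u : C) f g : level_fun f -> level_fun g -> level_fun (fun h => u * f h + g h).
Proof.
move=> hf hg; have [N /(_ N (leqnn N))[c [d [-> ->]]]] := level_at2 hf hg.
exists N, (fun l m => u * c l m + d l m); apply/funext => h; rewrite !EfE /lev2.
by case: asboolP => // _; rewrite mulr0 addr0.
Qed.

Lemma level_convol f g : level_fun f -> level_fun g -> level_fun (convol mut f g).
Proof.
move=> hf hg; have [N /(_ N (leqnn N))[c [d [-> ->]]]] := level_at2 hf hg.
by rewrite convol_Ef; do 2 eexists.
Qed.

Lemma level_invol f : level_fun f -> level_fun (invol f).
Proof. by move=> [N [c ->]]; rewrite invol_Ef; do 2 eexists. Qed.

(* Equivalently, the I-norm of f is at most K. *)
Definition Ibound f (K : R) := forall x,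
  (\int[mut x]_z (nm (ev f x z))%:E <= K%:E)%E /\ (\int[mut x]_z (nm (ev f z x))%:E <= K%:E)%E.

Section L2.
Variable x0 : bipath L.
Local Notation v0 N := (bp_obj x0 (cz N)).

(** The dense subspace of L^2 of the stable class of x0 on which kernels act as finite matrices. *)
Definition levels : set (bipath L -> C) := [set xi | exists N b, xi = lev N x0 b].
Implicit Types xi eta : bipath L -> C.

Definition lvip xi eta : C := Cintegral mut x0 (fun z => xi z * (eta z)^*).
Definition kop f xi : bipath L -> C := fun x => Cintegral mut x0 (fun z => ev f x z * xi z).

Lemma levels_at xi : levels xi -> exists N, forall M, (N <= M)%N -> exists b, xi = lev M x0 b.
Proof.
move=> [N [b ->]]; exists N => M NM; exists (raise2 N M (fun _ => b) (win M x0)); apply/funext => z.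
exact: (lev2_raise (fun _ => b) x0 z NM).
Qed.

Lemma levels_at2 xi eta : levels xi -> levels eta ->
  exists N, forall M, (N <= M)%N -> exists b b', xi = lev M x0 b /\ eta = lev M x0 b'.
Proof.
move=> /levels_at[N hN] /levels_at[N' hN']; exists (maxn N N') => M; rewrite geq_max => /andP[].
by move=> /hN[c cE] /hN'[d dE]; exists c, d.
Qed.

Lemma lvip_lev N b b' : lvip (lev N x0 b) (lev N x0 b') = isum N (v0 N) (fun i => b i * (b' i)^*).
Proof.
rewrite -(Cintegral_lev hL hprim hr t_gt0 haar); congr Cintegral; apply/funext => z.
by rewrite /lev; case: asboolP => // _; rewrite mul0r.
Qed.

Lemma levD N b b' : lev N x0 b + lev N x0 b' = lev N x0 (fun l => b l + b' l) :> (bipath L -> C).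
Proof.
apply/funext => z; rewrite -[LHS]/(lev N x0 b z + lev N x0 b' z) /lev.
by case: asboolP => // _; rewrite addr0.
Qed.

Lemma levZ N (u : C) b : u *: (lev N x0 b : bipath L -> C) = lev N x0 (fun l => u * b l).
Proof.
apply/funext => z; rewrite -[LHS]/(u * lev N x0 b z) /lev.
by case: asboolP => // _; rewrite mulr0.
Qed.

Lemma levels0 : levels 0.
Proof. by exists 0%N, (fun=> 0); apply/funext => z; rewrite /lev if_same. Qed.

Lemma levels_D xi eta : levels xi -> levels eta -> levels (xi + eta).
Proof.
move=> h h'; have [N /(_ N (leqnn N))[b [b' [-> ->]]]] := levels_at2 h h'.
by rewrite levD; do 2 eexists.
Qed.

Lemma levels_Z (u : C) xi : levels xi -> levels (u *: xi).
Proof. by move=> [N [b ->]]; rewrite levZ; do 2 eexists. Qed.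

Lemma lvipDl xi eta zeta : levels xi -> levels eta -> levels zeta ->
  lvip (xi + eta) zeta = lvip xi zeta + lvip eta zeta.
Proof.
move=> h h' /levels_at[N' h3]; have [N hN] := levels_at2 h h'.
have [b [b' [-> ->]]] := hN (maxn N N') (leq_maxl _ _).
have [b3 ->] := h3 (maxn N N') (leq_maxr _ _).
by rewrite levD !lvip_lev -isumD; apply: eq_isum => i _; rewrite mulrDl.
Qed.

Lemma lvipZl (u : C) xi eta : levels xi -> levels eta -> lvip (u *: xi) eta = u * lvip xi eta.
Proof.
move=> h h'; have [N /(_ N (leqnn N))[b [b' [-> ->]]]] := levels_at2 h h'.
by rewrite levZ !lvip_lev -isumZ; apply: eq_isum => i _; rewrite mulrA.
Qed.

Lemma lvipC xi eta : levels xi -> levels eta -> lvip xi eta = (lvip eta xi)^*.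
Proof.
move=> h h'; have [N /(_ N (leqnn N))[b [b' [-> ->]]]] := levels_at2 h h'.
by rewrite !lvip_lev isumC; apply: eq_isum => i _; rewrite rmorphM /= conjCK mulrC.
Qed.

Lemma lvip_sqr N b : lvip (lev N x0 b) (lev N x0 b) =
  (\sum_(i <- blk N (v0 N)) wt N (pv i) * nm (b (pv i)) ^+ 2)%:C%C.
Proof.
rewrite lvip_lev rmorph_sum; apply: eq_bigr => i _.
by rewrite -normCK nmE [RHS]rmorphM [in RHS]rmorphXn.
Qed.

Lemma lvip_ge0 xi : levels xi -> 0 <= lvip xi xi.
Proof.
move=> [N [b ->]]; rewrite lvip_sqr lecR; apply: sumr_ge0 => i _.
by rewrite mulr_ge0 ?sqr_ge0 // ltW // wt_gt0.
Qed.

Definition level_pre : prehilbert R :=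
  @Prehilbert R (bipath L -> C) levels lvip levels0 levels_D levels_Z lvipDl lvipZl lvipC lvip_ge0.

Lemma kop_lev N c b :
  kop (Ef N c) (lev N x0 b) = lev N x0 (fun l => isum N (v0 N) (fun i => c l i * b i)).
Proof.
apply/funext => x; rewrite /kop.
have E z : ev (Ef N c) x z * lev N x0 b z =
    lev N x0 (fun i => if `[< agN N x0 x >] then c (win N x) i * b i else 0) z.
  rewrite ev_Ef lev2_row /lev; case: asboolP => [xz|xz]; case: asboolP => [z0|z0]; rewrite ?mul0r ?mulr0 //.
    by rewrite asboolT //; apply: agN_trans z0 (agN_sym xz).
  by rewrite asboolF // => x0x; apply: xz; apply: agN_trans (agN_sym x0x) z0.
rewrite (funext E) (Cintegral_lev hL hprim hr t_gt0 haar) /lev.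
by case: asboolP => // _; rewrite isum0.
Qed.

Lemma common_level f xi : level_fun f -> levels xi -> exists N c b, f = Ef N c /\ xi = lev N x0 b.
Proof.
move=> /level_at[N hN] /levels_at[N' hN'].
have [c ->] := hN (maxn N N') (leq_maxl _ _); have [b ->] := hN' (maxn N N') (leq_maxr _ _).
by exists (maxn N N'), c, b.
Qed.

Lemma levels_kop f xi : level_fun f -> levels xi -> levels (kop f xi).
Proof.
move=> hf hx; have [N [c [b [-> ->]]]] := common_level hf hx.
by rewrite kop_lev; do 2 eexists.
Qed.

Lemma kop_linear f g (u : C) xi : level_fun f -> level_fun g -> levels xi ->
  kop (fun h => u * f h + g h) xi = u *: kop f xi + kop g xi.
Proof.
move=> h h' /levels_at[N' h3]; have [N hN] := level_at2 h h'.
have [b ->] := h3 (maxn N N') (leq_maxr _ _).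
have [c [c' [-> ->]]] := hN (maxn N N') (leq_maxl _ _).
have -> : (fun h => u * Ef (maxn N N') c h + Ef (maxn N N') c' h) =
    Ef (maxn N N') (fun l m => u * c l m + c' l m).
  by apply/funext => g'; rewrite !EfE /lev2; case: asboolP => // _; rewrite mulr0 addr0.
rewrite !kop_lev levZ levD; congr (lev _ _ _); apply/funext => l.
by rewrite -isumZ -isumD; apply: eq_isum => i _; ring.
Qed.

Lemma kop_convol f g xi : level_fun f -> level_fun g -> levels xi ->
  kop (convol mut f g) xi = kop f (kop g xi).
Proof.
move=> h h' /levels_at[N' h3]; have [N hN] := level_at2 h h'.
have [b ->] := h3 (maxn N N') (leq_maxr _ _).
have [c [d [-> ->]]] := hN (maxn N N') (leq_maxl _ _); set M := maxn _ _.
rewrite convol_Ef !kop_lev; apply/funext => z; rewrite /lev; case: asboolP => // z0.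
have -> : kg_s (win M z) = v0 M by exact: agN_src z0.
transitivity (isum M (v0 M) (fun i => isum M (v0 M) (fun j => c (win M z) j * d j i * b i))).
  by apply: eq_isum => i _; rewrite isumZr.
rewrite exchange_isum; apply: eq_isum => j _; rewrite -isumZ; apply: eq_isum => i _.
by rewrite mulrA.
Qed.

Lemma kop_adj f xi eta : level_fun f -> levels xi -> levels eta ->
  lvip (kop f xi) eta = lvip xi (kop (invol f) eta).
Proof.
move=> /level_at[N' h3] h h'; have [N hN] := levels_at2 h h'.
have [b [b' [-> ->]]] := hN (maxn N N') (leq_maxl _ _).
have [c ->] := h3 (maxn N N') (leq_maxr _ _); set M := maxn _ _.
rewrite invol_Ef !kop_lev !lvip_lev.
transitivity (isum M (v0 M) (fun i => isum M (v0 M) (fun j => c i j * b j * (b' i)^*))).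
  by apply: eq_isum => i _; rewrite isumZr.
rewrite exchange_isum; apply: eq_isum => j _; rewrite isumC -isumZ; apply: eq_isum => i _.
by rewrite rmorphM /= conjCK; ring.
Qed.

(** The I-norm bound becomes one on weighted row and column sums, since by [cell_inhabited] each
    window with the right source occurs in some path. *)
Lemma Ibound_lev N c K : Ibound (Ef N c) K ->
  (forall l : pathT L (cst (N + N)), kg_s (pv l) = v0 N ->
     \sum_(i <- blk N (v0 N)) nm (c (pv l) (pv i)) * wt N (pv i) <= K /\
     \sum_(i <- blk N (v0 N)) nm (c (pv i) (pv l)) * wt N (pv i) <= K).
Proof.
move=> h l sl; have dl : kg_d (pv l) = cst (N + N) by exact: (pvP hL hprim hr).
have [x [x0x wx]] := cell_inhabited dl sl.
have vE : bp_obj x (cz N) = v0 N by exact: etrans (esym (bp_s x (lez_cz k N))) (agN_src x0x).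
have [h1 h2] := h x; split; rewrite -lee_fin.
  have [_] := lev_integral hL hprim hr t_gt0 haar N x (c (win N x)) (@nm0 R C).
  rewrite vE wx => <-; move: h1; congr (_ <= _)%E; apply: eq_integral => z _.
  by rewrite ev_Ef lev2_row wx.
have [_] := lev_integral hL hprim hr t_gt0 haar N x (fun l => c l (win N x)) (@nm0 R C).
rewrite vE wx => <-; move: h2; congr (_ <= _)%E; apply: eq_integral => z _.
by rewrite ev_Ef lev2_col wx.
Qed.

End L2.
End LevelConvolution.

(** * Estimates in the I-norm and the boundedness of kernel operators *)

Section INormBounds.
Variables (k : nat) (L : kgraph k) (R : realType).
Local Notation C := (complex R).
Implicit Types (x y z : bipath L) (f g : Gs L -> C).
Local Notation cst := (@cst k).
Local Notation cz := (@cz k).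
Hypothesis hL : inhabited (kg_obj L).
Hypothesis hprim : primitive L.
Hypothesis hr : surjective_finite_to_one (@kg_r k L).
Variables (t : 'I_k -> R) (a : kg_obj L -> R).
Variable mut : forall x : bipath L, {measure set (borel_at x) -> \bar R}.
Hypothesis t_gt0 : forall i, 0 < t i.
Hypothesis a_gt0 : forall v, 0 < a v.
Hypothesis haar : stable_haar_system t a mut.
Local Notation wt := (wt t a).
Local Notation wtot := (@wtot k L R t a).
Local Notation isum := (isum t a).
Local Notation blk := (@blk k L).
Local Notation Ibound := (Ibound mut).

Definition supp f N := forall h, f h != 0 -> inG N h.

Lemma supp_le f N M : (N <= M)%N -> supp f N -> supp f M.
Proof. by move=> NM sf h /sf; exact: agN_le. Qed.

Lemma suppD (u : C) f g N : supp f N -> supp g N -> supp (fun h => u * f h + g h) N.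
Proof.
move=> sf sg h; have [f0|/sf //] := eqVneq (f h) 0; have [g0|/sg //] := eqVneq (g h) 0.
by rewrite f0 g0 mulr0 addr0 eqxx.
Qed.

Lemma ev_rel (P : C -> C -> Prop) f g :
  P 0 0 -> (forall h, P (f h) (g h)) -> forall x y, P (ev f x y) (ev g x y).
Proof. by move=> P0 h x y; rewrite /ev; case: pselect. Qed.

Lemma ev_supp f N x y : supp f N -> ev f x y != 0 -> agN N x y.
Proof. by move=> sf; rewrite /ev; case: pselect => [h /sf //|]; rewrite eqxx. Qed.

Lemma stable_sym x y : stable x y -> stable y x.
Proof. by move=> /stable_agN[N h]; apply/stable_agN; exists N; exact: agN_sym. Qed.

Lemma ev_invol f x y : ev (invol f) x y = (ev f y x)^*.
Proof.
rewrite /ev; case: pselect => h; first by [].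
by case: pselect => h'; [case: h; exact: stable_sym | rewrite conjC0].
Qed.

Lemma level_Cc f : level_fun f -> Cc f.
Proof. by move=> [N [c ->]]; exact: Ef_Cc. Qed.

Lemma Cc_uapp f N : Cc f -> supp f N ->
  forall x, uapp N x (ev f x) /\ uapp N x (fun z => ev f z x).
Proof.
move=> fC sf x; split; split=> [z|e e0].
- exact: ev_supp.
- have [M [c [_ fc _]]] := Cc_approx fC sf e0; exists M, (c (win M x)) => z.
  rewrite -lev2_row -ev_Ef; apply: (ev_rel (P := fun u v => nm (u - v) <= e)) => //.
  by rewrite subrr nm0 ltW.
- by move=> /(ev_supp sf)/agN_sym.
- have [M [c [_ fc _]]] := Cc_approx fC sf e0; exists M, (fun l => c l (win M x)) => z.
  rewrite -lev2_col -ev_Ef; apply: (ev_rel (P := fun u v => nm (u - v) <= e)) => //.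
  by rewrite subrr nm0 ltW.
Qed.

(** On a fixed G_{s,N} the I-norm is controlled by the uniform norm. *)
Lemma Ibound_small f N (e : R) : Cc f -> supp f N -> 0 <= e -> (forall h, nm (f h) <= e) ->
  Ibound f (e * wtot N).
Proof.
move=> fC sf e0 fe x; have [u1 u2] := Cc_uapp fC sf x.
have fe' y z : nm (ev f y z) <= e.
  by apply: (ev_rel (P := fun u _ => nm u <= e) (g := f)) => //; rewrite nm0.
by split; apply: (nm_integral_le hL hprim hr t_gt0 a_gt0 haar).
Qed.

Lemma Ibound_close f g N (e K : R) : Cc f -> Cc g -> supp f N -> supp g N -> 0 <= e ->
  (forall h, nm (f h - g h) <= e) -> Ibound f K -> Ibound g (K + e * wtot N).
Proof.
move=> fC gC sf sg e0 fg fK x; have [u1 u2] := Cc_uapp fC sf x; have [v1 v2] := Cc_uapp gC sg x.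
have fg' y z : nm (ev f y z - ev g y z) <= e.
  by apply: (ev_rel (P := fun u v => nm (u - v) <= e)) => //; rewrite subrr nm0.
have [K1 K2] := fK x; rewrite EFinD.
split; [apply: le_trans (nm_integral_close hL hprim hr t_gt0 a_gt0 haar u1 v1 e0 (fg' x)) _
       |apply: le_trans (nm_integral_close hL hprim hr t_gt0 a_gt0 haar u2 v2 e0 (fg'^~ x)) _];
  exact: leeD.
Qed.

Lemma Cc_bounded f : Cc f -> exists2 B, 0 <= B & forall h, nm (f h) <= B.
Proof.
move=> fC; have [N0 sf] := Cc_supp fC; have [N [c [_ fc _]]] := Cc_approx fC sf ltr01.
pose B := \sum_(i : pathT L (cst (N + N))) \sum_(j : pathT L (cst (N + N))) nm (c (pv i) (pv j)).
have B0 : 0 <= B by apply: sumr_ge0 => i _; apply: sumr_ge0 => j _; exact: nm_ge0.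
exists (1 + B) => [|h]; first exact: addr_ge0.
have := nm_tri (f h) (Ef N c h) 0; rewrite !subr0 => /le_trans; apply; apply: lerD => //.
rewrite /Ef; case: asboolP => _; last by rewrite nm0.
have [i <-] := win_pathT hL hprim hr N (sval h).1; have [j <-] := win_pathT hL hprim hr N (sval h).2.
rewrite /B (bigD1 i) //= (bigD1 j) //= -addrA lerDl addr_ge0 // sumr_ge0 // => ? _; rewrite ?nm_ge0 //.
by apply: sumr_ge0 => ? _; exact: nm_ge0.
Qed.

Lemma Ibound_ex f : Cc f -> exists2 K, 0 <= K & Ibound f K.
Proof.
move=> fC; have [B B0 fB] := Cc_bounded fC; have [N sf] := Cc_supp fC.
by exists (B * wtot N); [rewrite mulr_ge0 ?wtot_ge0 | exact: Ibound_small].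
Qed.

Lemma Ibound_invol f K : Ibound f K -> Ibound (invol f) K.
Proof.
move=> h x; have [h1 h2] := h x; split.
  by move: h2; congr (_ <= _)%E; apply: eq_integral => z _; rewrite ev_invol nm_conj.
by move: h1; congr (_ <= _)%E; apply: eq_integral => z _; rewrite ev_invol nm_conj.
Qed.

(** x0 keeps the suprema from being taken over the empty set, and K makes them finite, so [fine]
    loses nothing. *)
Lemma I_norm_fine x0 f K : Ibound f K ->
  [/\ Ibound f (fine (I_norm mut f)), 0 <= fine (I_norm mut f) & fine (I_norm mut f) <= K].
Proof.
move=> fK; have IK : (I_norm mut f <= K%:E)%E.
  by rewrite ge_max; apply/andP; split; apply: ge_ereal_sup => _ [x _ <-]; have [] := fK x.
have rowI x : (\int[mut x]_z (nm (ev f x z))%:E <= I_norm mut f)%E.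
  by rewrite le_max; apply/orP; left; apply: ereal_sup_ubound; exists x.
have colI x : (\int[mut x]_z (nm (ev f z x))%:E <= I_norm mut f)%E.
  by rewrite le_max; apply/orP; right; apply: ereal_sup_ubound; exists x.
have I0 : (0 <= I_norm mut f)%E.
  by apply: le_trans (rowI x0); apply: integral_ge0 => z _; rewrite lee_fin nm_ge0.
have fin : I_norm mut f \is a fin_num.
  by rewrite ge0_fin_numE //; apply: le_lt_trans IK _; exact: ltry.
split=> [x||]; [by rewrite fineK | exact: fine_ge0 | by rewrite -lee_fin fineK].
Qed.

Section Schur.
Variable x0 : bipath L.
Local Notation v0 N := (bp_obj x0 (cz N)).
Local Notation E := (level_pre hL hprim hr t_gt0 a_gt0 haar x0).
Local Notation kop := (kop mut x0).

Lemma pn_lev N (b : L -> C) : @pn R E (lev N x0 b) ^+ 2 = \sum_(i <- blk N (v0 N)) wt N (pv i) * nm (b (pv i)) ^+ 2.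
Proof.
apply: (@complexI R); rewrite -(@pn_sqr R E); last by do 2 eexists.
exact: lvip_sqr.
Qed.

(* Schur test. *)
Lemma kop_bound_gt0 f K (xi : bipath L -> C) : level_fun f -> 0 < K -> Ibound f K -> levels x0 xi ->
  @pn R E (kop f xi) <= K * @pn R E xi.
Proof.
move=> hf K0 fK hx; have [N [c [b [fE ->]]]] := common_level hf hx.
move: fK; rewrite {}fE => fK; have sK := Ibound_lev hL hprim hr t_gt0 a_gt0 haar (x0 := x0) fK.
rewrite (kop_lev hL hprim hr t_gt0 haar) -(@ler_pXn2r _ 2) ?nnegrE ?mulr_ge0 ?pn_ge0 ?(ltW K0) //.
rewrite exprMn !pn_lev; set r := blk _ _.
pose T l := isum N (v0 N) (fun i => c l i * b i).
change (\sum_(l <- r) wt N (pv l) * nm (T (pv l)) ^+ 2 <= K ^+ 2 * \sum_(i <- r) wt N (pv i) * nm (b (pv i)) ^+ 2).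
have w0 (i : pathT L (cst (N + N))) : 0 <= wt N (pv i : L) by exact/ltW/wt_gt0.
have TK (l : pathT L (cst (N + N))) : kg_s (pv l) = v0 N -> nm (T (pv l)) ^+ 2 <=
    K * \sum_(i <- r) (nm (c (pv l) (pv i)) * wt N (pv i)) * nm (b (pv i)) ^+ 2.
  move=> /sK[+ _]; set p := nm (T _) => h1.
  have p0 : 0 <= p by exact: nm_ge0.
  have pS : p <= \sum_(i <- r) (nm (c (pv l) (pv i)) * wt N (pv i)) * nm (b (pv i)).
    apply: le_trans (nm_sum _ _ _) _; apply: ler_sum => i _.
    by rewrite !nmM nmR ger0_norm // mulrA (mulrC (wt _ _)).
  (* 2 p q <= p^2/K + K q^2. Summed with weights u of total at most K, this gives 2 p^2 <= p^2 + K
     sum u q^2, without square roots. *)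
  have step (i : pathT L (cst (N + N))) : 2 * p * ((nm (c (pv l) (pv i)) * wt N (pv i)) * nm (b (pv i))) <=
      p ^+ 2 / K * (nm (c (pv l) (pv i)) * wt N (pv i)) + K * ((nm (c (pv l) (pv i)) * wt N (pv i)) * nm (b (pv i)) ^+ 2).
    set u := nm (c _ _) * _; have u0 : 0 <= u by rewrite mulr_ge0 ?nm_ge0.
    rewrite -subr_ge0; set q := nm (b _).
    have -> : p ^+ 2 / K * u + K * (u * q ^+ 2) - 2 * p * (u * q) = u * (K * (p / K - q) ^+ 2).
      by field; rewrite gt_eqF.
    by rewrite mulr_ge0 // mulr_ge0 ?sqr_ge0 // ltW.
  have h2 : 2 * p * p <= p ^+ 2 / K * K + K * \sum_(i <- r) (nm (c (pv l) (pv i)) * wt N (pv i)) * nm (b (pv i)) ^+ 2.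
    apply: le_trans (ler_wpM2l _ pS) _; first by rewrite mulr_ge0.
    rewrite mulr_sumr; apply: le_trans; first by apply: ler_sum => i _; exact: step.
    rewrite big_split /= -!mulr_sumr lerD2r; apply: ler_wpM2l h1; by rewrite mulr_ge0 ?sqr_ge0 // invr_ge0 ltW.
  move: h2; rewrite divfK ?gt_eqF // expr2; lra.
apply: (@le_trans _ _ (\sum_(l <- r) wt N (pv l) * (K * \sum_(i <- r) (nm (c (pv l) (pv i)) * wt N (pv i)) * nm (b (pv i)) ^+ 2))).
  rewrite big_seq [leRHS]big_seq; apply: ler_sum => l; rewrite blk_in => /eqP lv.
  by apply: ler_wpM2l => //; exact: TK.
under eq_bigr do rewrite mulrCA; rewrite -mulr_sumr expr2 -mulrA ler_wpM2l ?(ltW K0) //.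
(* After the exchange the column sums appear and contribute the second factor K. *)
under eq_bigr do rewrite mulr_sumr; rewrite exchange_big mulr_sumr big_seq [leRHS]big_seq.
apply: ler_sum => i; rewrite blk_in => /eqP iv; have [_ h2] := sK i iv.
rewrite (eq_bigr (fun l => (nm (c (pv l) (pv i)) * wt N (pv l)) * (wt N (pv i) * nm (b (pv i)) ^+ 2))).
  by rewrite -mulr_suml ler_wpM2r // mulr_ge0 // sqr_ge0.
by move=> l _; ring.
Qed.

Lemma kop_bound f K (xi : bipath L -> C) : level_fun f -> 0 <= K -> Ibound f K -> levels x0 xi ->
  @pn R E (kop f xi) <= K * @pn R E xi.
Proof.
move=> hf K0 fK hx; apply/ler_addgt0Pr => e e0.
have p1 : 0 < @pn R E xi + 1 by rewrite ltr_wpDl ?pn_ge0.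
have d0 : 0 < e / (@pn R E xi + 1) by rewrite divr_gt0.
have fK' : Ibound f (K + e / (@pn R E xi + 1)).
  by move=> x; have [h1 h2] := fK x; split; apply: le_trans; try eassumption; rewrite lee_fin lerDl ltW.
apply: le_trans (kop_bound_gt0 hf (ltr_wpDl K0 d0) fK' hx) _.
rewrite mulrDl lerD2l mulrAC ler_pdivrMr // ler_wpM2l ?ltW //; lra.
Qed.

End Schur.
End INormBounds.

Lemma small_factor (R : realType) (e K : R) : 0 < e -> 0 <= K -> exists d, [/\ 0 < d, d <= 1 & d * K <= e].
Proof.
move=> e0 K0; have p : 0 < e + K by lra.
exists (e / (e + K)); split; first exact: divr_gt0.
  by rewrite ler_pdivrMr // mul1r lerDl.
by rewrite mulrAC ler_pdivrMr // ler_wpM2l ?ltW //; lra.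
Qed.

Section NormEstimates.
Variables (R : realType) (V : normedZmodType (complex R)).
Implicit Types (u v : V) (e w : R).

Lemma nm_near u v e : nm (u - v) <= e -> nm u <= nm v + e.
Proof. by move=> h; have := nm_tri u v 0; rewrite !subr0; lra. Qed.

Lemma nm_nearC u v e : nm (u - v) <= e -> nm v <= nm u + e.
Proof. by rewrite nmB; exact: nm_near. Qed.

Lemma nm_near3 u u' v v' e w : nm (u - u') <= e -> nm (v - v') <= e -> nm (u' - v') <= w ->
  nm (u - v) <= 2 * e + w.
Proof.
move=> h1 h2 h3; have a1 := nm_tri u u' v; have a2 := nm_tri u' v' v; rewrite (nmB v) in h2; lra.
Qed.

End NormEstimates.

Lemma nm_mul_near (R : realType) (p p' s s' : complex R) (q F G : R) : nm (p - p') <= q ->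
  nm (s - s') <= q -> nm p <= F -> nm s <= G -> q <= 1 -> nm (p * s - p' * s') <= q * (F + 1 + G).
Proof.
move=> b1 b2 b3 b4 q1; have -> : p * s - p' * s' = (p - p') * s + p' * (s - s') by ring.
apply: le_trans (nmD _ _) _; rewrite !nmM.
have b5 : nm p' <= F + 1 by have := nm_nearC b1; lra.
have c1 := ler_pM (nm_ge0 _) (nm_ge0 _) b1 b4; have c2 := ler_pM (nm_ge0 _) (nm_ge0 _) b5 b2.
by apply: le_trans (lerD c1 c2) _; rewrite (_ : q * G + _ = q * (F + 1 + G)) //; ring.
Qed.

Lemma nm_near_lin (R : realType) (V : normedModType (complex R)) (c : complex R) (u u' v v' : V) (e q : R) :
  nm (u - u') <= q -> nm (v - v') <= q -> q * (nm c + 1) <= e ->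
  nm (c *: u + v - (c *: u' + v')) <= e.
Proof.
move=> h1 h2 h3; rewrite opprD addrACA -scalerBr; apply: le_trans (nmD _ _) _; rewrite nmZ.
have := ler_wpM2l (nm_ge0 c) h1; lra.
Qed.

Section CompletionExt.
Variables (R : realType) (E : prehilbert R).

Lemma vec_eq (u v : pW E) (Vu : @pV R E u) (Vv : @pV R E v) : u = v -> vec Vu = vec Vv.
Proof. by move=> uv; subst v; congr vec; exact: Prop_irrelevance. Qed.

Lemma compl_ext (f g : compl E) : (forall v (Vv : @pV R E v), hip f (vec Vv) = hip g (vec Vv)) -> f = g.
Proof.
move=> fg; apply: fspace_ext => -[w Vw]; have := fg w Vw.
by rewrite hipC [RHS]hipC !hip_vecl /feval !conjCK.
Qed.

End CompletionExt.

(** * The representation of C_c(G_s) on L^2 of one stable class *)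

Section RegularRepresentation.
Variables (k : nat) (L : kgraph k) (R : realType).
Local Notation C := (complex R).
Implicit Types (x y z : bipath L) (f g d : Gs L -> C) (xi eta : bipath L -> C).
Local Notation cst := (@cst k).
Local Notation cz := (@cz k).
Hypothesis hL : inhabited (kg_obj L).
Hypothesis hprim : primitive L.
Hypothesis hr : surjective_finite_to_one (@kg_r k L).
Variables (t : 'I_k -> R) (a : kg_obj L -> R).
Variable mut : forall x : bipath L, {measure set (borel_at x) -> \bar R}.
Hypothesis t_gt0 : forall i, 0 < t i.
Hypothesis a_gt0 : forall v, 0 < a v.
Hypothesis haar : stable_haar_system t a mut.
Variable x0 : bipath L.
Local Notation wt := (wt t a).
Local Notation wtot := (@wtot k L R t a).
Local Notation Ibound := (Ibound mut).
Local Notation E := (level_pre hL hprim hr t_gt0 a_gt0 haar x0).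
Local Notation H := (compl_hilbert E).
Local Notation kop := (kop mut x0).
Local Notation convol := (convol mut).
Local Notation vec := (@vec R E).

(** A relation, because the construction of the operator depends on a proof that f is constant on
    cells of some level. *)
Definition Rep f (A : BH H) :=
  forall xi (V : levels x0 xi) (V' : levels x0 (kop f xi)), A (inl (vec V)) = vec V'.

Lemma lkop f : level_fun f -> forall xi, levels x0 xi -> levels x0 (kop f xi).
Proof. by move=> hf xi; exact: (levels_kop hL hprim hr t_gt0 haar). Qed.

Lemma Rep_ex f : level_fun f -> exists A, Rep f A.
Proof.
move=> hf; have hf' := level_invol hf.
have [K K0 fK] := Ibound_ex hL hprim hr t_gt0 a_gt0 haar (level_Cc hL hprim hr hf).
have VT := lkop hf; have VT' := lkop hf'.
have TT' xi eta : levels x0 xi -> levels x0 eta -> @pip R E (kop f xi) eta = @pip R E xi (kop (invol f) eta).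
  exact: (kop_adj hL hprim hr t_gt0 haar).
have T'T xi eta : levels x0 xi -> levels x0 eta -> @pip R E (kop (invol f) xi) eta = @pip R E xi (kop f eta).
  move=> h h'; rewrite (@pipC R E) ?TT' //; last exact: VT'.
  by rewrite -TT' // -(@pipC R E) //; exact: VT.
have TK xi : levels x0 xi -> @pn R E (kop f xi) <= K * @pn R E xi by exact: kop_bound.
have T'K xi : levels x0 xi -> @pn R E (kop (invol f) xi) <= K * @pn R E xi.
  by apply: kop_bound => //; exact: Ibound_invol.
pose F (w : H + H) : H := match w with
  | inl h => @ext R E (kop f) (kop (invol f)) K K0 VT VT' TT' T'K h
  | inr h => @ext R E (kop (invol f)) (kop f) K K0 VT' VT T'T TK h end.
have PF : opP F.
  split=> [u v|]; first exact: ext_adj.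
  by exists K => // -[u|u]; exact: ext_le.
exists (mk_op PF) => xi V V'; apply: etrans (@ext_vec R E (kop f) (kop (invol f)) K K0 VT VT' TT' T'K xi V) _; exact: vec_eq.
Qed.

Lemma Rep_bound f A K : level_fun f -> Rep f A -> 0 <= K -> Ibound f K -> nm A <= K.
Proof.
move=> hf fA K0 fK; apply: nm_op_le => // h; apply/ler_addgt0Pr => e e0.
have A0 := nm_ge0 A.
have [d [d0 _ de]] := small_factor e0 (addr_ge0 A0 K0).
have [xi [V hV]] := vec_dense h d0; have V' := lkop hf V.
have -> : A (inl h) = A (inl (h - vec V)) + vec V'.
  by rewrite -(fA _ V V') -opD subrK.
apply: le_trans (nmD _ _) _; rewrite nm_vec.
have h1 := nm_op A (inl (h - vec V)).
have h2 : @pn R E (kop f xi) <= K * @pn R E xi by exact: kop_bound.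
have h3 := nm_vec_le hV; have h4 := ler_wpM2l K0 h3.
have h5 : nm (A (inl (h - vec V))) <= nm A * d by apply: le_trans h1 (ler_wpM2l A0 hV).
move: h2 h4 h5 de; lra.
Qed.

Lemma Rep_linear (u : C) f g A B : level_fun f -> level_fun g -> Rep f A -> Rep g B ->
  Rep (fun h => u * f h + g h) (u *: A + B).
Proof.
move=> hf hg fA gB xi V V'; rewrite op_addE op_scaleE (fA _ V (lkop hf V)) (gB _ V (lkop hg V)).
rewrite -vecZ -vecD; apply: vec_eq; exact/esym/(kop_linear hL hprim hr t_gt0 haar).
Qed.

Lemma Rep_convol f g A B : level_fun f -> level_fun g -> Rep f A -> Rep g B ->
  Rep (convol f g) (op_mul A B).
Proof.
move=> hf hg fA gB xi V V'; have V1 := lkop hg V.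
rewrite /= (gB _ V V1) (fA _ V1 (lkop hf V1)); apply: vec_eq.
exact/esym/(kop_convol hL hprim hr t_gt0 haar).
Qed.

Lemma Rep_invol f A : level_fun f -> Rep f A -> Rep (invol f) (op_star A).
Proof.
move=> hf fA xi V V'; apply: compl_ext => eta Ve.
have -> : hip (op_star A (inl (vec V))) (vec Ve) = hip (vec V) (A (inl (vec Ve))) by exact: (@op_adjr R H A (vec V) (vec Ve)).
rewrite (fA _ Ve (lkop hf Ve)) !hip_vec (@pipC R E) //; last exact: lkop.
rewrite [in LHS]/= (kop_adj hL hprim hr t_gt0 haar) // -(@pipC R E) //.
Qed.

Lemma Rep_close m f g A B (e : R) : level_fun f -> level_fun g -> supp f m -> supp g m ->
  Rep f A -> Rep g B -> 0 <= e -> (forall h, nm (f h - g h) <= e) -> nm (A - B) <= e * wtot m.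
Proof.
move=> hf hg sf sg fA gB e0 fg; have -> : A - B = (-1) *: B + A by rewrite scaleN1r addrC.
have w0 : 0 <= e * wtot m by rewrite mulr_ge0 // wtot_ge0.
have hd := level_funD (-1) hg hf.
apply: (Rep_bound hd (Rep_linear (u := -1) hg hf gB fA) w0).
apply: (Ibound_small hL hprim hr t_gt0 a_gt0 haar) => //; first exact: level_Cc.
  exact: suppD.
by move=> h; rewrite mulN1r addrC.
Qed.

(** A is a limit of operators of level functions that tend uniformly to f inside G_{s,m}. The common
    support makes A unique and lets the algebraic identities pass to the limit. *)
Definition isPi m f (A : BH H) := forall e : R, 0 < e -> exists d B,
  [/\ level_fun d, supp d m, forall h, nm (f h - d h) <= e, Rep d B & nm (A - B) <= e].

Lemma isPi_le m m' f A : (m <= m')%N -> isPi m f A -> isPi m' f A.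
Proof.
by move=> mm h e /h[d [B [? sd ? ? ?]]]; exists d, B; split=> //; exact: supp_le sd.
Qed.

Lemma isPi_level m f A : level_fun f -> supp f m -> Rep f A -> isPi m f A.
Proof. by move=> hf sf fA e e0; exists f, A; split=> // [h|]; rewrite subrr nm0 ltW. Qed.

Lemma isPi_ex m f : Cc f -> supp f m -> exists A, isPi m f A.
Proof.
move=> fC sf; have /choice[u uP] : forall n, exists dB : (Gs L -> C) * BH H,
    [/\ level_fun dB.1, supp dB.1 m, forall h, nm (f h - dB.1 h) <= 2^-1 ^+ n & Rep dB.1 dB.2].
  move=> n; have e0 : (0 : R) < 2^-1 ^+ n by rewrite exprn_gt0 // invr_gt0.
  have [N [c [_ fc sc]]] := Cc_approx fC sf e0.
  have hd : level_fun (Ef N c) by do 2 eexists.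
  by have [A cA] := Rep_ex hd; exists (Ef N c, A).
have half0 : 0 <= (2^-1 : R) by rewrite invr_ge0.
have half1 : (2^-1 : R) < 1 by rewrite invf_lt1 // ltr1n.
have [|A AP] := @complete_seq R (BHs H) (fun n => (u n).2).
  move=> e e0; have w0 := wtot_ge0 t_gt0 a_gt0 m.
  have w1 : 0 < 2 * wtot m + 1 by lra.
  have [N NP] := expr_small half0 half1 (divr_gt0 e0 w1).
  exists N => i j /NP iN /NP jN; have [hi si fi Ri] := uP i; have [hj sj fj Rj] := uP j.
  set q := e / _ in iN jN; have q0 : 0 < q by exact: divr_gt0.
  have q2 : 0 <= 2 * q by lra.
  apply: le_lt_trans (Rep_close hi hj si sj Ri Rj q2 _) _.
    move=> h; have := nm_tri ((u i).1 h) (f h) ((u j).1 h); rewrite (nmB ((u i).1 h) (f h)).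
    have := fi h; have := fj h; lra.
  have -> : e = q * (2 * wtot m + 1) by rewrite divfK ?gt_eqF.
  by rewrite [ltRHS](_ : _ = 2 * q * wtot m + q) ?ltrDl //; ring.
exists A => e e0; have [N1 N1P] := AP e e0.
have [N2 N2P] := expr_small half0 half1 e0.
have [hd sd fd Rd] := uP (maxn N1 N2).
exists (u (maxn N1 N2)).1, (u (maxn N1 N2)).2; split=> // [h|].
  by apply: le_trans (fd h) _; apply/ltW/N2P; exact: leq_maxr.
by rewrite nmB; apply/ltW/N1P; exact: leq_maxl.
Qed.

Lemma isPi_uniq m f A B : isPi m f A -> isPi m f B -> A = B.
Proof.
move=> fA fB; apply: (@eq_of_approx _ _ _ _ (2 + 2 * wtot m)) => e e0 _.
have [d [A' [hd sd fd RA dA]]] := fA e e0; have [d' [B' [hd' sd' fd' RB dB]]] := fB e e0.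
have e2 : 0 <= 2 * e by rewrite mulr_ge0 // ltW.
have h3 h : nm (d h - d' h) <= 2 * e.
  by rewrite -[leRHS]addr0; apply: nm_near3; [rewrite nmB; exact: fd | rewrite nmB; exact: fd' | rewrite subrr nm0].
apply: le_trans (nm_near3 dA dB (Rep_close hd hd' sd sd' RA RB e2 h3)) _.
by rewrite [leRHS]mulrDl mulrAC.
Qed.

Lemma isPi_linear m (u : C) f g A B : isPi m f A -> isPi m g B ->
  isPi m (fun h => u * f h + g h) (u *: A + B).
Proof.
move=> fA gB e e0; have [q [q0 _ qe]] := small_factor e0 (addr_ge0 (nm_ge0 u) ler01).
have [d [A' [hd sd fd RA dA]]] := fA q q0; have [d' [B' [hd' sd' fd' RB dB]]] := gB q q0.
exists (fun h => u * d h + d' h), (u *: A' + B'); split.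
- exact: level_funD.
- exact: suppD.
- by move=> h; exact: (@nm_near_lin _ C^o _ _ _ _ _ _ _ (fd h) (fd' h) qe).
- exact: Rep_linear.
- exact: nm_near_lin dA dB qe.
Qed.

Lemma isPi_invol m f A : isPi m f A -> isPi m (invol f) (op_star A).
Proof.
move=> fA e e0; have [d [A' [hd sd fd RA dA]]] := fA e e0.
exists (invol d), (op_star A'); split.
- exact: level_invol.
- by move=> [[x y] xy] /=; rewrite /invol /= conjC_eq0 => /(ev_supp sd)/agN_sym.
- move=> [[x y] xy]; rewrite /invol /= -rmorphB nm_conj.
  by apply: (ev_rel (P := fun u v => nm (u - v) <= e)) => //; rewrite subrr nm0 ltW.
- exact: Rep_invol.
- have := nm_adj (A - A' : BH H); rewrite cs_adjB => nE; apply: le_trans dA; rewrite -nE; exact: lexx.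
Qed.

Lemma uapp_mul m f g x y : Cc f -> Cc g -> supp f m -> supp g m ->
  uapp m x (fun z => ev f x z * ev g z y).
Proof.
move=> fC gC sf sg; split=> [z|e e0].
  by rewrite mulf_eq0 negb_or => /andP[/(ev_supp sf)].
have [F F0 fF] := Cc_bounded hL hprim hr fC; have [G G0 gG] := Cc_bounded hL hprim hr gC.
have [q [q0 q1 qe]] := small_factor e0 (addr_ge0 (addr_ge0 F0 ler01) G0).
have [N [c [_ fc _]]] := Cc_approx fC sf q0; have [N' [c' [_ gc _]]] := Cc_approx gC sg q0.
have hd : level_fun (Ef N c) by do 2 eexists.
have hd' : level_fun (Ef N' c') by do 2 eexists.
have [M /(_ M (leqnn M))[d [d' [dE dE']]]] := level_at2 hd hd'.
exists M, (fun i => if `[< agN M x y >] then d (win M x) i * d' i (win M y) else 0) => z.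
have <- := congr1 (fun F => F z) (ev_mul_lev M d d' x y); rewrite /= -dE -dE'.
have b1 : nm (ev f x z - ev (Ef N c) x z) <= q.
  by apply: (ev_rel (P := fun u v => nm (u - v) <= q)) => //; rewrite subrr nm0 ltW.
have b2 : nm (ev g z y - ev (Ef N' c') z y) <= q.
  by apply: (ev_rel (P := fun u v => nm (u - v) <= q)) => //; rewrite subrr nm0 ltW.
have b3 : nm (ev f x z) <= F by apply: (ev_rel (P := fun u _ => nm u <= F) (g := f)) => //; rewrite nm0.
have b4 : nm (ev g z y) <= G by apply: (ev_rel (P := fun u _ => nm u <= G) (g := g)) => //; rewrite nm0.
by apply: le_trans qe; exact: nm_mul_near b1 b2 b3 b4 q1.
Qed.

Lemma supp_convol m f g : supp f m -> supp g m -> supp (convol f g) m.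
Proof.
move=> sf sg [[x y] xy]; apply: contra_neqP => no; rewrite /convol /=.
have -> : (fun z => ev f x z * ev g z y) = lev 0 x (fun=> 0).
  apply/funext => z; rewrite /lev if_same.
  have [->|/(ev_supp sf) xz] := eqVneq (ev f x z) 0; first by rewrite mul0r.
  have [->|/(ev_supp sg) zy] := eqVneq (ev g z y) 0; first by rewrite mulr0.
  by case: no; exact: agN_trans zy.
by rewrite (Cintegral_lev hL hprim hr t_gt0 haar) isum0.
Qed.

Lemma isPi_convol m f g A B : Cc f -> Cc g -> supp f m -> supp g m ->
  isPi m f A -> isPi m g B -> isPi m (convol f g) (op_mul A B).
Proof.
move=> fC gC sf sg fA gB e e0.
have [F F0 fF] := Cc_bounded hL hprim hr fC; have [G G0 gG] := Cc_bounded hL hprim hr gC.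
have w0 := wtot_ge0 t_gt0 a_gt0 m.
(* K1 comes from the integrand error q (F + 1 + G) over a set of measure at most wtot m, doubled for
   real and imaginary parts; K2 from the error in the product of the operators. *)
pose K1 := 2 * ((F + 1 + G) * wtot m); pose K2 := nm A + 1 + nm B.
have K10 : 0 <= K1 by rewrite !mulr_ge0 // !addr_ge0.
have K20 : 0 <= K2 by exact: addr_ge0 (addr_ge0 (nm_ge0 A) ler01) (nm_ge0 B).
have [q [q0 q1 qe]] := small_factor e0 (addr_ge0 K10 K20).
have [d [A' [hd sd fd RA dA]]] := fA q q0; have [d' [B' [hd' sd' fd' RB dB]]] := gB q q0.
exists (convol d d'), (op_mul A' B'); split.
- exact: (level_convol hL hprim hr t_gt0 haar).
- exact: supp_convol.
- move=> [[x y] xy]; rewrite /convol /=.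
  have qF : 0 <= q * (F + 1 + G) by rewrite mulr_ge0 ?addr_ge0 // ltW.
  have hdC := level_Cc hL hprim hr hd; have hdC' := level_Cc hL hprim hr hd'.
  apply: le_trans (Cintegral_close hL hprim hr t_gt0 a_gt0 haar qF (uapp_mul x y fC gC sf sg)
    (uapp_mul x y hdC hdC' sd sd') _) _; last first.
    apply: le_trans qe; rewrite [leRHS]mulrDr [leLHS](_ : _ = q * K1); last by rewrite /K1; ring.
    by rewrite lerDl; exact: mulr_ge0 (ltW q0) K20.
  move=> z; have b1 : nm (ev f x z - ev d x z) <= q.
    by apply: (ev_rel (P := fun u v => nm (u - v) <= q)) => //; rewrite subrr nm0 ltW.
  have b2 : nm (ev g z y - ev d' z y) <= q.
    by apply: (ev_rel (P := fun u v => nm (u - v) <= q)) => //; rewrite subrr nm0 ltW.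
  have b3 : nm (ev f x z) <= F by apply: (ev_rel (P := fun u _ => nm u <= F) (g := f)) => //; rewrite nm0.
  have b4 : nm (ev g z y) <= G by apply: (ev_rel (P := fun u _ => nm u <= G) (g := g)) => //; rewrite nm0.
  exact: nm_mul_near b1 b2 b3 b4 q1.
- exact: Rep_convol.
have -> : op_mul A B - op_mul A' B' = ((A - A') ** B + A' ** (B - B') : BH H).
  by rewrite cs_mulBl cs_mulBr addrA subrK.
apply: le_trans (nmD _ _) _.
have b5 : nm A' <= nm A + 1 by apply: le_trans (nm_nearC dA) _; rewrite lerD2l.
have c1 := le_trans (nm_cs_mul (A - A') B) (ler_wpM2r (nm_ge0 B) dA).
have c2 := le_trans (nm_cs_mul A' (B - B')) (ler_pM (nm_ge0 _) (nm_ge0 _) b5 dB).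
apply: le_trans (lerD c1 c2) _; apply: le_trans qe; rewrite [leRHS]mulrDr.
rewrite [X in X <= _](_ : _ = q * K2); first by rewrite lerDr; exact: mulr_ge0 (ltW q0) K10.
by rewrite (mulrC _ q) -mulrDr addrC.
Qed.

Lemma isPi_bound m f A K : Cc f -> supp f m -> isPi m f A -> 0 <= K -> Ibound f K -> nm A <= K.
Proof.
move=> fC sf fA K0 fK; apply/ler_addgt0Pr => e e0.
have w0 := wtot_ge0 t_gt0 a_gt0 m; have [q [q0 _ qe]] := small_factor e0 (addr_ge0 w0 ler01).
have [d [A' [hd sd fd RA dA]]] := fA q q0.
have dK := Ibound_close hL hprim hr t_gt0 a_gt0 haar fC (level_Cc hL hprim hr hd) sf sd (ltW q0) fd fK.
have K0' : 0 <= K + q * wtot m by rewrite addr_ge0 // mulr_ge0 // ltW.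
apply: le_trans (nm_near dA) _; apply: le_trans (lerD (Rep_bound hd RA K0' dK) (lexx q)) _.
by rewrite -addrA lerD2l -{2}[q]mulr1 -mulrDr.
Qed.

Definition inPi f (A : BH H) := exists m, supp f m /\ isPi m f A.

Lemma inPi_uniq f A B : inPi f A -> inPi f B -> A = B.
Proof.
move=> [m [_ fA]] [m' [_ fB]]; apply: (@isPi_uniq (maxn m m') f).
  exact: isPi_le (leq_maxl _ _) fA.
exact: isPi_le (leq_maxr _ _) fB.
Qed.

Lemma inPi_ex f : Cc f -> exists2 A, inPi f A & exists2 m, supp f m & isPi m f A.
Proof.
move=> fC; have [m sf] := Cc_supp fC; have [A fA] := isPi_ex fC sf.
by exists A; [exists m | exists m].
Qed.

(** [representation] asks for a total function, so the operator is chosen when there is one;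
    [inPi_uniq] makes the choice immaterial. *)
Definition pi f (v : H) : H :=
  if pselect (exists A, inPi f A) is left h then sval (cid h) (inl v) else 0.

Lemma piE f A : inPi f A -> forall v, pi f v = A (inl v).
Proof.
move=> fA v; rewrite /pi; case: pselect => [h|[]]; last by exists A.
by rewrite (inPi_uniq (svalP (cid h)) fA).
Qed.

Lemma pi_representation : representation mut pi.
Proof.
split=> [f fC c v w|f g fC gC c v|f g fC gC v|f fC v w|f fC v].
- by have [A fA _] := inPi_ex fC; rewrite !(piE fA) opD opZ.
- have [A fA [m sf mA]] := inPi_ex fC; have [B gB [m' sg mB]] := inPi_ex gC.
  rewrite (piE fA) (piE gB) -(op_scaleE c A) -op_addE; apply: piE.
  exists (maxn m m'); split; last exact: (isPi_linear c (isPi_le (leq_maxl _ _) mA) (isPi_le (leq_maxr _ _) mB)).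
  by apply: suppD; [exact: supp_le (leq_maxl _ _) _ | exact: supp_le (leq_maxr _ _) _].
- have [A fA [m sf mA]] := inPi_ex fC; have [B gB [m' sg mB]] := inPi_ex gC.
  have sf' := supp_le (leq_maxl m m') sf; have sg' := supp_le (leq_maxr m m') sg.
  rewrite (piE fA) (piE gB); apply: (piE (A := op_mul A B)); exists (maxn m m').
  split; first exact: supp_convol.
  exact: (isPi_convol fC gC sf' sg' (isPi_le (leq_maxl _ _) mA) (isPi_le (leq_maxr _ _) mB)).
- have [A fA [m sf mA]] := inPi_ex fC.
  have fA' : inPi (invol f) (op_star A).
    exists m; split; last exact: isPi_invol.
    by move=> [[x y] xy] /=; rewrite /invol /= conjC_eq0 => /(ev_supp sf)/agN_sym.
  by rewrite (piE fA) (piE fA'); exact: op_adj.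
- have [A fA [m sf mA]] := inPi_ex fC; rewrite (piE fA) !nmE -rmorphM lecR.
  have [K K0 fK] := Ibound_ex hL hprim hr t_gt0 a_gt0 haar fC.
  have [fI I0 _] := I_norm_fine x0 fK.
  apply: le_trans (nm_op A (inl v)) _; apply: ler_wpM2r; first exact: nm_ge0.
  exact: isPi_bound mA I0 fI.
Qed.

Definition delta2 (l l' u u' : L) : C := (u == l)%:R * (u' == l')%:R.

Lemma isum_delta N (j : pathT L (cst (N + N))) (b : L -> C) :
  isum t a N (kg_s (pv j)) (fun l => (l == pv j)%:R * b l) = (wt N (pv j))%:C%C * b (pv j).
Proof.
rewrite /isum (bigD1_seq j) ?filter_uniq ?index_enum_uniq ?blk_in //= eqxx mul1r big1 ?addr0 // => i ij.
by rewrite (inj_eq (@pv_inj k L _)) (negbTE ij) mul0r mulr0.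
Qed.

(** The kernel sends the indicator of the cell of x0 to a positive multiple of itself, the factor
    being the measure of the cell. *)
Lemma pi_neq0 N : exists v, pi (Ef N (delta2 (win N x0) (win N x0))) v <> 0.
Proof.
set l0 := win N x0; set f := Ef N _; have hf : level_fun f by do 2 eexists.
have [A fA] := Rep_ex hf; have V : levels x0 (lev N x0 (fun l => (l == l0)%:R : C)) by do 2 eexists.
have V' := lkop hf V; exists (vec V); rewrite (piE (A := A)); last first.
  by exists N; split; [exact: Ef_neq0 | apply: (isPi_level hf _ fA); exact: Ef_neq0].
rewrite (fA _ V V') => v0; have : @pn R E (kop f (lev N x0 (fun l => (l == l0)%:R : C))) ^+ 2 = 0.
  by rewrite -(@nm_vec R E _ V') v0 nm0 expr0n.
rewrite /f (kop_lev hL hprim hr t_gt0 haar) pn_lev.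
have [i iE] := win_pathT hL hprim hr N x0.
have si : kg_s (pv i) = bp_obj x0 (cz N) by rewrite iE; exact: bp_s.
apply/eqP; rewrite gt_eqF // (bigD1_seq i) ?filter_uniq ?index_enum_uniq ?blk_in ?si //=.
have wi := wt_gt0 t_gt0 a_gt0 N (pv i : L).
apply: ltr_pwDl; last by apply: sumr_ge0 => j _; rewrite mulr_ge0 ?sqr_ge0 // ltW // wt_gt0.
rewrite mulr_gt0 // exprn_gt0 // -si.
have -> : isum t a N (kg_s (pv i)) (fun j => delta2 l0 l0 (pv i) j * (j == l0)%:R) = (wt N (pv i))%:C%C * 1.
  rewrite -(isum_delta i (fun=> 1)); apply: eq_isum => j _; rewrite /delta2 (_ : l0 = pv i) // eqxx mul1r mulr1.
  by case: eqP => _; rewrite ?mulr1 ?mulr0.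
by rewrite mulr1 nmR normr_gt0 gt_eqF.
Qed.

End RegularRepresentation.

(** * The stable algebra *)

Section StableAlgebra.
Variables (k : nat) (L : kgraph k) (R : realType).
Local Notation C := (complex R).
Implicit Types (f g : Gs L -> C) (c : L -> L -> C).
Local Notation cst := (@cst k).
Local Notation cz := (@cz k).
Hypothesis hL : inhabited (kg_obj L).
Hypothesis hprim : primitive L.
Hypothesis hr : surjective_finite_to_one (@kg_r k L).
Hypothesis hs : surjective_finite_to_one (@kg_s k L).
Variables (t : 'I_k -> R) (a : kg_obj L -> R).
Variable mut : forall x : bipath L, {measure set (borel_at x) -> \bar R}.
Hypothesis t_gt0 : forall i, 0 < t i.
Hypothesis a_gt0 : forall v, 0 < a v.
Hypothesis haar : stable_haar_system t a mut.
Variables (S : cstar R) (iota : (Gs L -> C) -> S).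
Hypothesis hS : is_stable_algebra mut iota.
Local Notation wt := (wt t a).
Local Notation T N := (pathT L (cst (N + N))).

Lemma iotaD f g (c : C) : level_fun f -> level_fun g ->
  iota (fun h => c * f h + g h) = c *: iota f + iota g.
Proof. by move=> hf hg; have [+ _ _ _ _] := hS; apply; exact: level_Cc. Qed.

Lemma level0 : level_fun (fun _ : Gs L => 0 : C).
Proof. by exists 0%N, (fun _ _ => 0); apply/funext => g; rewrite /Ef if_same. Qed.

Lemma iota0 : iota (fun=> 0) = 0.
Proof.
have := iotaD 1 level0 level0; rewrite (_ : (fun _ => _) = (fun=> 0)).
  by rewrite scale1r => /(congr1 (fun u => u - iota (fun=> 0))); rewrite subrr addrK => <-.
by apply/funext => g; rewrite mulr0 addr0.
Qed.

Lemma iotaZ f (c : C) : level_fun f -> iota (fun h => c * f h) = c *: iota f.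
Proof.
move=> hf; have := iotaD c hf level0; rewrite iota0 addr0 => <-; congr iota.
by apply/funext => h; rewrite addr0.
Qed.

Lemma iota_sum (J : Type) (r : seq J) (F : J -> Gs L -> C) (u : J -> C) :
  (forall j, level_fun (F j)) ->
  level_fun (fun h => \sum_(j <- r) u j * F j h) /\
  iota (fun h => \sum_(j <- r) u j * F j h) = \sum_(j <- r) u j *: iota (F j).
Proof.
move=> hF; elim: r => [|j r [IH1 IH2]].
  have -> : (fun h => \sum_(j <- [::]) u j * F j h) = (fun=> 0) by apply/funext => h; rewrite big_nil.
  by rewrite big_nil iota0; split=> //; exact: level0.
have -> : (fun h => \sum_(i <- j :: r) u i * F i h) = (fun h => u j * F j h + \sum_(i <- r) u i * F i h).
  by apply/funext => h; rewrite big_cons.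
by rewrite big_cons iotaD // IH2; split=> //; exact: level_funD.
Qed.

Lemma level_Ef N c : level_fun (Ef N c).
Proof. by do 2 eexists. Qed.

Lemma Ef_expand N c : Ef N c = fun h =>
  \sum_(p : T N * T N) c (pv p.1) (pv p.2) * Ef N (delta2 R (pv p.1) (pv p.2)) h.
Proof.
apply/funext => h; rewrite /Ef; case: asboolP => hN; last by rewrite big1 // => p _; rewrite mulr0.
have [i <-] := win_pathT hL hprim hr N (sval h).1; have [j <-] := win_pathT hL hprim hr N (sval h).2.
rewrite (bigD1 (i, j)) //= /delta2 !eqxx !mulr1 big1 ?addr0 // => -[p q] /=.
rewrite !(inj_eq (@pv_inj k L _)) xpair_eqE (eq_sym p) (eq_sym q).
by case: eqP => _; case: eqP => _ //=; rewrite ?mulr0 ?mul0r ?mulr0.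
Qed.

Lemma wt_pos N (l : L) : 0 < wt N l.
Proof. exact: wt_gt0. Qed.

Definition sqw N (i : T N) : R := Num.sqrt (wt N (pv i)).

Lemma sqw_neq0 N (i : T N) : sqw i != 0.
Proof. by rewrite gt_eqF // sqrtr_gt0 wt_pos. Qed.

Lemma sqw_sqr N (i : T N) : sqw i * sqw i = wt N (pv i).
Proof. by rewrite -expr2 sqr_sqrtr // ltW // wt_pos. Qed.

(** Convolving the indicators of (i, j) and (j, l) produces the weight of j as a factor; dividing by
    the square roots of the outer weights removes it and is compatible with the involution. *)
Definition gunit N (i j : T N) : S :=
  ((sqw i * sqw j)^-1)%:C%C *: iota (Ef N (delta2 R (pv i) (pv j))).

Lemma iota_delta N (i j : T N) :
  iota (Ef N (delta2 R (pv i) (pv j))) = (sqw i * sqw j)%:C%C *: gunit i j.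
Proof. by rewrite scalerA -rmorphM divff ?mulf_neq0 ?sqw_neq0 // scale1r. Qed.

Lemma iota_Ef N c : iota (Ef N c) =
  mx_sum (@gunit N) (fun i j => c (pv i) (pv j) * (sqw i * sqw j)%:C%C).
Proof.
rewrite Ef_expand (iota_sum _ _ _).2; last by move=> p; exact: level_Ef.
by rewrite /mx_sum pair_big /=; apply: eq_bigr => -[i j] _; rewrite iota_delta scalerA.
Qed.

Lemma gunit_block N (i j : T N) : kg_s (pv i) != kg_s (pv j) -> gunit i j = 0.
Proof.
move=> ij; rewrite /gunit (_ : Ef _ _ = fun=> 0) ?iota0 ?scaler0 //.
apply/funext => h; rewrite /Ef; case: asboolP => // hN; rewrite /delta2.
case: eqP => [h1|]; last by rewrite mul0r.
case: eqP => [h2|]; last by rewrite mulr0.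
by case/eqP: ij; rewrite -h1 -h2 (agN_src hN) bp_s.
Qed.

Lemma iotaM f g : level_fun f -> level_fun g -> iota f ** iota g = iota (convol mut f g).
Proof. by move=> hf hg; have [_ + _ _ _] := hS; move=> ->; [|exact: level_Cc|exact: level_Cc]. Qed.

Lemma gunitM0 N (i j p l : T N) : j != p -> gunit i j ** gunit p l = 0.
Proof.
move=> jp; rewrite /gunit cs_mulZl cs_mulZr iotaM; [|exact: level_Ef|exact: level_Ef].
rewrite (convol_Ef hL hprim hr t_gt0 haar) (_ : Ef _ _ = fun=> 0) ?iota0 ?scaler0 //.
apply/funext => h; rewrite /Ef; case: asboolP => // _.
rewrite -[RHS](isum0 t a N (kg_s (win N (sval h).1))); apply: eq_isum => q _.
rewrite /delta2; case: (pv q =P pv j) => [->|]; last by rewrite mulr0 mul0r.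
by rewrite (inj_eq (@pv_inj k L _)) (negbTE jp) mul0r mulr0.
Qed.

Lemma gunitM N (i j l : T N) : kg_s (pv i) = kg_s (pv j) -> gunit i j ** gunit j l = gunit i l.
Proof.
move=> ij; rewrite /gunit cs_mulZl cs_mulZr iotaM; [|exact: level_Ef|exact: level_Ef].
rewrite (convol_Ef hL hprim hr t_gt0 haar).
rewrite (_ : Ef _ _ = fun h => (wt N (pv j))%:C%C * Ef N (delta2 R (pv i) (pv l)) h); last first.
  apply/funext => h; rewrite /Ef; case: asboolP => [_|]; last by rewrite mulr0.
  rewrite [in RHS]/delta2; case: eqP => [->|no]; last first.
    rewrite mul0r mulr0 -[RHS](isum0 t a N (kg_s (win N (sval h).1))); apply: eq_isum => q _.
    by rewrite /delta2; case: eqP => // _; rewrite !mul0r.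
  rewrite ij mul1r.
  have -> : (win N (sval h).2 == pv l)%:R = delta2 R (pv j) (pv l) (pv j) (win N (sval h).2).
    by rewrite /delta2 eqxx mul1r.
  rewrite -(isum_delta t a j (fun q => delta2 R (pv j) (pv l) q (win N (sval h).2))).
  by apply: eq_isum => q _; rewrite {1}/delta2 eqxx mul1r.
rewrite iotaZ; last exact: level_Ef.
rewrite !scalerA -!rmorphM; congr (_%:C%C *: _); rewrite -sqw_sqr.
by field; rewrite !sqw_neq0.
Qed.

Lemma gunitJ N (i j : T N) : (gunit i j)^# = gunit j i.
Proof.
have [_ _ h _ _] := hS; rewrite /gunit cs_adjZ -h; last by apply: level_Cc => //; exact: level_Ef.
rewrite invol_Ef (mulrC (sqw j)); congr (_ *: iota (Ef N _)).
  by apply/eqP; rewrite eq_complex /= oppr0 !eqxx.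
by apply/funext => u; apply/funext => u'; rewrite /delta2 rmorphM /= !conjC_nat mulrC.
Qed.

Lemma gunit_mono N (i j : T N) : mx_span (@gunit N.+1) (gunit i j).
Proof.
have [_ _ sc] := mx_span_subspace (@gunit N.+1).
by apply: sc; rewrite (Ef_raise _ (leqnSn N)) iota_Ef; eexists.
Qed.

(** The window is prolonged forwards to the prescribed source by primitivity, and backwards by
    surjectivity of s. *)
Lemma extend_window N : exists M0, forall M, (M0 <= M)%N -> forall (i : T N) (v : kg_obj L),
  exists l : T M, [/\ (N <= M)%N, mid N M (pv l) = pv i & kg_s (pv l) = v].
Proof.
have [M0 MP] := connect_exists hprim hr N; exists (maxn M0 N) => M; rewrite geq_max => /andP[/MP conn NM] i v.
have [b [db rb sb]] := conn (kg_s (pv i)) v.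
have [[u [du su]] _] := hs (cst (M - N)) (kg_r (pv i)).
have di : kg_d (pv i) = cst (N + N) by exact: (pvP hL hprim hr).
have E1 : kg_s (pv i) = kg_r b by rewrite rb.
have E2 : kg_s u = kg_r (kg_comp (pv i) b) by rewrite kg_r_comp.
have [|l lE] := pathT_ex hL hprim hr (n := cst (M + M)) (x := kg_comp u (kg_comp (pv i) b)).
  by rewrite !kg_d_comp // du di db; apply/ffunP => q; rewrite !ffunE; flia.
exists l; split=> //; last by rewrite lE !kg_s_comp.
have sg : seg (pv l) (cst (M - N)) (pv i) by exists u, b; split=> //; rewrite lE.
by have := subE sg; rewrite di.
Qed.

Lemma gunit_conn N (i : T N) : exists M0, forall M, (M0 <= M)%N -> forall j : T M,
  exists x y, [/\ mx_span (@gunit M) x, mx_span (@gunit M) y & gunit j j = x ** gunit i i ** y].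
Proof.
have [M0 MP] := extend_window N; exists M0 => M /MP ext j.
have [l [NM lE sl]] := ext i (kg_s (pv j)).
set w := sqw i * sqw i; set w' := sqw l * sqw l.
have w0 : w != 0 by rewrite mulf_neq0 ?sqw_neq0.
have w'0 : w' != 0 by rewrite mulf_neq0 ?sqw_neq0.
have sj : kg_s (pv j) = kg_s (pv l) by rewrite sl.
have [_ _ sc] := mx_span_subspace (@gunit M).
(* Raised to level M, the unit e_ii has coefficient w'/w at (l, l), because the normalisation
   changes with the level. *)
exists ((w / w')%:C%C *: gunit j l), (gunit l j); split; [|exact: mx_span_e|].
  by apply: sc; exact: mx_span_e.
rewrite [X in _ ** X ** _]/gunit -/w (Ef_raise _ NM) iota_Ef cs_mulZl cs_mulZr cs_mulZl.
have blk0 := @gunit_block M; have mulM := @gunitM M; have mul0 := @gunitM0 M.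
rewrite cs_mulZl (e_mx_sum mulM mul0) // cs_suml (bigD1 l) //= [X in _ + X]big1 ?addr0; last first.
  by move=> q ql; rewrite cs_mulZl gunitM0 // scaler0.
rewrite cs_mulZl gunitM //; move: (gunit j j) => G; rewrite !scalerA /raise2 eqxx lE /delta2 eqxx !mul1r -/w' -!rmorphM.
have E : w / w' / w * w' = 1 by field; rewrite w0 w'0.
by rewrite -[LHS]scale1r; congr (_ *: _); rewrite E.
Qed.

Lemma gunit_neq0 : exists N (i : T N), gunit i i <> 0.
Proof.
have [x0 _] := bipath_exists hr hs hL.
have [i iE] := win_pathT hL hprim hr 0 x0; exists 0%N, i => u0.
have [v pv0] := pi_neq0 hL hprim hr t_gt0 a_gt0 haar x0 0.
have [_ _ _ _ h] := hS; have [h1 _] := h _ (level_Cc hL hprim hr (level_Ef 0 (delta2 R (pv i) (pv i)))).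
apply: pv0; rewrite -iE; apply/eqP; rewrite -normr_le0.
have := h1 _ _ (pi_representation hL hprim hr t_gt0 a_gt0 haar x0) v.
by rewrite iota_delta u0 scaler0 normr0 mul0r.
Qed.

Lemma CcD (u : C) f g : Cc f -> Cc g -> Cc (fun h => u * f h + g h).
Proof.
move=> fC gC; have [m sf] := Cc_supp fC; have [m' sg] := Cc_supp gC.
have [cf _] := fC; have [cg _] := gC; split.
  move=> h U /= /(@nbhsC R C^o)[e e0 eU]; have e2 : 0 < e / 2 by lra.
  have [q [q0 _ qe]] := small_factor e2 (addr_ge0 (nm_ge0 u) ler01).
  have F1 : nbhs h (f @^-1` [set w : C^o | nm (f h - w) < q]).
    by apply: (cf h); apply/(@nbhsC R C^o); exists q.
  have F2 : nbhs h (g @^-1` [set w : C^o | nm (g h - w) < q]).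
    by apply: (cg h); apply/(@nbhsC R C^o); exists q.
  apply: filterS2 F1 F2 => h' h1 h2; apply: eU.
  by apply: le_lt_trans (@nm_near_lin _ C^o _ _ _ _ _ _ _ (ltW h1) (ltW h2) qe) _; lra.
have sfg : supp (fun h => u * f h + g h) (maxn m m').
  by apply: suppD => h h0; [exact: agN_le (leq_maxl m m') (sf h h0) | exact: agN_le (leq_maxr m m') (sg h h0)].
refine (subclosed_compact _ (@inG_compact k L hL hprim hr (maxn m m')) _); first exact: closed_closure.
by rewrite [X in _ `<=` X](closure_id _).1; [exact: closure_subset | exact: inG_closed].
Qed.

(** The norm of S is the least bound over all representations, and each of them is bounded by the
    I-norm. *)
Lemma nm_iota f K : Cc f -> Ibound mut f K -> nm (iota f) <= K.
Proof.
move=> fC fK; have [x0 _] := bipath_exists hr hs hL.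
have [fI I0 IK] := I_norm_fine x0 fK.
have [_ _ _ _ /(_ _ fC)[_ h]] := hS; apply: le_trans IK.
rewrite -lecR -nmE; apply: h => [|H p [_ _ _ _ hp] v]; first by rewrite lecR.
exact: hp.
Qed.

Lemma gunit_dense : closure (af_core gunit) = setT.
Proof.
apply/seteqP; split=> // x _; apply/closureC => e e0.
have [iD _ _ dS _] := hS; have e2 : 0 < e / 2 by lra.
have : closure (iota @` Cc (L := L) (R := R)) x by rewrite dS.
move=> /closureC/(_ _ e2)[_ [f fC <-] xf]; have [m sf] := Cc_supp fC.
(* The total weight of level m is fixed before the level N of the approximant is chosen, as the
   support remains in G_{s,m}. *)
have [q [q0 _ qe]] := small_factor e2 (wtot_ge0 t_gt0 a_gt0 m).
have [N [c [_ fc sc]]] := Cc_approx fC sf q0.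
exists (iota (Ef N c)); first by exists N => //; rewrite iota_Ef; eexists.
have dC : Cc (Ef N c) by exact: Ef_Cc.
have fdC := CcD (-1) dC fC.
have sd : supp (fun h => -1 * Ef N c h + f h) m by exact: suppD.
have fd : nm (iota f - iota (Ef N c)) <= q * wtot t a m.
  rewrite -(scaleN1r (iota _)) addrC -(iD _ _ dC fC (-1)); apply: nm_iota => //.
  apply: (Ibound_small hL hprim hr t_gt0 a_gt0 haar) => //; first exact: ltW.
  by move=> h; rewrite mulN1r addrC.
have := nm_tri x (iota f) (iota (Ef N c)); lra.
Qed.

Theorem stable_algebra_simple_AF : simple_AF_algebra [set: S].
Proof.
rewrite -gunit_dense.
apply: (@matrix_units_simple_AF R S (kg_obj L) (fun N => T N) (fun N i => kg_s (pv i))).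
- by move=> N i j; exact: gunit_block.
- by move=> N i j l; exact: gunitM.
- by move=> N i j p l; exact: gunitM0.
- by move=> N i j; exact: gunitJ.
- by move=> N i j; exact: gunit_mono.
- by move=> N i; exact: gunit_conn.
- exact: gunit_neq0.
Qed.

End StableAlgebra.

Theorem corollary5p4 (R : realType) (k : nat) (hk : (0 < k)%N) (L : kgraph k)
    (hL : inhabited (kg_obj L)) (hprim : primitive L)
    (hr : surjective_finite_to_one (@kg_r k L))
    (hs : surjective_finite_to_one (@kg_s k L)) :
  (forall (A : cstar R) (s : L -> A) (al : ('I_k -> complex R) -> A -> A),
     is_kgraph_algebra s -> is_gauge_action s al ->
     simple_AF_algebra (fixed_points al)) /\
  (forall (t : 'I_k -> R) (a b : kg_obj L -> R)
     (mut : forall x : bipath L, {measure set (borel_at x) -> \bar R}),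
     perron_frobenius t a b -> stable_haar_system t a mut ->
     forall (S : cstar R) (iota : (Gs L -> complex R) -> S),
       is_stable_algebra mut iota ->
       simple_AF_algebra (setT : set S)).
Proof.
split=> [A s al hA hal|t a b mut [t_gt0 ab_gt0 _ _ _] haar S iota hS].
  exact: kgraph_core_simple_AF hA hal.
have a_gt0 v : 0 < a v by have [] := ab_gt0 v.
exact: stable_algebra_simple_AF hS.
Qed.
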